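(* Let $\alpha\in(1,2)$ and $\beta\in[-1,1]$, and let $Z\sim S_\alpha(1,\beta)$, with density $p_Z$. Then $\eta_{\alpha,\beta}:=\mathrm{Beta}\big(\tfrac2\alpha,1-\tfrac1\alpha\big)\int_{\mathbb{R}}|p_Z'(y)|\,dy<\infty$, and for any integrable random variable $X$, \[ d_W(\mathcal{L}(X),\mathcal{L}(Z))\leqslant \sup_{\substack{\phi\in C^2(\mathbb{R}):\ \|\phi'\|_\infty\leqslant\alpha,\\ \|\phi''\|_\infty\leqslant\eta_{\alpha,\beta}}}\Big|\mathbb{E}[(\mathcal{L}^{\alpha,\beta}\phi)(X)]-\frac1\alpha\mathbb{E}[X\phi'(X)]\Big|. \]
   Context: For $\alpha\in(1,2)$, $\sigma>0$, $\beta\in[-1,1]$, $Z\sim S_\alpha(\sigma,\beta)$ means $\mathbb{E}[e^{itZ}]=\exp\{-\sigma^\alpha|t|^\alpha(1-i\beta\,\mathrm{sign}(t)\tan\frac{\pi\alpha}{2})\}$ for all $t\in\mathbb{R}$; this law has a smooth density. For $\phi\in C^2(\mathbb{R})$ with $\|\phi''\|_\infty<\infty$, \[ (\mathcal{L}^{\alpha,\beta}\phi)(x)=d_\alpha\int_{\mathbb{R}}\frac{\phi(u+x)-\phi(x)-u\phi'(x)}{2|u|^{1+\alpha}}\big[(1+\beta)\mathbf{1}_{(0,\infty)}(u)+(1-\beta)\mathbf{1}_{(-\infty,0)}(u)\big]du, \] where $d_\alpha=\big(\int_0^\infty\frac{1-\cos y}{y^{1+\alpha}}dy\big)^{-1}$.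 The Wasserstein distance is $d_W(\mathcal{L}(X),\mathcal{L}(Y))=\sup|\mathbb{E}[h(X)]-\mathbb{E}[h(Y)]|$, the supremum over all $1$-Lipschitz $h:\mathbb{R}\to\mathbb{R}$. $\mathrm{Beta}$ denotes the Euler Beta function. *)

(* Defs.v *)
From HB Require Import structures.
From mathcomp Require Import all_boot all_order all_algebra.
From mathcomp Require Import all_classical all_reals all_analysis.
Set Implicit Arguments. Unset Strict Implicit. Unset Printing Implicit Defensive.
Import Order.TTheory GRing.Theory Num.Theory.
Import numFieldNormedType.Exports.
Local Open Scope classical_set_scope.
Local Open Scope ring_scope.

Definition Beta {R : realType} (a b : R) : R :=
  fine (\int[@lebesgue_measure R]_(t in `[0%R, 1%R])
          ((t `^ (a - 1)) * ((1 - t) `^ (b - 1)))%:E)%E.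

Definition d_alpha {R : realType} (alpha : R) : R :=
  (fine (\int[@lebesgue_measure R]_(y in `]0%R, +oo[)
           ((1 - cos y) / (y `^ (1 + alpha)))%:E)%E)^-1.

Definition gen_integrand {R : realType} (alpha beta : R) (phi : R -> R) (x u : R) : R :=
  (phi (u + x) - phi x - u * derive1 phi x) / (2 * (`|u| `^ (1 + alpha)))
  * (if 0 < u then 1 + beta else if u < 0 then 1 - beta else 0).

Definition Lgen {R : realType} (alpha beta : R) (phi : R -> R) (x : R) : R :=
  d_alpha alpha *
  fine (\int[@lebesgue_measure R]_u (gen_integrand alpha beta phi x u)%:E)%E.

Definition C2 {R : realType} (phi : R -> R) : Prop :=
  (forall x, derivable phi x 1) /\ (forall x, derivable (derive1 phi) x 1) /\
  continuous (derive1 (derive1 phi)).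

(* mu is the law S_alpha(1, beta): its characteristic function is
   exp(-|t|^alpha (1 - i beta sgn(t) tan(pi alpha/2))), written via real and
   imaginary parts. *)
Definition stable_law {R : realType} (alpha beta : R) (mu : probability R R) : Prop :=
  forall t : R,
    (\int[mu]_z (cos (t * z))%:E =
       (expR (- (`|t| `^ alpha)) *
        cos (beta * Num.sg t * (`|t| `^ alpha) * tan (pi * alpha / 2)))%:E /\
     \int[mu]_z (sin (t * z))%:E =
       (expR (- (`|t| `^ alpha)) *
        sin (beta * Num.sg t * (`|t| `^ alpha) * tan (pi * alpha / 2)))%:E)%E.

Definition is_density {R : realType} (mu : probability R R) (p : R -> R) : Prop :=
  (forall x, 0 <= p x) /\ measurable_fun setT p /\
  forall A : set R, measurable A ->
    mu A = (\int[@lebesgue_measure R]_(x in A) (p x)%:E)%E.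

Definition dW {R : realType} {d : measure_display} {T : measurableType d}
  (P : probability T R) (X : T -> R) (mu : probability R R) : \bar R :=
  ereal_sup [set `| (\int[P]_w (h (X w))%:E - \int[mu]_z (h z)%:E)%E |%E
            | h in [set h : R -> R | forall x y, `|h x - h y| <= `|x - y|]].

(* Main.v *)
(* Stein's method along the semigroup of the stable law.  For a trigonometric
   polynomial T put T_v(x) = E T(x + (1 - v)^(1/alpha) Z); then
     phi(x) = - int_0^1 v^(-1) (T_v(v^(1/alpha) x) - T_v(0)) dv
   solves L phi (x) - x phi'(x) / alpha = T(x) - E T(Z), because L acts on each
   frequency by an explicit multiplier, so that the left-hand side is the
   integral of d/dv T_v(v^(1/alpha) x).  Computing the multiplier requires the
   ratio of int (u - sin u) u^(-1-alpha) du and int (1 - cos u) u^(-1-alpha) du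
   over (0, oo), obtained by rotating the half-line of integration in the
   complex plane.  If |T'| <= 1 then phi' is bounded by
   int_0^1 v^(1/alpha - 1) dv = alpha, and integrating E T''(y + b Z) by parts
   against the density gives |E T''(y + b Z)| <= b^(-1) int |p'|, whence
   |phi''| <= Beta(2/alpha, 1 - 1/alpha) int |p'|.  The integral of |p'| is
   finite because Fourier inversion (by the Poisson kernel) writes p' as an
   oscillatory integral to which two integrations by parts apply, so that
   p'(x) = O(1 / (1 + x^2)).  Finally, a 1-Lipschitz h is approximated by
   1-Lipschitz trigonometric polynomials: replace h(x) by h(N sin (x / N)) and
   take Bernstein polynomials in sin (x / N). *)

Require Import Defs.
From HB Require Import structures.
From mathcomp Require Import all_boot all_order all_algebra.
From mathcomp Require Import ring lra.
From mathcomp Require Import all_classical all_reals all_analysis measurable_realfun.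
Set Implicit Arguments. Unset Strict Implicit. Unset Printing Implicit Defensive.
Import Order.TTheory GRing.Theory Num.Theory.
Import numFieldNormedType.Exports.
Local Open Scope classical_set_scope.
Local Open Scope ring_scope.

(** * Differentiation rules *)

(** The test functions must satisfy the bounds [alpha] and [eta] exactly, so no constant may be lost
    in an approximation. Trigonometric polynomials make T_v a finite sum with explicit coefficients:
    regularity, the exchange of L with the integral in v and the Stein equation all reduce to
    estimates on single frequencies. The bounds stay exact because the approximants of h are
    themselves 1-Lipschitz, and this is why Bernstein polynomials are taken: they do not increase
    the Lipschitz constant. The weight v^(-1) is not integrable at 0. Subtracting T_v(0) gains a
    factor v^(1/alpha), and the majorants used for Fubini keep that factor. The law of Z is given by
    its characteristic function only. Hence E|Z| < oo has to be extracted from it, and p, an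
    arbitrary C^1 density, has to be identified at every point with the inversion integral. In the
    bound on phi'' the two derivatives of T_v(v^(1/alpha) x) turn v^(-1) into v^(2/alpha - 1), while
    b = (1 - v)^(1/alpha) contributes (1 - v)^(-1/alpha): the product is the integrand of Beta. *)

Section calculus_rules.
Context {R : realType}.
Implicit Types (f g F : R -> R) (x a b c : R).

Lemma derive_add f g x a b : is_derive x 1 f a -> is_derive x 1 g b ->
  is_derive x 1 (fun y => f y + g y) (a + b).
Proof. by move=> fa gb; exact: is_deriveD. Qed.

Lemma derive_sub f g x a b : is_derive x 1 f a -> is_derive x 1 g b ->
  is_derive x 1 (fun y => f y - g y) (a - b).
Proof. by move=> fa gb; exact: is_deriveB. Qed.

Lemma derive_opp f x a : is_derive x 1 f a -> is_derive x 1 (fun y => - f y) (- a).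
Proof. by move=> fa; exact: is_deriveN. Qed.

Lemma derive_mul f g x a b : is_derive x 1 f a -> is_derive x 1 g b ->
  is_derive x 1 (fun y => f y * g y) (a * g x + f x * b).
Proof.
move=> fa gb; apply: (@is_derive_eq _ _ _ _ _ _ _ _ (is_deriveM fa gb)).
by rewrite /GRing.scale/= addrC (mulrC a).
Qed.

Lemma derive_scale c f x a : is_derive x 1 f a ->
  is_derive x 1 (fun y => c * f y) (c * a).
Proof. by move=> fa; exact: (is_deriveZ c fa). Qed.

Lemma derive_comp f g x a b : is_derive (g x) 1 f a -> is_derive x 1 g b ->
  is_derive x 1 (fun y => f (g y)) (a * b).
Proof. exact: is_derive1_comp. Qed.

Lemma derive_cos f x a : is_derive x 1 f a ->
  is_derive x 1 (fun y => cos (f y)) (- sin (f x) * a).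
Proof. by move=> fa; apply: derive_comp. Qed.

Lemma derive_sin f x a : is_derive x 1 f a ->
  is_derive x 1 (fun y => sin (f y)) (cos (f x) * a).
Proof. by move=> fa; apply: derive_comp. Qed.

Lemma derive_exp f x a : is_derive x 1 f a ->
  is_derive x 1 (fun y => expR (f y)) (expR (f x) * a).
Proof. by move=> fa; apply: derive_comp. Qed.

Lemma derive_pow c f x a : 0 < f x -> is_derive x 1 f a ->
  is_derive x 1 (fun y => f y `^ c) (c * f x `^ (c - 1) * a).
Proof. by move=> fx fa; apply: (derive_comp (f := fun y => y `^ c)) fa; exact: is_derive1_powR. Qed.

Lemma derive_idc x : is_derive x 1 (fun y : R => y) 1.
Proof. exact: is_derive_id. Qed.

Lemma derive_cstc c x : is_derive x 1 (fun _ : R => c) 0.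
Proof. exact: is_derive_cst. Qed.

Lemma derive_eq f x a b : is_derive x 1 f a -> a = b -> is_derive x 1 f b.
Proof. by move=> fa <-. Qed.

Lemma is_derive_to_derive1 f x a : is_derive x 1 f a -> derive1 f x = a.
Proof. by move=> fa; rewrite derive1E; exact: derive_val. Qed.

Lemma is_derive_to_continuous f x a : is_derive x 1 f a -> {for x, continuous f}.
Proof.
by move=> fa; apply/differentiable_continuous/derivable1_diffP; exact: ex_derive.
Qed.

(** A quadratic remainder bound is an inequality, so it passes through finite sums and integrals. It
    serves as differentiation under the sum or integral sign for [trigp], [stein_int] and
    [osc_int]. *)
Lemma is_derive_quadratic f x a c :
  (forall h, `|f (x + h) - f x - h * a| <= c * h ^+ 2) -> is_derive x 1 f a.
Proof.
move=> H.
suff K : h^-1 *: ((f \o shift x) (h *: 1) - f x) @[h --> 0^'] --> (a : R).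
  apply: DeriveDef; first by apply/cvg_ex; exists a.
  exact: cvg_lim K.
apply/cvgrPdist_le => e e0.
near=> h.
have h0 : h != 0 by near: h; exact: nbhs_dnbhs_neq.
have hn : 0 < `|h| by rewrite normr_gt0.
rewrite /= /GRing.scale/= mulr1 (addrC h).
rewrite distrC -(ler_pM2l hn) -normrM mulrBr mulrA divff// mul1r.
apply: le_trans (H h) _.
have -> : c * h ^+ 2 = `|h| * (c * `|h|).
  by rewrite -(real_normK (num_real h)) expr2; ring.
rewrite ler_pM2l//.
apply: le_trans (_ : (`|c| + 1) * `|h| <= _).
  by rewrite ler_wpM2r// (le_trans (ler_norm c)) // lerDl.
rewrite mulrC -ler_pdivlMr//.
near: h; apply: dnbhs0_le; exact: divr_gt0.
Unshelve. all: by end_near. Qed.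

Lemma continuous_lipschitz f c :
  (forall x y, `|f x - f y| <= c * `|x - y|) -> continuous f.
Proof.
move=> H x; apply/cvgrPdist_le => e e0; near=> y.
apply: le_trans (H _ _) _.
apply: le_trans (_ : (`|c| + 1) * `|x - y| <= _).
  by rewrite ler_wpM2r// (le_trans (ler_norm c)) // lerDl.
rewrite mulrC -ler_pdivlMr//; near: y.
by apply: cvgr_dist_le; [exact: cvg_id|exact: divr_gt0].
Unshelve. all: by end_near. Qed.

Lemma mvt_le f (df : R -> R) (c a b : R) :
  (forall x, Num.min a b <= x <= Num.max a b -> is_derive x 1 f (df x)) ->
  (forall x, Num.min a b <= x <= Num.max a b -> `|df x| <= c) ->
  `|f b - f a| <= c * `|b - a|.
Proof.
wlog ab : a b / a <= b.
  move=> W; have /orP[ab|ba] := le_total a b; first exact: W.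
  move=> H1 H2; rewrite distrC (distrC b).
  by apply: W => // x; rewrite minC maxC; [exact: H1|exact: H2].
rewrite min_l// max_r// => H1 H2.
have [||z zab ->] := @MVT_segment _ f df a b ab.
- by move=> x; rewrite in_itv/= => /andP[/ltW? /ltW?]; apply: H1; apply/andP.
- apply: derivable_within_continuous => x; rewrite in_itv/= => xab.
  by apply: ex_derive; exact: H1.
rewrite normrM ler_wpM2r//; apply: H2; by move: zab; rewrite in_itv.
Qed.

End calculus_rules.

(** The derivative is left as an existential variable and is built by unification, bypassing
    instance search since [is_derive] is a class. Constants come first and a constant left factor is
    tried before a general product, which avoids spurious zero terms. A power leaves the positivity
    of its base as a subgoal. *)
Ltac der1 := first [ notypeclasses refine (derive_idc _)
  | notypeclasses refine (derive_cstc _ _)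
  | notypeclasses refine (derive_scale _ _)
  | notypeclasses refine (derive_mul _ _)
  | notypeclasses refine (derive_add _ _)
  | notypeclasses refine (derive_sub _ _)
  | notypeclasses refine (derive_opp _)
  | notypeclasses refine (derive_cos _)
  | notypeclasses refine (derive_sin _)
  | notypeclasses refine (derive_exp _)
  | notypeclasses refine (derive_pow _ _ _) ].
Ltac der := repeat der1.

Ltac derive := notypeclasses refine (derive_eq _ _); [der; try assumption | rewrite /=].

(** * The fundamental theorem of calculus on open intervals *)

Section exhaustion.
Context {R : realType}.
Notation leb := (@lebesgue_measure R).
Implicit Types (f F : R -> R).

Lemma continuous_segment_within f (a b : R) :
  (forall x, a <= x <= b -> {for x, continuous f}) ->
  {within `[a, b], continuous f}.
Proof.
by move=> cf; apply: continuous_in_subspaceT => x; rewrite inE/= in_itv; exact: cf.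
Qed.

Lemma continuous_segment_integrable f (a b : R) :
  (forall x, a <= x <= b -> {for x, continuous f}) ->
  leb.-integrable `[a, b] (EFin \o f).
Proof.
move=> cf; apply: continuous_compact_integrable; first exact: segment_compact.
exact: continuous_segment_within.
Qed.

Lemma segment_FTC f F (a b : R) : a <= b ->
  (forall x, a <= x <= b -> is_derive x 1 F (f x)) ->
  (forall x, a <= x <= b -> {for x, continuous f}) ->
  (\int[leb]_(x in `[a, b]) (f x)%:E = (F b - F a)%:E)%E.
Proof.
rewrite le_eqVlt => /predU1P[<- _ _|ab dF cf].
  by rewrite set_itv1 integral_set1 subrr.
rewrite (@continuous_FTC2 _ f F)//.
- exact: continuous_segment_within.
- split.
  + by move=> x; rewrite in_itv/= => /andP[/ltW? /ltW?]; apply: ex_derive;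
      apply: dF; apply/andP.
  + apply: cvg_at_right_filter; apply: is_derive_to_continuous.
    by apply: dF; rewrite lexx ltW.
  + apply: cvg_at_left_filter; apply: is_derive_to_continuous.
    by apply: dF; rewrite lexx ltW.
- move=> x; rewrite in_itv/= => /andP[/ltW? /ltW?].
  by apply: is_derive_to_derive1; apply: dF; apply/andP.
Qed.

(** An abstract exhaustion by growing segments, instantiated below with []0, +oo[], []0, 1[] and the
    whole line. Continuity is asked for on [D] only, so integrands may blow up at the ends. *)
Variables (a b : R^nat) (D : set R).
Hypothesis ab : forall n, a n <= b n.
Hypothesis da : forall n, a n.+1 <= a n.
Hypothesis ib : forall n, b n <= b n.+1.
Hypothesis DE : D = \bigcup_n `[a n, b n]%classic.

Let nd : nondecreasing_seq (fun n => `[a n, b n]%classic : set R).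
Proof.
apply/nondecreasing_seqP => n; rewrite subsetEset; apply: subset_itvScc.
  by rewrite bnd_simp.
by rewrite bnd_simp.
Qed.

Let segD n x : a n <= x <= b n -> D x.
Proof. by move=> xab; rewrite DE; exists n => //=; rewrite in_itv. Qed.

Lemma exhaustion_measurable : measurable D.
Proof. by rewrite DE; apply: bigcup_measurable => n _. Qed.

Lemma exhaustion_continuous_measurable f :
  (forall x, D x -> {for x, continuous f}) -> measurable_fun D f.
Proof.
move=> cf; rewrite DE; apply/measurable_fun_bigcup => // n.
apply: subspace_continuous_measurable_fun => //.
by apply: continuous_segment_within => x /segD; exact: cf.
Qed.

(** For a nonnegative integrand monotone convergence gives the value without prior integrability,
    which then follows from the existence of the limit. *)
Lemma ge0_exhaustion_FTC f F (l : R) :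
  (forall x, D x -> is_derive x 1 F (f x)) ->
  (forall x, D x -> {for x, continuous f}) ->
  (forall x, D x -> 0 <= f x) ->
  F (b n) - F (a n) @[n --> \oo] --> l ->
  (\int[leb]_(x in D) (f x)%:E = l%:E)%E.
Proof.
move=> dF cf f0 Fl.
have mf n : measurable_fun `[a n, b n] (EFin \o f).
  apply/measurable_EFinP; apply: subspace_continuous_measurable_fun => //.
  by apply: continuous_segment_within => x /segD; exact: cf.
have := @ge0_nondecreasing_set_cvg_integral _ (measurableTypeR R) R
  (fun n => `[a n, b n]%classic) (EFin \o f) leb nd (fun=> measurable_itv _) mf.
rewrite -DE => /(_ _)/cvg_lim <- //; last first.
  by move=> n x; rewrite /= in_itv/= lee_fin => /segD; exact: f0.
apply/cvg_lim => //.
rewrite (_ : (fun i => _) = (fun n => (F (b n) - F (a n))%:E)); last first.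
  apply/funext => n; apply: segment_FTC => // x /segD; first exact: dF.
  exact: cf.
by apply: cvg_EFin => //; exact: nearW.
Qed.

Lemma ge0_exhaustion_FTC_integrable f F (l : R) :
  (forall x, D x -> is_derive x 1 F (f x)) ->
  (forall x, D x -> {for x, continuous f}) ->
  (forall x, D x -> 0 <= f x) ->
  F (b n) - F (a n) @[n --> \oo] --> l ->
  leb.-integrable D (EFin \o f).
Proof.
move=> dF cf f0 Fl; apply/integrableP; split.
  by apply/measurable_EFinP; exact: exhaustion_continuous_measurable.
rewrite [ltLHS](_ : _ = l%:E) ?ltry// -(ge0_exhaustion_FTC dF cf f0 Fl).
by apply: eq_integral => x /set_mem Dx /=; rewrite ger0_norm// f0.
Qed.

(** A signed integrand needs integrability beforehand: [|f|] dominates its restrictions to the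
    segments. *)
Lemma exhaustion_cvg f : leb.-integrable D (EFin \o f) ->
  \int[leb]_(x in `[a n, b n]) f x @[n --> \oo] --> \int[leb]_(x in D) f x.
Proof.
move=> If; apply: fine_cvg.
have mD := exhaustion_measurable.
rewrite fineK; last exact: integrable_fin_num.
rewrite (_ : (fun n => _) =
  fun n => (\int[leb]_(x in D) ((EFin \o f) \_ `[a n, b n]) x)%E); last first.
  apply/funext => n; rewrite -integral_mkcondr; congr integral.
  by rewrite setIidr// => x /=; rewrite in_itv; exact: segD.
apply: (@dominated_cvg _ _ _ leb D mD _ _ (fun x => `|f x|%:E)).
- move=> n; apply/measurable_restrict => //.
  by apply: measurable_funS (measurable_int leb If) => //; exact: subIsetl.
- move=> x Dx; have := Dx; rewrite {1}DE => -[N _ xN].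
  apply: cvg_near_cst; exists N => // n Nn.
  rewrite patchE mem_set//.
  by have := nd Nn; rewrite subsetEset; apply.
- by [].
- exact: integrable_norm If.
- move=> n x Dx; rewrite patchE; case: ifPn => //= _.
  by rewrite ?abse0 ?normr0 ?lee_fin.
Qed.

Lemma exhaustion_FTC f F (l : R) :
  (forall x, D x -> is_derive x 1 F (f x)) ->
  (forall x, D x -> {for x, continuous f}) ->
  leb.-integrable D (EFin \o f) ->
  F (b n) - F (a n) @[n --> \oo] --> l ->
  \int[leb]_(x in D) f x = l.
Proof.
move=> dF cf If Fl; have /cvg_lim <- // := exhaustion_cvg If.
apply/cvg_lim => //.
rewrite (_ : (fun i => _) = (fun n => F (b n) - F (a n)))//.
apply/funext => n; rewrite /Rintegral.
rewrite (_ : (\int[_]_(x in _) _)%E = (F (b n) - F (a n))%:E)//.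
by apply: segment_FTC => // x /segD; [exact: dF|exact: cf].
Qed.

End exhaustion.

Section improper.
Context {R : realType}.
Notation leb := (@lebesgue_measure R).
Implicit Types (f F : R -> R).

Let a1 : R^nat := fun n => n.+1%:R^-1.
Let b1 : R^nat := fun n => n.+1%:R.
(** With the shift by two the first segment is [1/2, 1/2], already nonempty at n = 0. *)
Let b2 : R^nat := fun n => 1 - n.+2%:R^-1.
Let a2 : R^nat := fun n => n.+2%:R^-1.
Let b3 : R^nat := fun n => n%:R.
Let a3 : R^nat := fun n => - n%:R.

Let ab1 n : a1 n <= b1 n.
Proof. by rewrite /a1 /b1 (@le_trans _ _ 1) ?invf_le1 ?ler1n. Qed.
Let da1 n : a1 n.+1 <= a1 n.
Proof. by rewrite /a1 lef_pV2 ?posrE// ler_nat. Qed.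
Let ib1 n : b1 n <= b1 n.+1.
Proof. by rewrite /b1 ler_nat. Qed.

Let inv_small (x : R) : 0 < x -> exists n, n.+1%:R^-1 <= x.
Proof.
move=> x0; exists (Num.truncn x^-1).
by rewrite invf_ple ?posrE// ltW// truncnS_gt.
Qed.

Lemma itv0y_exhaustion : `]0%R, +oo[%classic = \bigcup_n `[a1 n, b1 n]%classic.
Proof.
apply/seteqP; split => x /=; rewrite in_itv/= ?andbT.
  move=> x0; have [n nx] := inv_small x0.
  pose m := Num.truncn x; exists (maxn n m) => //=; rewrite in_itv/=.
  apply/andP; split.
    apply: le_trans nx; rewrite lef_pV2 ?posrE// ler_nat ltnS leq_maxl//.
  rewrite (le_trans (ltW (truncnS_gt x)))// ler_nat ltnS leq_maxr//.
by move=> [n _] /=; rewrite in_itv/= => /andP[+ _]; apply: lt_le_trans; rewrite /a1.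
Qed.

Let ab2 n : a2 n <= b2 n.
Proof.
by rewrite /a2 /b2 lerBrDr -mulr2n -[leLHS]mulr_natl ler_pdivrMr// mul1r ler_nat.
Qed.
Let da2 n : a2 n.+1 <= a2 n.
Proof. by rewrite /a2 lef_pV2 ?posrE// ler_nat. Qed.
Let ib2 n : b2 n <= b2 n.+1.
Proof. by rewrite /b2 lerD2l lerN2 lef_pV2 ?posrE// ler_nat. Qed.

Lemma itv01_exhaustion : `]0%R, 1%R[%classic = \bigcup_n `[a2 n, b2 n]%classic.
Proof.
apply/seteqP; split => x /=; rewrite in_itv/=.
  move=> /andP[x0 x1]; have [n nx] := inv_small x0.
  have [m mx] : exists m, m.+1%:R^-1 <= 1 - x by apply: inv_small; rewrite subr_gt0.
  exists (maxn n m) => //=; rewrite in_itv/=.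
  apply/andP; split.
    by apply: le_trans nx; rewrite lef_pV2 ?posrE// ler_nat ltnS leqW// leq_maxl.
  rewrite lerBrDr addrC -lerBrDr; apply: le_trans mx.
  by rewrite lef_pV2 ?posrE// ler_nat ltnS leqW// leq_maxr.
move=> [n _] /=; rewrite in_itv/= => /andP[h1 h2]; apply/andP; split.
  by apply: lt_le_trans h1; rewrite /a2.
by apply: le_lt_trans h2 _; rewrite /b2 ltrBlDr ltrDl.
Qed.

Let ab3 n : a3 n <= b3 n. Proof. by rewrite /a3 /b3 ge0_cp. Qed.
Let da3 n : a3 n.+1 <= a3 n. Proof. by rewrite /a3 lerN2 ler_nat. Qed.
Let ib3 n : b3 n <= b3 n.+1. Proof. by rewrite /b3 ler_nat. Qed.

Lemma setT_exhaustion : [set: R] = \bigcup_n `[a3 n, b3 n]%classic.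
Proof.
apply/seteqP; split => x //= _.
exists (Num.truncn `|x|).+1 => //=; rewrite in_itv/= -ler_norml.
exact/ltW/truncnS_gt.
Qed.

Let cvg_a1 : a1 @ \oo --> 0^'+.
Proof.
move=> A [e /= e0 eA]; have [N _ HN] : \forall n \near \oo, n.+1%:R^-1 < e :> R.
  near=> n; rewrite invf_plt ?posrE//.
  by apply: lt_trans (truncnS_gt _) _; rewrite ltr_nat ltnS; near: n;
    apply: nbhs_infty_gt.
exists N => // n /HN Hn; apply: eA => /=; last by rewrite /a1.
by rewrite /ball_/= sub0r normrN ger0_norm ?invr_ge0.
Unshelve. all: end_near. Qed.

Let cvg_b1 : b1 @ \oo --> +oo%R.
Proof.
apply/cvgryPge => A; near=> n; rewrite /b1.
by apply: le_trans (ltW (truncnS_gt _)) _; rewrite ler_nat ltnS; near: n;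
  apply: nbhs_infty_ge.
Unshelve. all: end_near. Qed.

Let cvg_b3 : b3 @ \oo --> +oo%R.
Proof. by apply/cvgryPge => A; near=> n; rewrite /b3; near: n; exact: nbhs_infty_ger.
Unshelve. all: end_near. Qed.

Let cvg_a3 : a3 @ \oo --> -oo%R.
Proof. by apply/cvgNrNy. Qed.

Let cvg_a2 : a2 @ \oo --> 0^'+.
Proof. by rewrite (_ : a2 = fun n => a1 (n + 1)%N); [rewrite cvg_shiftn|
  apply/funext => n; rewrite /a1 addn1]. Qed.

Let cvg_b2 : b2 @ \oo --> 1^'-.
Proof.
move=> A [e /= e0 eA]; have [N _ HN] : \forall n \near \oo, n.+1%:R^-1 < e :> R.
  near=> n; rewrite invf_plt ?posrE//.
  by apply: lt_trans (truncnS_gt _) _; rewrite ltr_nat ltnS; near: n;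
    apply: nbhs_infty_gt.
exists N => // n Nn; apply: eA => /=; last by rewrite /b2 gtrDl oppr_lt0.
rewrite /ball_/= opprB addrCA subrr addr0 ger0_norm ?invr_ge0//.
by apply: HN => /=; exact: leqW.
Unshelve. all: end_near. Qed.

Section itv0y.
Variables (f F : R -> R) (l0 l1 : R).
Hypothesis dF : forall x : R, 0 < x -> is_derive x 1 F (f x).
Hypothesis cf : forall x : R, 0 < x -> {for x, continuous f}.
Hypothesis F0 : F x @[x --> 0^'+] --> l0.
Hypothesis F1 : F x @[x --> +oo%R] --> l1.

Let dF' (x : R) : `]0%R, +oo[%classic x -> is_derive x 1 F (f x).
Proof. by rewrite /= in_itv/= andbT; exact: dF. Qed.
Let cf' (x : R) : `]0%R, +oo[%classic x -> {for x, continuous f}.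
Proof. by rewrite /= in_itv/= andbT; exact: cf. Qed.
Let cvgF : F (b1 n) - F (a1 n) @[n --> \oo] --> l1 - l0.
Proof. by apply: cvgB; [exact: cvg_comp cvg_b1 F1|exact: cvg_comp cvg_a1 F0]. Qed.

Lemma ge0_FTC_itv0y_integrable : (forall x : R, 0 < x -> 0 <= f x) ->
  leb.-integrable `]0%R, +oo[ (EFin \o f).
Proof.
move=> f0; apply: (ge0_exhaustion_FTC_integrable ab1 da1 ib1 itv0y_exhaustion dF' cf' _ cvgF).
by move=> x; rewrite /= in_itv/= andbT; exact: f0.
Qed.

Lemma FTC_itv0y : leb.-integrable `]0%R, +oo[ (EFin \o f) ->
  \int[leb]_(x in `]0%R, +oo[) f x = l1 - l0.
Proof. by move=> If; apply: (exhaustion_FTC ab1 da1 ib1 itv0y_exhaustion dF' cf' If cvgF). Qed.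

End itv0y.

Section itv01.
Variables (f F : R -> R) (l0 l1 : R).
Hypothesis dF : forall x : R, 0 < x < 1 -> is_derive x 1 F (f x).
Hypothesis cf : forall x : R, 0 < x < 1 -> {for x, continuous f}.
Hypothesis F0 : F x @[x --> 0^'+] --> l0.
Hypothesis F1 : F x @[x --> 1^'-] --> l1.

Let dF' (x : R) : `]0%R, 1%R[%classic x -> is_derive x 1 F (f x).
Proof. by rewrite /= in_itv/=; exact: dF. Qed.
Let cf' (x : R) : `]0%R, 1%R[%classic x -> {for x, continuous f}.
Proof. by rewrite /= in_itv/=; exact: cf. Qed.
Let cvgF : F (b2 n) - F (a2 n) @[n --> \oo] --> l1 - l0.
Proof. by apply: cvgB; [exact: cvg_comp cvg_b2 F1|exact: cvg_comp cvg_a2 F0]. Qed.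

Lemma ge0_FTC_itv01 : (forall x : R, 0 < x < 1 -> 0 <= f x) ->
  (\int[leb]_(x in `]0%R, 1%R[) (f x)%:E = (l1 - l0)%:E)%E.
Proof.
move=> f0; apply: (ge0_exhaustion_FTC ab2 da2 ib2 itv01_exhaustion dF' cf' _ cvgF).
by move=> x; rewrite /= in_itv/=; exact: f0.
Qed.

Lemma ge0_FTC_itv01_integrable : (forall x : R, 0 < x < 1 -> 0 <= f x) ->
  leb.-integrable `]0%R, 1%R[ (EFin \o f).
Proof.
move=> f0; apply: (ge0_exhaustion_FTC_integrable ab2 da2 ib2 itv01_exhaustion dF' cf' _ cvgF).
by move=> x; rewrite /= in_itv/=; exact: f0.
Qed.

Lemma FTC_itv01 : leb.-integrable `]0%R, 1%R[ (EFin \o f) ->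
  \int[leb]_(x in `]0%R, 1%R[) f x = l1 - l0.
Proof. by move=> If; apply: (exhaustion_FTC ab2 da2 ib2 itv01_exhaustion dF' cf' If cvgF). Qed.

End itv01.

Lemma FTC_setT f F (l0 l1 : R) :
  (forall x : R, is_derive x 1 F (f x)) -> continuous f ->
  F x @[x --> -oo%R] --> l0 -> F x @[x --> +oo%R] --> l1 ->
  leb.-integrable setT (EFin \o f) ->
  \int[leb]_x f x = l1 - l0.
Proof.
move=> dF cf F0 F1 If.
apply: (exhaustion_FTC ab3 da3 ib3 setT_exhaustion (fun x _ => dF x) (fun x _ => cf x) If).
by apply: cvgB; [exact: cvg_comp cvg_b3 F1|exact: cvg_comp cvg_a3 F0].
Qed.

Lemma ge0_FTC_setT_integrable f F (l0 l1 : R) :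
  (forall x : R, is_derive x 1 F (f x)) -> continuous f -> (forall x, 0 <= f x) ->
  F x @[x --> -oo%R] --> l0 -> F x @[x --> +oo%R] --> l1 ->
  leb.-integrable setT (EFin \o f).
Proof.
move=> dF cf f0 F0 F1.
apply: (ge0_exhaustion_FTC_integrable ab3 da3 ib3 setT_exhaustion
  (fun x _ => dF x) (fun x _ => cf x) (fun x _ => f0 x)).
by apply: cvgB; [exact: cvg_comp cvg_b3 F1|exact: cvg_comp cvg_a3 F0].
Qed.

Lemma cvg_integral_window f : leb.-integrable `]0%R, +oo[ (EFin \o f) ->
  \int[leb]_(x in `[n.+1%:R^-1, n.+1%:R]) f x @[n --> \oo] -->
  \int[leb]_(x in `]0%R, +oo[) f x.
Proof. by move=> If; apply: (exhaustion_cvg da1 ib1 itv0y_exhaustion If). Qed.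

End improper.

(** * Changes of variable *)

Section change_of_scale.
Context {R : realType}.
Notation leb := (@lebesgue_measure R).

(** Uniqueness of Lebesgue measure: [c] times the pushforward gives the half-open interval from a to
    b the mass c (b / c - a / c), its length. *)
Lemma lebesgue_measure_scale (c : R) (c0 : 0 < c) (A : set R) : measurable A ->
  pushforward leb ( *%R c : _ -> measurableTypeR R) A =
  mscale (NngNum (ltW (etrans (invr_gt0 c) c0))) leb A.
Proof.
move=> mA.
have mc : measurable_fun [set: R] ( *%R c : R -> measurableTypeR R).
  exact: measurable_funM.
pose m' := mscale (NngNum (ltW c0))
  (pushforward leb ( *%R c : _ -> measurableTypeR R)).
pose m := m' mc.
have mE : forall A, measurable A -> leb A = m A.
  apply: lebesgue_measure_unique => _ [[a b] _ <-].
  transitivity (c%:E * leb `](a / c)%R, (b / c)%R]%classic)%E; last first.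
    congr (_ * leb _)%E; apply/seteqP; split => x /=; rewrite !in_itv/=.
      by rewrite ltr_pdivrMr// ler_pdivlMr// (mulrC x).
    by rewrite ltr_pdivrMr// ler_pdivlMr// (mulrC x).
  rewrite !lebesgue_measure_itv/= !lte_fin ltr_pM2r ?invr_gt0//.
  case: ifPn => _; last by rewrite mule0.
  by rewrite -!EFinB -EFinM; congr EFin; field; exact: lt0r_neq0.
rewrite [in RHS]/mscale/= mE// /m /m' /mscale/= muleA -EFinM mulVf ?lt0r_neq0//.
by rewrite mul1e.
Qed.

Lemma ge0_integral_scale (c : R) (f : R -> \bar R) : 0 < c ->
  measurable_fun setT f -> (forall x, 0 <= f x)%E ->
  (\int[leb]_x f (c * x)%R = c^-1%:E * \int[leb]_x f x)%E.
Proof.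
move=> c0 mf f0.
have mc : measurable_fun [set: R] ( *%R c : R -> R) by exact: measurable_funM.
have := @ge0_integral_pushforward _ _ (measurableTypeR R) (measurableTypeR R) R ( *%R c : R -> R) mc leb setT f.
rewrite preimage_setT => /(_ measurableT mf (fun x _ => f0 x)) <-.
rewrite (eq_measure_integral
  (mscale (NngNum (ltW (etrans (invr_gt0 c) c0))) leb)); last first.
  by move=> A mA _; exact: lebesgue_measure_scale.
by rewrite ge0_integral_mscale.
Qed.

Lemma integrable_scale (c : R) (f : R -> R) : 0 < c ->
  leb.-integrable setT (EFin \o f) ->
  leb.-integrable setT (EFin \o (fun x => f (c * x))).
Proof.
move=> c0 /integrableP[/measurable_EFinP mf fi].
have mc : measurable_fun [set: R] ( *%R c : R -> R) by exact: measurable_funM.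
apply/integrableP; split.
  by apply/measurable_EFinP; exact: (measurableT_comp mf mc).
rewrite (ge0_integral_scale (f := fun x => `|(f x)%:E|%E))//.
  by apply: lte_mul_pinfty => //; rewrite lee_fin invr_ge0 ltW.
by apply: measurableT_comp => //; exact/measurable_EFinP.
Qed.

Lemma Rintegral_scale (c : R) (f : R -> R) : 0 < c ->
  leb.-integrable setT (EFin \o f) ->
  \int[leb]_x f (c * x) = c^-1 * \int[leb]_x f x.
Proof.
move=> c0 fi; have /integrableP[mf _] := fi.
rewrite /Rintegral.
suff -> : (\int[leb]_x (f (c * x))%:E = c^-1%:E * \int[leb]_x (f x)%:E)%E.
  by rewrite fineM//; exact: integrable_fin_num.
rewrite [LHS]integralE [in RHS]integralE muleBr//; last first.
  by rewrite fin_num_adde_defr//; exact: integrable_pos_fin_num.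
rewrite -!ge0_integral_scale//.
- by congr (_ - _)%E; apply: eq_integral => x _; rewrite ?funeposE ?funenegE.
- exact: measurable_funeneg.
- exact: measurable_funepos.
Qed.

Let restrict_scale (c : R) (f : R -> R) : 0 < c ->
  (f \_ `]0%R, +oo[) \o *%R c = (fun x => f (c * x)) \_ `]0%R, +oo[.
Proof.
move=> c0; apply/funext => x /=; rewrite !patchE.
by rewrite !mem_setE !in_itv/= !andbT pmulr_rgt0.
Qed.

Lemma integrable_scale_itv0y (c : R) (f : R -> R) : 0 < c ->
  leb.-integrable `]0%R, +oo[ (EFin \o f) ->
  leb.-integrable `]0%R, +oo[ (EFin \o (fun x => f (c * x))).
Proof.
move=> c0 /integrable_mkcond fi; apply/integrable_mkcond => //.
rewrite restrict_EFin -restrict_scale//; apply: integrable_scale => //.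
by rewrite -restrict_EFin; exact: fi.
Qed.

Lemma Rintegral_scale_itv0y (c : R) (f : R -> R) : 0 < c ->
  leb.-integrable `]0%R, +oo[ (EFin \o f) ->
  \int[leb]_(x in `]0%R, +oo[) f (c * x) = c^-1 * \int[leb]_(x in `]0%R, +oo[) f x.
Proof.
move=> c0 /integrable_mkcond fi.
rewrite Rintegral_mkcond -restrict_scale// Rintegral_scale//.
  by rewrite -Rintegral_mkcond.
by rewrite -restrict_EFin; exact: fi.
Qed.

Lemma integrable_opp (f : R -> R) : leb.-integrable setT (EFin \o f) ->
  leb.-integrable setT (EFin \o (fun x => f (- x))).
Proof.
move=> /integrableP[/measurable_EFinP mf fi].
apply/integrableP; split.
  by apply/measurable_EFinP; apply: (measurableT_comp mf); exact: oppr_measurable.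
have := @ge0_integral_pushforward _ _ (measurableTypeR R) (measurableTypeR R) R (-%R : R -> R) (@oppr_measurable R setT) leb setT (fun x => `|(f x)%:E|%E).
rewrite preimage_setT => <- //; last first.
  by apply: measurableT_comp => //; exact/measurable_EFinP.
apply: le_lt_trans fi; rewrite le_eqVlt; apply/orP; left; apply/eqP.
by apply: eq_measure_integral => A mA _; exact: lebesgue_measureN.
Qed.

Lemma Rintegral_opp (f : R -> R) : leb.-integrable setT (EFin \o f) ->
  \int[leb]_x f (- x) = \int[leb]_x f x.
Proof.
move=> fi; have /integrableP[mf _] := fi.
have := @integral_pushforward _ _ (measurableTypeR R) (measurableTypeR R) R (-%R : R -> R) (@oppr_measurable R setT) leb setT (EFin \o f) mf (integrable_opp fi) measurableT.
rewrite preimage_setT /Rintegral => <-; congr fine.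
by apply: eq_measure_integral => A mA _; exact: lebesgue_measureN.
Qed.

(* The vanishing at 0 makes the decomposition below an equality of functions. *)
Lemma half_lines (f : R -> R) : f 0 = 0 ->
  leb.-integrable `]0%R, +oo[ (EFin \o f) ->
  leb.-integrable `]0%R, +oo[ (EFin \o (fun x => f (- x))) ->
  leb.-integrable setT (EFin \o f) /\
  \int[leb]_x f x = \int[leb]_(x in `]0%R, +oo[) f x +
                    \int[leb]_(x in `]0%R, +oo[) f (- x).
Proof.
move=> f0 ip im.
pose fp := f \_ `]0%R, +oo[.
pose fm := (fun x => f (- x)) \_ `]0%R, +oo[.
have fE : f = fun x => fp x + fm (- x).
  apply/funext => x; rewrite /fp /fm !patchE !mem_setE !in_itv/= !andbT opprK oppr_gt0.
  by case: (ltrgtP 0 x) => [_|_|<-]; rewrite ?addr0 ?add0r ?f0.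
have ifp : leb.-integrable setT (EFin \o fp).
  by have /integrable_mkcond := ip; rewrite restrict_EFin => /(_ (measurable_itv _)).
have ifm : leb.-integrable setT (EFin \o fm).
  by have /integrable_mkcond := im; rewrite restrict_EFin => /(_ (measurable_itv _)).
have ifm' := integrable_opp ifm.
split.
  rewrite fE (_ : EFin \o _ = (EFin \o fp) \+ (EFin \o (fun x => fm (- x))))//.
  exact: integrableD.
rewrite {1}fE RintegralD// Rintegral_opp//.
by rewrite -!Rintegral_mkcond.
Qed.

End change_of_scale.

(** * Trigonometric estimates *)

Section trigonometric_bounds.
Context {R : realType}.
Implicit Types x y h a b c : R.

Let le1 c (x y : R) : `|c| <= 1 -> `|y| <= x -> `|c * y| <= x.
Proof.
move=> c1 yx; rewrite normrM; apply: le_trans yx.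
by rewrite -[leRHS]mul1r ler_wpM2r.
Qed.

Lemma ler_norm_cosB x y : `|cos x - cos y| <= `|x - y|.
Proof.
rewrite -[leRHS]mul1r; apply: (@mvt_le R cos (fun x => - sin x)) => z _.
by rewrite normrN sin_max.
Qed.

Lemma ler_norm_sinB x y : `|sin x - sin y| <= `|x - y|.
Proof.
rewrite -[leRHS]mul1r; apply: (@mvt_le R sin cos) => z _.
exact: cos_max.
Qed.

(** One use of the mean value inequality on the remainder, whose derivative sin x - sin (x + t) is
    at most |h| on the segment; hence the constant 1 in place of 1/2. *)
Lemma cos_taylor x h : `|cos (x + h) - cos x + h * sin x| <= h ^+ 2.
Proof.
have := @mvt_le R (fun t => cos (x + t) + t * sin x)
  (fun t => - sin (x + t) + sin x) `|h| 0 h.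
rewrite addr0 mul0r subr0 addr0 addrAC => H.
rewrite -(real_normK (num_real h)) expr2; apply: H => z zh.
  derive.
  by ring.
rewrite addrC; apply: le_trans (ler_norm_sinB _ _) _.
rewrite opprD addrA subrr add0r normrN; move: zh; have [h0|h0] := leP 0 h => /andP[z1 z2].
  by rewrite !ger0_norm.
by rewrite !ler0_norm ?lerN2// ltW.
Qed.

Lemma sin_taylor x h : `|sin (x + h) - sin x - h * cos x| <= h ^+ 2.
Proof.
have := cos_taylor (x - pi / 2) h.
by rewrite (addrAC x) !cosBpihalf sinBpihalf mulrN.
Qed.

Lemma cos_ge1B x : 0 <= 1 - cos x. Proof. by rewrite subr_ge0 cos_le1. Qed.

Lemma cos1_lt1 : cos 1 < 1 :> R.
Proof.
rewrite -[ltRHS]cos0 ltr_cos ?ltr01// in_itv/= ?lexx ?ler01 ?pi_ge0//=.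
by rewrite (le_trans _ (pi_ge2 R))// ler1n.
Qed.

(** The interval [1, 2] lies in [0, pi], where cos decreases. It is the window used for the
    positivity of [levy_cos] and, after dyadic rescaling, for the first moment of the stable law. *)
Lemma cos_le_cos1 x : 1 <= x <= 2 -> cos x <= cos 1.
Proof.
move=> /andP[x1 x2]; rewrite le_eqVlt; have [->|nx1] := eqVneq x 1; first by rewrite eqxx.
apply/orP; right; rewrite ltr_cos ?in_itv/= ?ler01/= ?(le_trans _ (pi_ge2 R)) ?ler1n//.
  by rewrite lt_neqAle eq_sym nx1.
by rewrite (le_trans ler01).
Qed.

Lemma cos_le_sqr x : 1 - cos x <= x ^+ 2.
Proof.
have := cos_taylor 0 x; rewrite add0r sin0 mulr0 addr0 cos0 distrC.
by rewrite ger0_norm// cos_ge1B.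
Qed.

Lemma ler_norm_sin x : `|sin x| <= `|x|.
Proof. by have := ler_norm_sinB x 0; rewrite sin0 !subr0. Qed.

Lemma norm_subr_sin_le x : `|x - sin x| <= x ^+ 2.
Proof. by have := sin_taylor 0 x; rewrite add0r sin0 cos0 subr0 mulr1 distrC. Qed.

Lemma norm_subr_sin_le2 x : `|x - sin x| <= 2 * `|x|.
Proof. by apply: le_trans (ler_normB _ _) _; rewrite mulrDl mul1r lerD2l ler_norm_sin. Qed.

Lemma expRN_le1 x : 0 <= x -> expR (- x) <= 1.
Proof. by move=> x0; rewrite expR_le1 oppr_le0. Qed.

Lemma oneBexpRN_le x : 1 - expR (- x) <= x.
Proof. by rewrite lerBlDr -lerBlDl; have := expR_ge1Dx (- x). Qed.

Lemma oneBexpRN_ge0 x : 0 <= x -> 0 <= 1 - expR (- x).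
Proof. by move=> /expRN_le1; rewrite subr_ge0. Qed.

Lemma expRN_taylor x : 0 <= x -> `|expR (- x) - 1 + x| <= x ^+ 2.
Proof.
move=> x0; have := @mvt_le R (fun t => expR (- t) + t) (fun t => - expR (- t) + 1) x 0 x.
rewrite oppr0 expR0 !addr0 addrAC => H.
rewrite -[X in X ^+ 2]ger0_norm// expr2 {1}ger0_norm//; apply: H => z;
  rewrite min_l// max_r// => /andP[z0 zx].
  derive.
  by ring.
rewrite addrC ger0_norm ?oneBexpRN_ge0//; exact: le_trans (oneBexpRN_le _) zx.
Qed.

Lemma ler_norm_cosMDsinM x a b : `|cos x * a + sin x * b| <= `|a| + `|b|.
Proof.
apply: le_trans (ler_normD _ _) _.
by apply: lerD; apply: le1 => //; [exact: cos_max|exact: sin_max].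
Qed.

End trigonometric_bounds.

(** * Integrability against the weight u^(-1-alpha) *)

Section power_bounds.
Context {R : realType}.
Notation leb := (@lebesgue_measure R).

Lemma powRN_cvgy (c : R) : 0 < c -> x `^ (- c) @[x --> +oo%R] --> (0 : R).
Proof.
move=> c0; apply/cvgrPdist_le => e e0; near=> x.
have xe : e `^ (- c^-1) <= x by near: x; apply: nbhs_pinfty_ge.
rewrite sub0r normrN ger0_norm ?powR_ge0// powRN.
rewrite invf_ple ?posrE ?powR_gt0//.
have := @ge0_ler_powR R c (ltW c0) (e `^ (- c^-1)) x.
rewrite !nnegrE powR_ge0 ltW// => /(_ isT isT xe).
by rewrite -powRrM mulNr mulVf ?gt_eqF// powR_inv1// ltW.
Unshelve. all: end_near. Qed.

Lemma measurable_invpowR (c : R) : measurable_fun setT (fun u : R => (u `^ c)^-1).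
Proof. by under eq_fun do rewrite -powRN; exact: measurable_powR. Qed.

Variables (alpha : R) (halpha : 1 < alpha < 2).
Let a1 : 1 < alpha. Proof. by case/andP: halpha. Qed.
Let a2 : alpha < 2. Proof. by case/andP: halpha. Qed.

(** The common majorant of the integrands of Levy type: order u^2 near 0 is enough because alpha <
    2, order u at infinity because alpha > 1. *)
Definition levy_min (u : R) : R := Num.min u (u ^+ 2) / u `^ (1 + alpha).

Lemma levy_min_ge0 u : 0 < u -> 0 <= levy_min u.
Proof.
by move=> u0; rewrite /levy_min divr_ge0 ?powR_ge0// le_min sqr_ge0 ltW.
Qed.

Let f1 : R -> R := (fun u : R => u `^ (1 - alpha)) \_ `]0%R, 1%R[.
Let f2 : R -> R := fun u => (1 + u) `^ (- alpha).

Let if1 : leb.-integrable `]0%R, +oo[ (EFin \o f1).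
Proof.
apply: (@integrableS _ _ _ leb setT) => //.
suff: leb.-integrable `]0%R, 1%R[ (EFin \o (fun u : R => u `^ (1 - alpha))).
  by move=> /integrable_mkcond; rewrite restrict_EFin => /(_ (measurable_itv _)).
apply: (@ge0_FTC_itv01_integrable R _
  (fun u => (2 - alpha)^-1 * u `^ (2 - alpha)) 0 (2 - alpha)^-1).
- move=> x /andP[x0 x1].
  derive.
      rewrite mulr1 mulrA mulVf ?mul1r; last by rewrite gt_eqF// subr_gt0.
  by congr (_ `^ _); ring.
- move=> x /andP[x0 x1]; apply: is_derive_to_continuous; exact: is_derive1_powR.
- rewrite -[X in _ --> X](mulr0 (2 - alpha)^-1); apply: cvgMr.
  by apply: powR_cvg0; rewrite subr_gt0.
- have h : x `^ (2 - alpha) @[x --> (1 : R)^'-] --> (1 : R) `^ (2 - alpha).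
    apply: cvg_at_left_filter.
    exact: (is_derive_to_continuous (is_derive1_powR _ (ltr01 : (0:R) < 1))).
  suff : (2 - alpha)^-1 * x `^ (2 - alpha) @[x --> (1 : R)^'-] -->
         (2 - alpha)^-1 * (1 : R) `^ (2 - alpha) by rewrite powR1 mulr1.
  exact: cvgMr.
- by move=> x _; exact: powR_ge0.
Qed.

Let if2 : leb.-integrable `]0%R, +oo[ (EFin \o f2).
Proof.
apply: (@ge0_FTC_itv0y_integrable R f2
  (fun u => - (alpha - 1)^-1 * (1 + u) `^ (- (alpha - 1))) (- (alpha - 1)^-1 * 1) 0).
- move=> x x0; have x1 : 0 < 1 + x by rewrite addr_gt0.
  derive.
  rewrite add0r mulr1 mulrA mulrNN mulVf ?mul1r; last by rewrite gt_eqF// subr_gt0.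
  by rewrite /f2; congr (_ `^ _); ring.
- move=> x x0; have x1 : 0 < 1 + x by rewrite addr_gt0.
  apply: (@is_derive_to_continuous _ _ _ (- alpha * (1 + x) `^ (- alpha - 1) * (0 + 1))).
  by der.
- have h : (1 + x) `^ (- (alpha - 1)) @[x --> (0 : R)^'+] --> (1 + 0 : R) `^ (- (alpha - 1)).
    apply: cvg_at_right_filter.
    apply: (@is_derive_to_continuous _ (fun x => (1 + x) `^ (- (alpha - 1))) _
      (- (alpha - 1) * (1 + 0) `^ (- (alpha - 1) - 1) * (0 + 1))).
    by der; rewrite addr0.
  by apply: cvgMr; move: h; rewrite addr0 powR1.
- rewrite -[X in _ --> X](mulr0 (- (alpha - 1)^-1)); apply: cvgMr.
  apply: (cvg_comp (fun u => 1 + u) (fun u => u `^ _)); last first.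
    by apply: powRN_cvgy; rewrite subr_gt0.
  apply/cvgryPge => A; near=> x; rewrite -lerBlDl; near: x.
  by apply: nbhs_pinfty_ge; exact: num_real.
- by move=> x _; exact: powR_ge0.
Unshelve. all: end_near. Qed.

(** For u >= 1 one has 1 + u <= 2 u, and 4 bounds 2^alpha. The shift by 1 in [f2] removes the
    singularity at 0, so [f2] is integrable on the whole half-line. *)
Let levy_min_le (u : R) : 0 < u -> levy_min u <= f1 u + 4 * f2 u.
Proof.
move=> u0; rewrite /levy_min /f1 /f2 patchE mem_setE in_itv/= u0/=.
  have [u1|u1] := ltP u 1.
    apply: (@le_trans _ _ (u `^ (1 - alpha))); last first.
      by rewrite lerDl mulr_ge0// powR_ge0.
    rewrite ler_pdivrMr ?powR_gt0// -powRD; last by rewrite (gt_eqF u0) implybT.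
    rewrite (_ : 1 - alpha + _ = 2%:R); last by ring.
    rewrite powR_mulrn; last exact: ltW.
    by rewrite ge_min lexx orbT.
  (* Outside []0, 1[] the restriction [f1] returns the default [point], which is 0. *)
  rewrite (_ : point = 0 :> R)// add0r.
  apply: (@le_trans _ _ (u `^ (- alpha))).
    rewrite ler_pdivrMr ?powR_gt0// -powRD; last by rewrite (gt_eqF u0) implybT.
    rewrite (_ : - alpha + _ = 1); last by ring.
    rewrite powRr1; last exact: ltW.
    by rewrite ge_min lexx.
  rewrite !powRN; rewrite -ler_pdivrMr ?invr_gt0 ?powR_gt0 ?addr_gt0// invrK.
  rewrite mulrC ler_pdivrMr ?powR_gt0//.
  apply: (@le_trans _ _ ((2 * u) `^ alpha)).
    by apply: ge0_ler_powR; rewrite ?nnegrE; have := a1; lra.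
  rewrite powRM; [|by []|exact: ltW]; rewrite ler_wpM2r ?powR_ge0//.
  apply: (@le_trans _ _ (2 `^ 2%:R)); first by apply: ler_powR; have := a2; lra.
  by rewrite powR_mulrn// -natrX.
Qed.

Lemma levy_min_integrable : leb.-integrable `]0%R, +oo[ (EFin \o levy_min).
Proof.
apply: (@le_integrable _ _ _ leb _ (measurable_itv _) _ (EFin \o (fun u => f1 u + 4 * f2 u))).
- apply/measurable_EFinP; apply: measurable_funM.
    by apply: measurable_minr => //; apply: measurable_funX.
  by apply: measurable_funTS; exact: measurable_invpowR.
- move=> u; rewrite /= in_itv/= andbT => u0; rewrite lee_fin.
  rewrite ger0_norm ?levy_min_ge0// (le_trans _ (ler_norm _))//.
  exact: levy_min_le.
- rewrite (_ : EFin \o _ = (EFin \o f1) \+ (fun u => 4%:E * (f2 u)%:E)%E).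
    by apply: integrableD => //; apply: integrableZl.
  by apply/funext => u /=; rewrite EFinD EFinM.
Qed.

Lemma levy_dominated_integrable (g : R -> R) (c : R) :
  measurable_fun setT g ->
  (forall u, 0 < u -> `|g u| <= c * u) -> (forall u, 0 < u -> `|g u| <= c * u ^+ 2) ->
  leb.-integrable `]0%R, +oo[ (EFin \o (fun u => g u / u `^ (1 + alpha))).
Proof.
move=> mg g1 g2.
apply: (@le_integrable _ _ _ leb _ (measurable_itv _) _ (fun u => c%:E * (levy_min u)%:E)%E).
- apply/measurable_EFinP; apply: measurable_funM; first exact: measurable_funTS.
  by apply: measurable_funTS; exact: measurable_invpowR.
- move=> u; rewrite /= in_itv/= andbT => u0; rewrite lee_fin.
  rewrite (le_trans _ (ler_norm _))// /levy_min mulrA normrM.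
  rewrite (ger0_norm (_ : 0 <= (u `^ (1 + alpha))^-1)) ?invr_ge0 ?powR_ge0//.
  rewrite ler_wpM2r ?invr_ge0 ?powR_ge0//.
  by rewrite minEle; case: ifP => _; auto.
- by apply: integrableZl => //; exact: levy_min_integrable.
Qed.

End power_bounds.

(** * The integrals of (1 - cos u) u^(-1-alpha) and (u - sin u) u^(-1-alpha) *)

Section rotation.
Context {R : realType}.
Notation leb := (@lebesgue_measure R).
Implicit Types (t y : R).

Lemma derive_measurable (f : R -> R) :
  (forall x : R, exists a : R, is_derive x 1 f a) -> measurable_fun setT f.
Proof.
move=> H; apply: continuous_measurable_fun => x; have [a fa] := H x.
exact: is_derive_to_continuous fa.
Qed.

(** With z = exp(i t), A + i B is exp(-z y) - 1 + z y; [Ay] and [By] are the derivatives in y. *)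
Let A t y := expR (- (y * cos t)) * cos (y * sin t) - 1 + y * cos t.
Let B t y := y * sin t - expR (- (y * cos t)) * sin (y * sin t).
Let Ay t y := cos t * (1 - expR (- (y * cos t)) * cos (y * sin t))
              - sin t * (expR (- (y * cos t)) * sin (y * sin t)).
Let By t y := sin t * (1 - expR (- (y * cos t)) * cos (y * sin t))
              + cos t * (expR (- (y * cos t)) * sin (y * sin t)).

Let dyA t y : is_derive y 1 (A t) (Ay t y).
Proof. by rewrite /A; derive; rewrite /Ay; ring. Qed.
Let dyB t y : is_derive y 1 (B t) (By t y).
Proof. by rewrite /B; derive; rewrite /By; ring. Qed.
(** The Cauchy-Riemann equations in polar form: on functions of y exp(i t), d/dt is i y d/dy. *)
Let dtA t y : is_derive t 1 (A ^~ y) (- y * By t y).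
Proof. by rewrite /A; derive; rewrite /By; ring. Qed.
Let dtB t y : is_derive t 1 (B ^~ y) (y * Ay t y).
Proof. by rewrite /B; derive; rewrite /Ay; ring. Qed.

(** The bounds of order y^2 control the inner end of the window of integration, those of order y the
    outer end. The condition 0 <= cos t, valid throughout the quarter turn, keeps the exponential at
    most 1. *)
Let Abound t y : 0 <= cos t -> 0 <= y -> `|A t y| <= 2 * y ^+ 2.
Proof.
move=> ct y0.
have yc : 0 <= y * cos t by exact: mulr_ge0.
have -> : A t y = (expR (- (y * cos t)) - 1 + y * cos t)
    - expR (- (y * cos t)) * (1 - cos (y * sin t)) by rewrite /A; ring.
apply: le_trans (ler_normB _ _) _; rewrite [leRHS]mulrDl mul1r; apply: lerD.
  apply: le_trans (expRN_taylor yc) _.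
  by rewrite exprMn ler_piMr ?sqr_ge0// -[leRHS](cos2Dsin2 t) lerDl sqr_ge0.
rewrite normrM (ger0_norm (expR_ge0 _)) (ger0_norm (cos_ge1B _)).
apply: (@le_trans _ _ (1 * (y * sin t) ^+ 2)).
  by apply: ler_pM; rewrite ?expR_ge0 ?cos_ge1B ?expRN_le1// cos_le_sqr.
by rewrite mul1r exprMn ler_piMr ?sqr_ge0// -[leRHS](cos2Dsin2 t) lerDr sqr_ge0.
Qed.

Let Abound1 t y : 0 <= cos t -> 1 <= y -> `|A t y| <= 3 * y.
Proof.
move=> ct y1; have y0 : 0 <= y by exact: le_trans y1.
have yc : 0 <= y * cos t by exact: mulr_ge0.
rewrite /A; apply: le_trans (ler_normD _ _) _.
have : `|y * cos t| <= y.
  by rewrite normrM (ger0_norm y0) ler_piMr// cos_max.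
have : `|expR (- (y * cos t)) * cos (y * sin t)| <= 1.
  rewrite normrM (ger0_norm (expR_ge0 _)) -[leRHS]mul1r.
  by apply: ler_pM; rewrite ?expR_ge0 ?cos_max ?expRN_le1.
have := ler_normB (expR (- (y * cos t)) * cos (y * sin t)) 1.
by rewrite normr1; lra.
Qed.

Let Bbound t y : 0 <= cos t -> 0 <= y -> `|B t y| <= 2 * y ^+ 2.
Proof.
move=> ct y0.
have yc : 0 <= y * cos t by exact: mulr_ge0.
have -> : B t y = (y * sin t - sin (y * sin t))
    + (1 - expR (- (y * cos t))) * sin (y * sin t) by rewrite /B; ring.
apply: le_trans (ler_normD _ _) _; rewrite [leRHS]mulrDl mul1r; apply: lerD.
  apply: le_trans (norm_subr_sin_le _) _.
  by rewrite exprMn ler_piMr ?sqr_ge0// -[leRHS](cos2Dsin2 t) lerDr sqr_ge0.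
rewrite normrM (ger0_norm (oneBexpRN_ge0 yc)) expr2.
apply: ler_pM; rewrite ?oneBexpRN_ge0//.
  apply: le_trans (oneBexpRN_le _) _.
  by rewrite ler_piMr// cos_le1.
apply: le_trans (ler_norm_sin _) _.
by rewrite normrM (ger0_norm y0) ler_piMr// sin_max.
Qed.

Let Bbound1 t y : 0 <= cos t -> 1 <= y -> `|B t y| <= 3 * y.
Proof.
move=> ct y1; have y0 : 0 <= y by exact: le_trans y1.
have yc : 0 <= y * cos t by exact: mulr_ge0.
rewrite /B; apply: le_trans (ler_normB _ _) _.
have : `|y * sin t| <= y.
  by rewrite normrM (ger0_norm y0) ler_piMr// sin_max.
have : `|expR (- (y * cos t)) * sin (y * sin t)| <= 1.
  rewrite normrM (ger0_norm (expR_ge0 _)) -[leRHS]mul1r.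
  by apply: ler_pM; rewrite ?expR_ge0 ?sin_max ?expRN_le1.
lra.
Qed.

Variables (alpha : R) (halpha : 1 < alpha < 2).

Let a1 : 1 < alpha. Proof. by case/andP: halpha. Qed.
Let a2 : alpha < 2. Proof. by case/andP: halpha. Qed.

(* With F(z) = int_0^oo (exp(-zy) - 1 + zy) y^(-1-alpha) dy and z = exp(i t),
   psi is the integrand of Im (exp(-i alpha t) F(z)) and ups that of the
   boundary term of its t-derivative: d psi / dt = d ups / dy, which is Cauchy's
   theorem for the rotation of the half-line from t = 0 to t = pi / 2. *)
Let psi t y := (cos (alpha * t) * B t y - sin (alpha * t) * A t y) * y `^ (- (1 + alpha)).
Let ups t y := (cos (alpha * t) * A t y + sin (alpha * t) * B t y) * y `^ (- alpha).
Let tht t y := (y * (cos (alpha * t) * Ay t y + sin (alpha * t) * By t y)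
  - alpha * (cos (alpha * t) * A t y + sin (alpha * t) * B t y)) * y `^ (- (1 + alpha)).

Let powS y : 0 < y -> y `^ (- alpha) = y * y `^ (- (1 + alpha)).
Proof.
move=> y0; rewrite -{2}(powRr1 (ltW y0)) -powRD; last by rewrite (gt_eqF y0) implybT.
by congr powR; ring.
Qed.

Let dt_psi t y : is_derive t 1 (psi ^~ y) (tht t y).
Proof.
rewrite /psi; notypeclasses refine (derive_eq _ _).
  notypeclasses refine (derive_mul _ _); last exact: derive_cstc.
  notypeclasses refine (derive_sub _ _); notypeclasses refine (derive_mul _ _);
    [by der|exact: dtB|by der|exact: dtA].
by rewrite /tht/=; ring.
Qed.

Let dy_psi t y : 0 < y -> exists a, is_derive y 1 (psi t) a.
Proof.
move=> y0; rewrite /psi; eexists.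
notypeclasses refine (derive_mul _ _).
  notypeclasses refine (derive_sub _ _); notypeclasses refine (derive_scale _ _);
    [exact: dyB|exact: dyA].
exact: is_derive1_powR.
Qed.

Let dy_ups t y : 0 < y -> is_derive y 1 (ups t) (tht t y).
Proof.
move=> y0; rewrite /ups; notypeclasses refine (derive_eq _ _).
  notypeclasses refine (derive_mul _ _).
    notypeclasses refine (derive_add _ _); notypeclasses refine (derive_scale _ _);
      [exact: dyA|exact: dyB].
  exact: is_derive1_powR.
rewrite /tht powS// (_ : - alpha - 1 = - (1 + alpha)); first by ring.
by ring.
Qed.

Let cont_tht t y : 0 < y -> {for y, continuous (tht t)}.
Proof.
move=> y0; suff [a /is_derive_to_continuous//] : exists a, is_derive y 1 (tht t) a.
eexists; rewrite /tht.
notypeclasses refine (derive_mul _ _); last exact: is_derive1_powR.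
notypeclasses refine (derive_sub _ _).
  by rewrite /Ay /By; der.
by rewrite /A /B; der.
Qed.

(** A bound uniform in t on a compact window of y, which is the dominating constant for
    differentiation under the integral. Since t is arbitrary, cos t may be negative, and the
    exponential is only bounded by exp N. *)
Let tht_bound (e N : R) : 0 < e -> exists M : R, forall t y,
  e <= y <= N -> `|tht t y| <= M.
Proof.
move=> e0; pose E := expR N.
exists ((N * (2 * (2 * E + 1)) + alpha * (2 * (E + 1 + N))) * e `^ (- (1 + alpha))).
move=> t y /andP[ey yN]; have y0 : 0 < y by exact: lt_le_trans ey.
have eE : expR (- (y * cos t)) <= E.
  rewrite ler_expR (le_trans _ yN)// (le_trans (ler_norm _))// normrN normrM gtr0_norm//.
  by rewrite ler_piMr ?cos_max// ltW.
have mE c : `|c| <= 1 -> `|expR (- (y * cos t)) * c| <= E.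
  move=> c1; rewrite normrM (ger0_norm (expR_ge0 _)) -[leRHS]mulr1.
  by apply: ler_pM; rewrite ?expR_ge0.
have h1 := mE _ (cos_max (y * sin t)); have h2 := mE _ (sin_max (y * sin t)).
have m1 c (x : R) : `|c| <= 1 -> `|c * x| <= `|x|.
  by move=> c1; rewrite normrM ler_piMl.
have bA : `|A t y| <= E + 1 + N.
  rewrite /A; apply: le_trans (ler_normD _ _) _; apply: lerD.
    by apply: le_trans (ler_normB _ _) _; rewrite normr1 lerD2r.
  by rewrite mulrC (le_trans (m1 _ _ (cos_max _)))// gtr0_norm.
have bB : `|B t y| <= E + 1 + N.
  rewrite /B; apply: le_trans (ler_normB _ _) _.
  have : `|y * sin t| <= N by rewrite mulrC (le_trans (m1 _ _ (sin_max _)))// gtr0_norm.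
  lra.
have b1 : `|1 - expR (- (y * cos t)) * cos (y * sin t)| <= 1 + E.
  by apply: le_trans (ler_normB _ _) _; rewrite normr1 lerD2l.
have bAy : `|Ay t y| <= 2 * E + 1.
  rewrite /Ay; apply: le_trans (ler_normB _ _) _.
  have := m1 _ (1 - expR (- (y * cos t)) * cos (y * sin t)) (cos_max t).
  have := m1 _ (expR (- (y * cos t)) * sin (y * sin t)) (sin_max t).
  lra.
have bBy : `|By t y| <= 2 * E + 1.
  rewrite /By; apply: le_trans (ler_normD _ _) _.
  have := m1 _ (1 - expR (- (y * cos t)) * cos (y * sin t)) (sin_max t).
  have := m1 _ (expR (- (y * cos t)) * sin (y * sin t)) (cos_max t).
  lra.
rewrite /tht normrM; apply: ler_pM => //.
  apply: le_trans (ler_normB _ _) _; apply: lerD; rewrite normrM.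
    rewrite gtr0_norm//; apply: ler_pM => //; first exact: ltW.
    by apply: le_trans (ler_norm_cosMDsinM _ _ _) _; lra.
  rewrite gtr0_norm; last by have := a1; lra.
  rewrite ler_pM2l; last by have := a1; lra.
  by apply: le_trans (ler_norm_cosMDsinM _ _ _) _; lra.
rewrite ger0_norm ?powR_ge0// !powRN lef_pV2 ?posrE ?powR_gt0//.
by apply: ge0_ler_powR; rewrite ?nnegrE; have := a1; lra.
Qed.

Let V (e N : R) t := \int[leb]_(y in `[e, N]) psi t y.

(** Differentiation under the integral turns [psi] into [tht], which is also the y-derivative of
    [ups]: only two boundary terms survive. *)
Let dV (e N t : R) : 0 < e <= N -> is_derive t 1 (V e N) (ups t N - ups t e).
Proof.
move=> /andP[e0 eN]; have [M HM] := tht_bound N e0.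
have psiE x y : partial1of2 psi x y = tht x y.
  by rewrite /partial1of2; apply: is_derive_to_derive1; exact: dt_psi.
have pos y : e <= y <= N -> 0 < y by move=> /andP[+ _]; exact: lt_le_trans.
have H1 x : x \in `](t - 1), (t + 1)[ -> leb.-integrable `[e, N] (EFin \o psi x).
  move=> _; apply: continuous_segment_integrable => y /pos y0.
  by have [a /is_derive_to_continuous] := dy_psi x y0.
have H2 (x y : R) : x \in `](t - 1), (t + 1)[ -> `[e, N]%classic y -> derivable (psi ^~ y) x 1.
  by move=> _ _; apply: ex_derive.
have H3 (x y : R) : x \in `](t - 1), (t + 1)[ -> `[e, N]%classic y -> `|partial1of2 psi x y| <= `|M|.
  move=> _; rewrite /= in_itv/= psiE => yeN.
  by apply: le_trans (HM _ _ yeN) _; exact: ler_norm.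
have tI : t \in `](t - 1), (t + 1)[ by rewrite in_itv/=; apply/andP; split; lra.
have HG : leb.-integrable `[e, N] (EFin \o cst `|M|).
  by apply: continuous_segment_integrable => y _; exact: cst_continuous.
have G0 (y : R) : 0 <= cst `|M| y by rewrite normr_ge0.
have VE : \int[leb]_(y in `[e, N]) (partial1of2 psi ^~ y) t = ups t N - ups t e.
  under eq_Rintegral do rewrite psiE.
  have H := @segment_FTC R (tht t) (ups t) e N eN
    (fun y yeN => @dy_ups t y (pos y yeN)) (fun y yeN => @cont_tht t y (pos y yeN)).
  by rewrite /Rintegral H.
apply: DeriveDef.
  exact: (@derivable_under_integral R _ _ leb psi `[e, N] (measurable_itv _) t _ _ tI H1 H2 _ G0 HG H3).
rewrite -derive1E -VE.
exact: (@differentiation_under_integral R _ _ leb psi `[e, N] (measurable_itv _) t _ _ tI H1 H2 _ G0 HG H3).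
Qed.

(** Both terms vanish as e tends to 0 and N to infinity, because 1 < alpha < 2. The constants are 3
    + 3 from [Abound1] and [Bbound1], and 2 + 2 from [Abound] and [Bbound]. *)
Let ups_bound t (e N : R) : 0 <= cos t -> 0 < e -> 1 <= N ->
  `|ups t N - ups t e| <= 6 * N `^ (- (alpha - 1)) + 4 * e `^ (2 - alpha).
Proof.
move=> ct e0 N1; have N0 : 0 < N by exact: lt_le_trans N1.
apply: le_trans (ler_normB _ _) _; apply: lerD; rewrite /ups normrM (ger0_norm (powR_ge0 _ _)).
  rewrite (_ : - (alpha - 1) = 1 + - alpha); last by ring.
  rewrite powRD; last by rewrite (gt_eqF N0) implybT.
  rewrite powRr1 ?(ltW N0)// mulrA ler_wpM2r ?powR_ge0//.
  apply: le_trans (ler_norm_cosMDsinM _ _ _) _.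
  by have := Abound1 ct N1; have := Bbound1 ct N1; lra.
rewrite powRD; last by rewrite (gt_eqF e0) implybT.
rewrite mulrA ler_wpM2r ?powR_ge0// (powR_mulrn 2 (ltW e0)).
apply: le_trans (ler_norm_cosMDsinM _ _ _) _.
by have := Abound ct (ltW e0); have := Bbound ct (ltW e0); lra.
Qed.

Definition levy_cos := \int[leb]_(y in `]0%R, +oo[) ((1 - cos y) / y `^ (1 + alpha)).
Definition levy_sin := \int[leb]_(y in `]0%R, +oo[) ((y - sin y) / y `^ (1 + alpha)).

Lemma levy_cos_integrable :
  leb.-integrable `]0%R, +oo[ (EFin \o (fun y => (1 - cos y) / y `^ (1 + alpha))).
Proof.
apply: (levy_dominated_integrable halpha (c := 1)).
- by apply: derive_measurable => x; eexists; der.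
- by move=> u u0; have := ler_norm_cosB 0 u; rewrite cos0 sub0r normrN (gtr0_norm u0) mul1r.
- by move=> u u0; rewrite ger0_norm ?cos_ge1B// mul1r cos_le_sqr.
Qed.

Lemma levy_sin_integrable :
  leb.-integrable `]0%R, +oo[ (EFin \o (fun y => (y - sin y) / y `^ (1 + alpha))).
Proof.
apply: (levy_dominated_integrable halpha (c := 2)).
- by apply: derive_measurable => x; eexists; der.
- by move=> u u0; have := norm_subr_sin_le2 u; rewrite (gtr0_norm u0).
- move=> u u0; apply: le_trans (norm_subr_sin_le _) _.
  by rewrite mulrDl mul1r lerDl sqr_ge0.
Qed.

Lemma cos_pialpha_lt0 : cos (pi * alpha / 2) < 0.
Proof.
rewrite (_ : pi * alpha / 2 = (pi * alpha / 2 - pi / 2) + pi / 2); last by ring.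
rewrite cosDpihalf oppr_lt0; apply: sin_gt0_pi.
have p0 : 0 < pi :> R := pi_gt0 R.
have q1 : 0 < pi * (alpha - 1) by rewrite mulr_gt0// subr_gt0.
have q2 : 0 < pi * (2 - alpha) by rewrite mulr_gt0// subr_gt0.
by apply/andP; split; lra.
Qed.

(** The integral of [psi] is 0 at t = 0 and changes by boundary terms only, so its limit at t = pi /
    2 is 0 too. There A is cos y - 1 and B is y - sin y, which gives a linear relation between the
    two integrals. *)
Lemma levy_sinE : levy_sin = - tan (pi * alpha / 2) * levy_cos.
Proof.
have c0 : cos (pi * alpha / 2) != 0 by rewrite lt_eqF// cos_pialpha_lt0.
suff H : cos (pi * alpha / 2) * levy_sin + sin (pi * alpha / 2) * levy_cos = 0.
  apply: (mulfI c0); rewrite /tan.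
  rewrite mulrA mulrN mulrCA divff// mulr1 mulNr.
  by apply/eqP; rewrite -addr_eq0 H.
pose a (n : nat) : R := n.+1%:R^-1; pose b (n : nat) : R := n.+1%:R.
have ab n : 0 < a n <= b n.
  by rewrite /a /b invr_gt0 ltr0n/= (@le_trans _ _ 1) ?invf_le1 ?ler1n.
have V0 n : V (a n) (b n) 0 = 0.
  rewrite /V (_ : psi 0 = cst 0) ?/Rintegral ?integral0//.
  by apply/funext => y; rewrite /psi /B !(mulr0, sin0, mul0r, subr0).
have Vb n : `|V (a n) (b n) (pi / 2)| <=
    (6 * b n `^ (- (alpha - 1)) + 4 * a n `^ (2 - alpha)) * (pi / 2).
  have := @mvt_le R (V (a n) (b n)) (fun t => ups t (b n) - ups t (a n))
    (6 * b n `^ (- (alpha - 1)) + 4 * a n `^ (2 - alpha)) 0 (pi / 2).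
  rewrite V0 !subr0 (ger0_norm (_ : 0 <= pi / 2)) ?divr_ge0 ?pi_ge0//.
  apply=> t; rewrite min_l ?max_r ?divr_ge0 ?pi_ge0// => /andP[t0 t1].
    exact: dV.
  apply: ups_bound.
  - by apply: cos_ge0_pihalf; have := pi_ge0 R; move=> ?; apply/andP; split; lra.
  - by case/andP: (ab n).
  - by rewrite /b ler1n.
have VE : V (a n) (b n) (pi / 2) @[n --> \oo] -->
    cos (pi * alpha / 2) * levy_sin + sin (pi * alpha / 2) * levy_cos.
  pose f y := psi (pi / 2) y.
  have fE : f = fun y => cos (pi * alpha / 2) * ((y - sin y) / y `^ (1 + alpha)) +
                 sin (pi * alpha / 2) * ((1 - cos y) / y `^ (1 + alpha)).
    apply/funext => y; rewrite /f /psi /A /B cos_pihalf sin_pihalf !mulr0 !mulr1 oppr0 expR0 powRN.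
    by rewrite (_ : alpha * (pi / 2) = pi * alpha / 2); ring.
  have i1 : leb.-integrable `]0%R, +oo[ (fun y => (cos (pi * alpha / 2))%:E *
      ((y - sin y) / y `^ (1 + alpha))%:E)%E.
    by apply: integrableZl => //; exact: levy_sin_integrable.
  have i2 : leb.-integrable `]0%R, +oo[ (fun y => (sin (pi * alpha / 2))%:E *
      ((1 - cos y) / y `^ (1 + alpha))%:E)%E.
    by apply: integrableZl => //; exact: levy_cos_integrable.
  have iF : leb.-integrable `]0%R, +oo[ (EFin \o f).
    have : leb.-integrable `]0%R, +oo[ ((fun y => (cos (pi * alpha / 2))%:E *
        ((y - sin y) / y `^ (1 + alpha))%:E) \+ (fun y => (sin (pi * alpha / 2))%:E *
        ((1 - cos y) / y `^ (1 + alpha))%:E))%E by exact: integrableD.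
    by apply: eq_integrable => // y _; rewrite /= fE.
  have <- : \int[leb]_(y in `]0%R, +oo[) f y =
      cos (pi * alpha / 2) * levy_sin + sin (pi * alpha / 2) * levy_cos.
    rewrite fE RintegralD//; congr (_ + _); rewrite RintegralZl//.
      exact: levy_sin_integrable.
    exact: levy_cos_integrable.
  exact: cvg_integral_window.
have B0 : (6 * b n `^ (- (alpha - 1)) + 4 * a n `^ (2 - alpha)) * (pi / 2) @[n --> \oo] --> (0 : R).
  have binf : b n @[n --> \oo] --> +oo%R.
    apply/cvgryPge => M; near=> n; rewrite /b.
    by apply: le_trans (ltW (truncnS_gt _)) _; rewrite ler_nat ltnS; near: n;
      apply: nbhs_infty_ge.
  have pa n : a n `^ (2 - alpha) = b n `^ (- (2 - alpha)).
    by rewrite /a -(powR_inv1 (ler0n _ _)) -powRrM mulN1r.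
  suff : (6 * b n `^ (- (alpha - 1)) + 4 * a n `^ (2 - alpha)) * (pi / 2)
      @[n --> \oo] --> ((6 * 0 + 4 * 0) * (pi / 2) : R).
    by rewrite !mulr0 addr0 mul0r.
  under eq_fun do rewrite pa.
  apply: cvgMl; apply: cvgD; apply: cvgMr.
    apply: (cvg_comp b (fun x => x `^ (- (alpha - 1))) binf).
    by apply: powRN_cvgy; rewrite subr_gt0.
  apply: (cvg_comp b (fun x => x `^ (- (2 - alpha))) binf).
  by apply: powRN_cvgy; rewrite subr_gt0.
have V00 : V (a n) (b n) (pi / 2) @[n --> \oo] --> (0 : R).
  apply: norm_cvg0; apply: (@squeeze_cvgr _ _ _ _ (cst 0) _ _ _ _ _ B0) => //.
    by apply: nearW => n; rewrite /= normr_ge0 Vb.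
  exact: cvg_cst.
by apply: (cvg_unique _ VE V00).
Unshelve. all: end_near. Qed.

End rotation.

(** * Fubini for dominated integrands *)

Section real_integrable.
Context {d} {T : measurableType d} {R : realType}.
Variables (m : {measure set T -> \bar R}) (D : set T) (mD : measurable D).
Implicit Types f g : T -> R.

Lemma integrable_mulr c f : m.-integrable D (EFin \o f) ->
  m.-integrable D (EFin \o (fun x => c * f x)).
Proof. by move=> i; exact: (integrableZl mD c i). Qed.

Lemma integrable_addr f g : m.-integrable D (EFin \o f) ->
  m.-integrable D (EFin \o g) -> m.-integrable D (EFin \o (fun x => f x + g x)).
Proof. by move=> i j; exact: (integrableD mD i j). Qed.

Lemma integrable_subr f g : m.-integrable D (EFin \o f) ->
  m.-integrable D (EFin \o g) -> m.-integrable D (EFin \o (fun x => f x - g x)).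
Proof. by move=> i j; exact: (integrableB mD i j). Qed.

Lemma integrable_dominated f g : measurable_fun D f ->
  (forall x, D x -> `|f x| <= g x) -> m.-integrable D (EFin \o g) ->
  m.-integrable D (EFin \o f).
Proof.
move=> mf fg; apply: le_integrable => //; first exact/measurable_EFinP.
by move=> x Dx; rewrite lee_fin (le_trans (fg x Dx))// ler_norm.
Qed.

End real_integrable.

Section dominated_Fubini.
Context {d1 d2} {T1 : measurableType d1} {T2 : measurableType d2} {R : realType}.
Variables (m1 : {sigma_finite_measure set T1 -> \bar R})
  (m2 : {sigma_finite_measure set T2 -> \bar R}).
Variables (D1 : set T1) (D2 : set T2) (mD1 : measurable D1) (mD2 : measurable D2).
Variables (F : T1 -> T2 -> R) (a : T1 -> R) (b : T2 -> R).
Hypothesis mF : measurable_fun setT (fun z => F z.1 z.2).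
Hypothesis ia : m1.-integrable D1 (EFin \o a).
Hypothesis ib : m2.-integrable D2 (EFin \o b).
Hypothesis Fab : forall x y, D1 x -> D2 y -> `|F x y| <= a x * b y.

(** Fubini is applied on the full product space, so the integrand is cut off by the indicators of
    the two domains. *)
Let G z := (F z.1 z.2 * \1_D1 z.1 * \1_D2 z.2)%R.

Let mG : measurable_fun setT G.
Proof.
apply: measurable_funM; first apply: measurable_funM => //.
  by apply: measurableT_comp => //; exact: measurable_indic.
by apply: measurableT_comp => //; exact: measurable_indic.
Qed.

Let mF1 x : measurable_fun setT (F x).
Proof. exact: (measurableT_comp mF (measurable_pair1 x)). Qed.

Let mF2 y : measurable_fun setT (F ^~ y).
Proof. exact: (measurableT_comp mF (measurable_pair2 y)). Qed.

Lemma dominated_section1 x : D1 x -> m2.-integrable D2 (EFin \o F x).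
Proof.
move=> Dx; apply: (@le_integrable _ _ _ m2 _ mD2 _ (fun y => (a x)%:E * (b y)%:E)%E).
- by apply/measurable_EFinP; exact: measurable_funTS.
- by move=> y Dy; rewrite /= lee_fin (le_trans (Fab Dx Dy))// ler_norm.
- exact: integrableZl.
Qed.

Lemma dominated_section2 y : D2 y -> m1.-integrable D1 (EFin \o F ^~ y).
Proof.
move=> Dy; apply: (@le_integrable _ _ _ m1 _ mD1 _ (fun x => (b y)%:E * (a x)%:E)%E).
- by apply/measurable_EFinP; exact: measurable_funTS.
- by move=> x Dx; rewrite /= lee_fin (le_trans (Fab Dx Dy))// mulrC ler_norm.
- exact: integrableZl.
Qed.

Let GE1 x : (\int[m2]_y (G (x, y))%:E)%E = (((fun x => \int[m2]_(y in D2) F x y) \_ D1) x)%:E.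
Proof.
rewrite patchE; case: ifPn => xD.
  rewrite -[RHS]fineK//.
  rewrite /= /Rintegral fineK; last first.
    by apply: integrable_fin_num => //; apply: dominated_section1; exact: set_mem.
  rewrite [RHS]integral_mkcond; apply: eq_integral => y _.
  rewrite /G/= patchE indicE xD mulr1 [\1__ _]indicE.
  by case: ifPn => // _; rewrite ?mulr1 ?mulr0.
rewrite integral0_eq// => y _.
by rewrite /G/= indicE (negbTE xD) mulr0 mul0r.
Qed.

Let GE2 y : (\int[m1]_x (G (x, y))%:E)%E = (((fun y => \int[m1]_(x in D1) F x y) \_ D2) y)%:E.
Proof.
rewrite patchE; case: ifPn => yD.
  rewrite /= /Rintegral fineK; last first.
    by apply: integrable_fin_num => //; apply: dominated_section2; exact: set_mem.
  rewrite [RHS]integral_mkcond; apply: eq_integral => x _.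
  rewrite /G/= patchE [\1_D2 _]indicE yD mulr1 [\1__ _]indicE.
  by case: ifPn => // _; rewrite ?mulr1 ?mulr0.
rewrite integral0_eq// => x _.
by rewrite /G/= [\1_D2 _]indicE (negbTE yD) mulr0.
Qed.

Let iG : (m1 \x m2)%E.-integrable setT (EFin \o G).
Proof.
apply/integrable12ltyP; first exact/measurable_EFinP.
apply: (@le_lt_trans _ _ (\int[m1]_(x in D1) (`|a x| * fine (\int[m2]_(y in D2) `|b y|%:E))%:E)%E).
  rewrite [leRHS]integral_mkcond; apply: ge0_le_integral => //.
  - by move=> x _; exact: integral_ge0.
  - apply: (measurable_fun_fubini_tonelli_F (fun z => `|(G z)%:E|%E)) => //=.
    by apply/measurable_EFinP; exact: measurableT_comp.
  - apply/(measurable_restrictT _ mD1)/measurable_EFinP; apply: measurable_funM => //.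
    by apply: measurableT_comp => //; apply/measurable_EFinP; exact: measurable_int ia.
  - move=> x _; rewrite patchE; case: ifPn => xD; last first.
      rewrite integral0_eq// => y _.
      by rewrite /G/= indicE (negbTE xD) mulr0 mul0r normr0.
    rewrite EFinM fineK; last first.
      have := integrable_norm ib; move=> /(integrable_fin_num mD2); exact.
    rewrite -ge0_integralZl//; last first.
      apply: measurableT_comp => //; apply: measurableT_comp => //.
      by apply/measurable_EFinP; exact: measurable_int ib.
    rewrite [leRHS]integral_mkcond; apply: ge0_le_integral => //.
    + apply/measurable_EFinP; apply: measurableT_comp => //.
      exact: (measurableT_comp mG (measurable_pair1 x)).
    + apply/(measurable_restrictT _ mD2)/measurable_EFinP; apply: measurable_funM => //.
      by apply: measurableT_comp => //; apply/measurable_EFinP; exact: measurable_int ib.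
    + move=> y _; rewrite patchE /G/= indicE xD mulr1 [\1__ _]indicE.
      case: ifPn => yD; last by rewrite mulr0 normr0.
      rewrite mulr1 lee_fin -normrM (le_trans _ (ler_norm _))//.
      by apply: Fab; exact: set_mem.
under eq_integral do rewrite EFinM.
have := integrableZr mD1 (fine (\int[m2]_(y in D2) `|b y|%:E)%E) (integrable_norm ia).
move=> /integrable_lty h; exact: (h mD1).
Qed.

Lemma Fubini_dominated :
  \int[m1]_(x in D1) \int[m2]_(y in D2) F x y =
  \int[m2]_(y in D2) \int[m1]_(x in D1) F x y.
Proof.
rewrite [LHS]Rintegral_mkcond [RHS]Rintegral_mkcond /Rintegral.
under eq_integral do rewrite -GE1.
under [in RHS]eq_integral do rewrite -GE2.
by congr fine; exact: (Fubini iG).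
Qed.

Lemma Fubini_dominated_integrable :
  m1.-integrable D1 (EFin \o (fun x => \int[m2]_(y in D2) F x y)).
Proof.
apply/integrable_mkcond => //; rewrite restrict_EFin.
have := integrable_fubini_F iG; apply: eq_integrable => // x _.
exact: GE1.
Qed.

End dominated_Fubini.

(** * Trigonometric polynomials and the generator *)

Section trigonometric_polynomials.
Context {R : realType}.
Notation leb := (@lebesgue_measure R).
Implicit Types (s : seq (R * R * R)) (q : R * R * R) (v x h u : R).

(* The triple ((c, xi), th) stands for the function x |-> c cos (xi x + th). *)
Definition trigp s x := \sum_(q <- s) q.1.1 * cos (q.1.2 * x + q.2).

(** The phase shift by pi / 2 keeps the derivative inside the class, since cos (y + pi / 2) = - sin
    y. *)
Definition trigd s : seq (R * R * R) :=
  [seq (q.1.1 * q.1.2, q.1.2, q.2 + pi / 2) | q <- s].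

Definition trigM s := \sum_(q <- s) `|q.1.1|.

(** The multiplier raises frequencies to the power alpha, and [powR] is multiplicative on
    nonnegative reals. Any cosine can be brought to this form by parity. *)
Definition nnfreq s := all (fun q => 0 <= q.1.2) s.

Lemma trigp_bound s x : `|trigp s x| <= trigM s.
Proof.
rewrite /trigp /trigM; apply: le_trans (ler_norm_sum _ _ _) _.
by apply: ler_sum => q _; rewrite normrM ler_piMr// cos_max.
Qed.

Lemma trigM_ge0 s : 0 <= trigM s.
Proof. by apply: sumr_ge0. Qed.

Lemma trigp_taylor s x h :
  `|trigp s (x + h) - trigp s x - h * trigp (trigd s) x| <= trigM (trigd (trigd s)) * h ^+ 2.
Proof.
rewrite /trigM /trigp !big_map mulr_sumr -!sumrB mulr_suml.
apply: le_trans (ler_norm_sum _ _ _) _; apply: ler_sum => -[[c xi] th] _ /=.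
have -> : c * cos (xi * (x + h) + th) - c * cos (xi * x + th) -
    h * (c * xi * cos (xi * x + (th + pi / 2))) =
    c * (cos (xi * x + th + xi * h) - cos (xi * x + th) + xi * h * sin (xi * x + th)).
  rewrite (addrA _ th) cosDpihalf (_ : xi * (x + h) + th = xi * x + th + xi * h); first by ring.
  by ring.
rewrite 3!normrM -2!(mulrA `|c|) ler_wpM2l//.
apply: le_trans (cos_taylor _ _) _.
by rewrite exprMn -(ger0_norm (sqr_ge0 xi)) expr2 normrM.
Qed.

Lemma trigp_lip s x h : `|trigp s (x + h) - trigp s x| <= trigM (trigd s) * `|h|.
Proof.
rewrite /trigM /trigp !big_map -!sumrB mulr_suml.
apply: le_trans (ler_norm_sum _ _ _) _; apply: ler_sum => -[[c xi] th] _ /=.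
rewrite -mulrBr !normrM -mulrA ler_wpM2l// -normrM.
apply: le_trans (ler_norm_cosB _ _) _.
by rewrite (_ : xi * (x + h) + th - (xi * x + th) = xi * h)//; ring.
Qed.

Lemma trigp_derive s x : is_derive x 1 (trigp s) (trigp (trigd s) x).
Proof.
by apply: (is_derive_quadratic (c := trigM (trigd (trigd s)))) => h; exact: trigp_taylor.
Qed.

Lemma trigp_continuous s : continuous (trigp s).
Proof. by move=> x; exact: is_derive_to_continuous (trigp_derive s x). Qed.

Lemma trigp_measurable s : measurable_fun setT (trigp s).
Proof. by apply: continuous_measurable_fun; exact: trigp_continuous. Qed.

End trigonometric_polynomials.

(** * The generator as a Fourier multiplier *)

Section levy_operator.
Context {R : realType}.
Notation leb := (@lebesgue_measure R).
Variables (alpha beta : R) (halpha : 1 < alpha < 2).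
Implicit Types (s : seq (R * R * R)) (q : R * R * R) (v x h u : R) (g : R -> R).

Let a1 : 1 < alpha. Proof. by case/andP: halpha. Qed.
(** The integrand of the generator folded onto the positive half-line; the factors 1/2 and [d_alpha]
    stay outside. *)
Definition levy_even g u := ((1 + beta) * g u + (1 - beta) * g (- u)) / u `^ (1 + alpha).

Definition levy_op g := \int[leb]_(u in `]0%R, +oo[) levy_even g u.

Lemma d_alphaE : d_alpha alpha = (levy_cos alpha)^-1.
Proof. by []. Qed.

(** The normalisation [d_alpha] is the inverse of this integral, so it cancels only if the integral
    is nonzero. The part over [1, 2] is already positive. *)
Lemma levy_cos_gt0 : 0 < levy_cos alpha.
Proof.
have i := levy_cos_integrable halpha.
have h1 : 0 < (1 - cos 1) / 2 `^ (1 + alpha) :> R.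
  by rewrite divr_gt0 ?powR_gt0// subr_gt0 cos1_lt1.
apply: (lt_le_trans h1).
have E : \int[leb]_(x in `[1, 2]) ((1 - cos 1) / 2 `^ (1 + alpha) : R) = (1 - cos 1) / 2 `^ (1 + alpha).
  by rewrite Rintegral_cst//= lebesgue_measure_itv/= lte_fin ltr1n/= mulrBr; lra.
rewrite -[leLHS]E /levy_cos.
have S : `[1, 2] `<=` (`]0, +oo[ : set R).
  by move=> y; rewrite /= !in_itv/= andbT => /andP[+ _]; apply: lt_le_trans.
apply: (@le_trans _ _ (\int[leb]_(y in `[1, 2]) ((1 - cos y) / y `^ (1 + alpha)))).
  apply: le_Rintegral => //.
  - by apply: continuous_segment_integrable => x _; exact: cst_continuous.
  - exact: integrableS i.
  - move=> y; rewrite /= in_itv/= => /andP[y1 y2].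
    have y0 : 0 < y by exact: lt_le_trans y1.
    apply: ler_pM; rewrite ?cos_ge1B ?invr_ge0 ?powR_ge0//.
      by rewrite lerD2l lerN2 cos_le_cos1// y1.
    by rewrite lef_pV2 ?posrE ?powR_gt0//; apply: ge0_ler_powR; rewrite ?nnegrE; have := a1; lra.
rewrite /Rintegral fine_le//.
- by apply: integrable_fin_num => //; exact: integrableS i.
- exact: integrable_fin_num.
- apply: ge0_subset_integral => //; first exact: measurable_int i.
  by move=> y _; rewrite lee_fin divr_ge0 ?cos_ge1B ?powR_ge0.
Qed.

Lemma levy_even_integrable g (c : R) : measurable_fun setT g ->
  (forall u, `|g u| <= c * `|u|) -> (forall u, `|g u| <= c * u ^+ 2) ->
  leb.-integrable `]0%R, +oo[ (EFin \o levy_even g).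
Proof.
move=> mg g1 g2.
apply: (levy_dominated_integrable halpha (c := (`|1 + beta| + `|1 - beta|) * c)).
- apply: measurable_funD; apply: measurable_funM => //.
  by apply: measurableT_comp => //; exact: oppr_measurable.
- move=> u u0; apply: le_trans (ler_normD _ _) _; rewrite !normrM mulrDl mulrDl.
  have e := gtr0_norm u0.
  apply: lerD; rewrite -mulrA ler_wpM2l//; first by have := g1 u; rewrite e.
  by have := g1 (- u); rewrite normrN e.
- move=> u u0; apply: le_trans (ler_normD _ _) _; rewrite !normrM mulrDl mulrDl.
  apply: lerD; rewrite -mulrA ler_wpM2l//.
  by have := g2 (- u); rewrite sqrrN.
Qed.

(** [gen_integrand] is 0 at u = 0, as [half_lines] requires, and the two bounds on [g] make each
    half integrable. *)
Lemma LgenE (phi : R -> R) x (c : R) :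
  let g u := phi (u + x) - phi x - u * derive1 phi x in
  measurable_fun setT g ->
  (forall u, `|g u| <= c * `|u|) -> (forall u, `|g u| <= c * u ^+ 2) ->
  Lgen alpha beta phi x = (levy_cos alpha)^-1 / 2 * levy_op g.
Proof.
move=> g mg g1 g2; rewrite /Lgen d_alphaE -mulrA; congr (_ * _).
have f0 : gen_integrand alpha beta phi x 0 = 0 by rewrite /gen_integrand ltxx mulr0.
have fp u : 0 < u -> gen_integrand alpha beta phi x u = 2^-1 * ((1 + beta) * g u) / u `^ (1 + alpha).
  move=> u0; rewrite /gen_integrand u0 gtr0_norm// invfM -/(g u); ring.
have fm u : 0 < u -> gen_integrand alpha beta phi x (- u) = 2^-1 * ((1 - beta) * g (- u)) / u `^ (1 + alpha).
  move=> u0; rewrite /gen_integrand oppr_gt0 oppr_lt0 u0 ltNge (ltW u0)/=.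
  by rewrite normrN gtr0_norm// invfM -/(g (- u)); ring.
have gn1 u : 0 < u -> `|g u| <= c * u by move=> u0; have := g1 u; rewrite (gtr0_norm u0).
have gn2 u : 0 < u -> `|g (- u)| <= c * u by move=> u0; have := g1 (- u); rewrite (normrN u) (gtr0_norm u0).
have mgN : measurable_fun setT (fun u => g (- u)).
  by apply: measurableT_comp => //; exact: oppr_measurable.
have ip : leb.-integrable `]0%R, +oo[ (EFin \o (fun u => 2^-1 * ((1 + beta) * g u) / u `^ (1 + alpha))).
  apply: (levy_dominated_integrable halpha (c := `|2^-1 * (1 + beta)| * c)).
  - by apply: measurable_funM => //; apply: measurable_funM.
  - by move=> u u0; rewrite mulrA normrM -mulrA ler_wpM2l// gn1.
  - by move=> u u0; rewrite mulrA normrM -mulrA ler_wpM2l.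
have im : leb.-integrable `]0%R, +oo[ (EFin \o (fun u => 2^-1 * ((1 - beta) * g (- u)) / u `^ (1 + alpha))).
  apply: (levy_dominated_integrable halpha (c := `|2^-1 * (1 - beta)| * c)).
  - by apply: measurable_funM => //; apply: measurable_funM.
  - by move=> u u0; rewrite mulrA normrM -mulrA ler_wpM2l// gn2.
  - by move=> u u0; rewrite mulrA normrM -mulrA ler_wpM2l//; have := g2 (- u); rewrite sqrrN.
have [| |_ H] := half_lines f0.
- apply: eq_integrable ip => // u; rewrite inE/= in_itv/= andbT => u0.
  by rewrite fp.
- apply: eq_integrable im => // u; rewrite inE/= in_itv/= andbT => u0.
  by rewrite fm.
transitivity (Rintegral leb setT (gen_integrand alpha beta phi x)); first by [].
rewrite H /levy_op.
rewrite -RintegralZl//; last by apply: (levy_even_integrable mg g1 g2).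
rewrite (eq_Rintegral leb (g := fun u => 2^-1 * ((1 + beta) * g u) / u `^ (1 + alpha))); last first.
  by move=> u; rewrite inE/= in_itv/= andbT; exact: fp.
rewrite [X in _ + X](eq_Rintegral leb (g := fun u => 2^-1 * ((1 - beta) * g (- u)) / u `^ (1 + alpha))); last first.
  by move=> u; rewrite inE/= in_itv/= andbT; exact: fm.
rewrite -RintegralD//; apply: eq_Rintegral => u _.
by rewrite /levy_even; ring.
Qed.

Let kap := beta * tan (pi * alpha / 2).

(** The argument equals cos th (cos (xi u) - 1) + sin th (xi u - sin (xi u)). Folding doubles the
    even part and multiplies the odd part by 2 beta; rescaling u gives the power of xi, and
    [levy_sinE] expresses everything through [levy_cos]. *)
Lemma levy_op_cos (xi th : R) : 0 <= xi ->
  levy_op (fun u => cos (xi * u + th) - cos th + xi * u * sin th) =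
  - 2 * levy_cos alpha * (xi `^ alpha * (cos th + kap * sin th)).
Proof.
rewrite le_eqVlt => /predU1P[<-|xi0].
  rewrite powR0 ?mul0r ?mulr0; last by rewrite gt_eqF // (lt_trans ltr01 a1).
  rewrite /levy_op (eq_Rintegral leb (g := fun=> 0)); first by rewrite /Rintegral integral0.
  by move=> u _; rewrite /levy_even !mul0r add0r subrr addr0 !mulr0 addr0 mul0r.
pose f1 y := (1 - cos y) / y `^ (1 + alpha).
pose f2 y := (y - sin y) / y `^ (1 + alpha).
have i1 := levy_cos_integrable halpha; have i2 := levy_sin_integrable halpha.
have j1 := integrable_scale_itv0y xi0 i1; have j2 := integrable_scale_itv0y xi0 i2.
have xa : xi `^ (1 + alpha) = xi * xi `^ alpha.
  rewrite powRD; last by rewrite (gt_eqF xi0) implybT.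
  by rewrite powRr1 ?(ltW xi0).
rewrite /levy_op.
rewrite (eq_Rintegral leb (g := fun u => - 2 * cos th * xi `^ (1 + alpha) * f1 (xi * u) +
     2 * beta * sin th * xi `^ (1 + alpha) * f2 (xi * u))); last first.
  move=> u; rewrite inE/= in_itv/= andbT => u0.
  rewrite /levy_even /f1 /f2 powRM ?ltW// mulrN !cosD sinN cosN.
  by field; rewrite !gt_eqF ?powR_gt0.
rewrite RintegralD//=; first last.
- exact: integrable_mulr.
- exact: integrable_mulr.
rewrite !RintegralZl// (Rintegral_scale_itv0y (f := f1))// (Rintegral_scale_itv0y (f := f2))//.
rewrite -/(levy_cos alpha) -/(levy_sin alpha) levy_sinE// xa /kap.
by field; rewrite gt_eqF.
Qed.

(** This is minus the generator applied to [trigp s]: under the normalisation of [LgenE] the factor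
    [- 2 * levy_cos alpha] of [levy_op_cos] becomes -1. *)
Definition trigL s x :=
  \sum_(q <- s) q.1.1 * (q.1.2 `^ alpha * (cos (q.1.2 * x + q.2) + kap * sin (q.1.2 * x + q.2))).

Lemma levy_op_trigp s x : nnfreq s ->
  levy_op (fun u => trigp s (x + u) - trigp s x - u * trigp (trigd s) x) =
  - 2 * levy_cos alpha * trigL s x.
Proof.
elim: s => [_|q s IH /andP[q0 s0]].
  rewrite /trigp /trigL !big_nil mulr0 /levy_op (eq_Rintegral leb (g := fun=> 0)).
    by rewrite /Rintegral integral0.
  by move=> u _; rewrite /levy_even !big_nil !subrr !mulr0 subrr !mulr0 addr0 mul0r.
pose g u := cos (q.1.2 * u + (q.1.2 * x + q.2)) - cos (q.1.2 * x + q.2) +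
            q.1.2 * u * sin (q.1.2 * x + q.2).
pose G u := trigp s (x + u) - trigp s x - u * trigp (trigd s) x.
have gE : g = fun u => trigp [:: (1, q.1.2, q.2)] (x + u) - trigp [:: (1, q.1.2, q.2)] x -
    u * trigp (trigd [:: (1, q.1.2, q.2)]) x.
  apply/funext => u; rewrite /g /trigp !big_cons !big_nil/= (addrA _ _ (pi / 2)) cosDpihalf.
  by rewrite (_ : q.1.2 * (x + u) + q.2 = q.1.2 * u + (q.1.2 * x + q.2)); ring.
have tb s' : exists c, [/\ measurable_fun setT (fun u => trigp s' (x + u) - trigp s' x - u * trigp (trigd s') x),
    forall u, `|trigp s' (x + u) - trigp s' x - u * trigp (trigd s') x| <= c * `|u| &
    forall u, `|trigp s' (x + u) - trigp s' x - u * trigp (trigd s') x| <= c * u ^+ 2].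
  exists (trigM (trigd s') + trigM (trigd s') + trigM (trigd (trigd s'))); split.
  - apply: measurable_funB; last by apply: measurable_funM.
    by apply: measurable_funB => //; apply: measurableT_comp; [exact: trigp_measurable|exact: measurable_funD].
  - move=> u; apply: le_trans (ler_normB _ _) _; rewrite mulrDl.
    rewrite -[leLHS]addr0 lerD ?mulr_ge0 ?trigM_ge0// mulrDl lerD ?trigp_lip//.
    by rewrite normrM mulrC ler_wpM2r// trigp_bound.
  - move=> u; apply: le_trans (trigp_taylor _ _ _) _.
    by rewrite ler_wpM2r ?sqr_ge0// lerDr addr_ge0// trigM_ge0.
have ig : leb.-integrable `]0%R, +oo[ (EFin \o levy_even g).
  by have [c [? ? ?]] := tb [:: (1, q.1.2, q.2)]; rewrite gE; apply: (levy_even_integrable (c := c)).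
have iG : leb.-integrable `]0%R, +oo[ (EFin \o levy_even G).
  by have [c [? ? ?]] := tb s; apply: (levy_even_integrable (c := c)).
have ig' : leb.-integrable `]0%R, +oo[ (EFin \o (fun u => q.1.1 * levy_even g u)).
  exact: integrable_mulr.
transitivity (q.1.1 * levy_op g + levy_op G).
  rewrite /levy_op -RintegralZl// -RintegralD//; apply: eq_Rintegral => u _.
  have h w : trigp (q :: s) (x + w) - trigp (q :: s) x - w * trigp (trigd (q :: s)) x =
     q.1.1 * g w + G w.
    rewrite /G /g /trigp !big_cons/= (addrA _ _ (pi / 2)) cosDpihalf.
    by rewrite (_ : q.1.2 * (x + w) + q.2 = q.1.2 * w + (q.1.2 * x + q.2)); ring.
  by rewrite {1}/levy_even !h /levy_even; ring.
by rewrite levy_op_cos// IH// {2}/trigL big_cons /trigL; ring.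
Qed.

End levy_operator.

(** * The Stein equation *)

Lemma powRN1_mul {R : realType} (v : R) : 0 < v -> v `^ (- 1) * v = 1.
Proof.
move=> v0; have h : v `^ (- 1) = v^-1 by apply: powR_inv1; exact: ltW.
by rewrite h mulVf //; exact: lt0r_neq0.
Qed.

Section Stein_solution.
Context {R : realType}.
Notation leb := (@lebesgue_measure R).
Variables (alpha beta : R) (halpha : 1 < alpha < 2).
Implicit Types (s : seq (R * R * R)) (q : R * R * R) (b c v x h u : R) (g : R -> R).

Let a1 : 1 < alpha. Proof. by case/andP: halpha. Qed.
Let kap := beta * tan (pi * alpha / 2).
Let k := alpha^-1.
Let a0 : 0 < alpha. Proof. exact: lt_trans a1. Qed.
Let k0 : 0 < k. Proof. by rewrite invr_gt0. Qed.

Let vk_le1 v : 0 < v < 1 -> v `^ k <= 1.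
Proof.
move=> /andP[v0 v1]; have := @ge0_ler_powR R k (ltW k0) v 1.
by rewrite !nnegrE powR1 (ltW v0) (ltW v1) ler01 => /(_ isT isT isT).
Qed.

(* trigp (trigE v s) x is the mean of trigp s (x + (1 - v)^(1/alpha) Z) for Z of
   law S_alpha(1, beta). *)
Definition trigE v s : seq (R * R * R) :=
  [seq (q.1.1 * expR (- ((1 - v) * q.1.2 `^ alpha)), q.1.2,
        q.2 + kap * ((1 - v) * q.1.2 `^ alpha)) | q <- s].

Definition trigS r s : seq (R * R * R) := [seq (q.1.1, r * q.1.2, q.2) | q <- s].

Lemma trigd_trigE v s : trigd (trigE v s) = trigE v (trigd s).
Proof.
rewrite /trigd /trigE -!map_comp; apply: eq_map => -[[c xi] th] /=.
by congr (_, _, _); ring.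
Qed.

Lemma trigM_trigE v s : v <= 1 -> trigM (trigE v s) <= trigM s.
Proof.
move=> v1; rewrite /trigM big_map; apply: ler_sum => q _ /=.
rewrite normrM ler_piMr// ger0_norm ?expR_ge0// expRN_le1//.
by rewrite mulr_ge0 ?powR_ge0// subr_ge0.
Qed.

Lemma trigE1 s : trigE 1 s = s.
Proof.
rewrite /trigE -[RHS]map_id; apply: eq_map => -[[c xi] th] /=.
by rewrite subrr !mul0r oppr0 expR0 mulr0 mulr1 addr0.
Qed.

Lemma trigE_measurable d (T : measurableType d) (V X : T -> R) s :
  measurable_fun setT V -> measurable_fun setT X ->
  measurable_fun setT (fun z => trigp (trigE (V z) s) (X z)).
Proof.
move=> mV mX; elim: s => [|q s IH].
  rewrite (_ : (fun z => _) = cst 0)//; apply/funext => z; exact: big_nil.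
rewrite /trigp /=; under eq_fun do rewrite big_cons.
apply: measurable_funD; last exact: IH.
have m1 : measurable_fun setT (fun z => (1 - V z) * q.1.2 `^ alpha).
  by apply: measurable_funM => //; exact: measurable_funB.
apply: measurable_funM => /=.
  apply: measurable_funM => //; apply: measurableT_comp; first exact: measurable_expR.
  by apply: measurableT_comp => //; exact: oppr_measurable.
apply: measurableT_comp.
  by apply: continuous_measurable_fun; exact: continuous_cos.
apply: measurable_funD; first exact: measurable_funM.
by apply: measurable_funD => //; exact: measurable_funM.
Qed.

Lemma trigp_trigS r s x : trigp (trigS r s) x = trigp s (r * x).
Proof.
by rewrite /trigp big_map; apply: eq_bigr => q _ /=; rewrite mulrCA mulrA.
Qed.

Lemma trigp_trigd_trigS r s x : trigp (trigd (trigS r s)) x = r * trigp (trigd s) (r * x).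
Proof.
rewrite /trigp !big_map mulr_sumr; apply: eq_bigr => q _ /=.
by rewrite (_ : r * q.1.2 * x = q.1.2 * (r * x)); ring.
Qed.

(** Homogeneity of order alpha: at r = v^(1/alpha) the factor is v, which cancels the weight v^(-1)
    of the solution. *)
Lemma trigL_trigS r s x : 0 <= r -> nnfreq s ->
  trigL alpha beta (trigS r s) x = r `^ alpha * trigL alpha beta s (r * x).
Proof.
move=> r0 /allP s0; rewrite /trigL big_map mulr_sumr; apply: eq_big_seq => q /s0 q0 /=.
rewrite powRM// (_ : r * q.1.2 * x = q.1.2 * (r * x)); first by ring.
by ring.
Qed.

Lemma nnfreq_trigS r s : 0 <= r -> nnfreq s -> nnfreq (trigS r s).
Proof. by move=> r0; rewrite /nnfreq all_map; apply: sub_all => q /= q0; exact: mulr_ge0. Qed.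

Lemma nnfreq_trigE v s : nnfreq s -> nnfreq (trigE v s).
Proof. by rewrite /nnfreq all_map. Qed.

Lemma powR_itv01_integral c : 0 < c ->
  leb.-integrable `]0%R, 1%R[ (EFin \o (fun v => v `^ (c - 1))) /\
  \int[leb]_(v in `]0%R, 1%R[) v `^ (c - 1) = c^-1.
Proof.
move=> c0.
have dF x : 0 < x < 1 -> is_derive x 1 (fun v => c^-1 * v `^ c) (x `^ (c - 1)).
  move=> /andP[x0 _]; derive; last by field; exact: lt0r_neq0.
have cf x : 0 < x < 1 -> {for x, continuous (fun v => v `^ (c - 1))}.
  by move=> /andP[x0 _]; apply: is_derive_to_continuous (is_derive1_powR _ x0).
have F0 : c^-1 * v `^ c @[v --> (0 : R)^'+] --> c^-1 * 0.
  by apply: cvgMr; exact: powR_cvg0.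
have F1 : c^-1 * v `^ c @[v --> (1 : R)^'-] --> c^-1 * 1 `^ c.
  apply: cvgMr; apply: cvg_at_left_filter.
  exact: (is_derive_to_continuous (is_derive1_powR _ (ltr01 : (0:R) < 1))).
have f0 x : 0 < x < 1 -> 0 <= x `^ (c - 1) by move=> _; exact: powR_ge0.
split; first exact: (ge0_FTC_itv01_integrable dF cf F0 F1 f0).
by rewrite /Rintegral (ge0_FTC_itv01 dF cf F0 F1 f0) powR1 mulr0 mulr1 subr0.
Qed.

(** One family for the solution and its derivatives: (c, b) = (0, 1) is the solution up to sign, and
    each derivative in x adds [k] to [c] and sets [b] to 0. *)
Let jint s c b x v := v `^ (c - 1) * (trigp (trigE v s) (v `^ k * x) - b * trigp (trigE v s) 0).
Definition stein_int s c b x := \int[leb]_(v in `]0%R, 1%R[) jint s c b x v.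

Let jint_measurable s c b x D : measurable_fun D (jint s c b x).
Proof.
apply: measurable_funTS; apply: measurable_funM; first exact: measurable_powR.
apply: measurable_funB; first apply: trigE_measurable => //.
  by apply: measurable_funM => //; exact: measurable_powR.
by apply: measurable_funM => //; exact: trigE_measurable.
Qed.

Lemma stein_int_integrable s c b x : 0 < c ->
  leb.-integrable `]0%R, 1%R[ (EFin \o jint s c b x).
Proof.
move=> c0; have [ic _] := powR_itv01_integral c0.
apply: (@integrable_dominated _ _ _ leb _ (measurable_itv _) _ (fun v => ((1 + `|b|) * trigM s) * v `^ (c - 1))).
- exact: jint_measurable.
- move=> v; rewrite /= in_itv/= => /andP[v0 v1].
  rewrite /jint normrM (ger0_norm (powR_ge0 _ _)) mulrC ler_wpM2r ?powR_ge0//.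
  apply: le_trans (ler_normB _ _) _; rewrite normrM mulrDl mul1r.
  have M y : `|trigp (trigE v s) y| <= trigM s.
    by apply: le_trans (trigp_bound _ _) _; exact: trigM_trigE (ltW v1).
  by rewrite lerD// ler_wpM2l.
- exact: integrable_mulr.
Qed.

(** At c = 0 the weight v^(-1) is not integrable, but the difference with the value at 0 is O(v^k)
    by the Lipschitz bound. *)
Lemma stein_int_integrable0 s x : leb.-integrable `]0%R, 1%R[ (EFin \o jint s 0 1 x).
Proof.
have [ic _] := powR_itv01_integral k0.
apply: (@integrable_dominated _ _ _ leb _ (measurable_itv _) _ (fun v => (trigM (trigd s) * `|x|) * v `^ (k - 1))).
- exact: jint_measurable.
- move=> v; rewrite /= in_itv/= => /andP[v0 v1].
  rewrite /jint normrM (ger0_norm (powR_ge0 _ _)) mul1r.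
  have := trigp_lip (trigE v s) 0 (v `^ k * x); rewrite add0r trigd_trigE => H.
  rewrite [leRHS](_ : _ = v `^ (0 - 1) * (trigM (trigd s) * `|v `^ k * x|)).
    rewrite ler_wpM2l ?powR_ge0//; apply: le_trans H _.
    by rewrite ler_wpM2r//; exact: trigM_trigE (ltW v1).
  rewrite normrM (ger0_norm (powR_ge0 _ _)) (_ : k - 1 = (0 - 1) + k); last by ring.
  rewrite powRD; last by rewrite (gt_eqF v0) implybT.
  by ring.
- exact: integrable_mulr.
Qed.

(** The Taylor remainder is of order (v^k h)^2, at most v^k h^2 as v < 1. Integrating v^(c + k - 1)
    gives the constant 1 / (c + k) for [is_derive_quadratic]. *)
Lemma stein_int_derive s c b x :
  (forall y, leb.-integrable `]0%R, 1%R[ (EFin \o jint s c b y)) -> 0 < c + k ->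
  is_derive x 1 (stein_int s c b) (stein_int (trigd s) (c + k) 0 x).
Proof.
move=> ij ck.
apply: (is_derive_quadratic (c := trigM (trigd (trigd s)) * (c + k)^-1)) => h.
have [ic icE] := powR_itv01_integral ck.
have ijd := stein_int_integrable (trigd s) 0 x ck.
rewrite /stein_int -RintegralB// -RintegralZl// -RintegralB//; last 2 first.
- exact: integrable_subr.
- exact: integrable_mulr.
have iJ : leb.-integrable `]0%R, 1%R[ (EFin \o (fun v => jint s c b (x + h) v - jint s c b x v -
    h * jint (trigd s) (c + k) 0 x v)).
  by apply: integrable_subr => //; [exact: integrable_subr|exact: integrable_mulr].
apply: le_trans (le_normr_Rintegral _ iJ) _ => //.
rewrite mulrAC -icE -RintegralZl//; apply: le_Rintegral => //.
- exact: integrable_norm.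
- exact: integrable_mulr.
move=> v; rewrite /= in_itv/= => /andP[v0 v1].
have vk : v `^ (c + k - 1) = v `^ (c - 1) * v `^ k.
  by rewrite -powRD; [congr powR; ring|rewrite (gt_eqF v0) implybT].
have vk1 : v `^ k <= 1.
  by apply: vk_le1; rewrite v0.
rewrite /jint vk mul0r subr0 (_ : _ - _ = v `^ (c - 1) * (trigp (trigE v s) (v `^ k * x + v `^ k * h) -
  trigp (trigE v s) (v `^ k * x) - v `^ k * h * trigp (trigE v (trigd s)) (v `^ k * x))); last by rewrite (mulrDr _ x h); ring.
rewrite normrM (ger0_norm (powR_ge0 _ _)) -trigd_trigE.
rewrite [leRHS](_ : _ = v `^ (c - 1) * (trigM (trigd (trigd s)) * (v `^ k * h ^+ 2))); last by ring.
rewrite ler_wpM2l ?powR_ge0//; apply: le_trans (trigp_taylor _ _ _) _.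
rewrite !trigd_trigE; apply: ler_pM; rewrite ?trigM_ge0 ?sqr_ge0//.
  exact: trigM_trigE (ltW v1).
by rewrite exprMn ler_wpM2r ?sqr_ge0// expr2 ler_piMl ?powR_ge0.
Qed.

Definition stein_sol s x := - stein_int s 0 1 x.
Definition stein_d1 s x := - stein_int (trigd s) k 0 x.
Definition stein_d2 s x := - stein_int (trigd (trigd s)) (k + k) 0 x.

Lemma stein_sol_derive s x : is_derive x 1 (stein_sol s) (stein_d1 s x).
Proof.
rewrite /stein_sol /stein_d1; apply: derive_opp.
rewrite -{1}(add0r k); apply: stein_int_derive; last by rewrite add0r.
exact: stein_int_integrable0.
Qed.

Lemma stein_d1_derive s x : is_derive x 1 (stein_d1 s) (stein_d2 s x).
Proof.
rewrite /stein_d1 /stein_d2; apply: derive_opp; apply: stein_int_derive.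
  by move=> y; exact: stein_int_integrable.
exact: addr_gt0.
Qed.

Lemma stein_d2_continuous s : continuous (stein_d2 s).
Proof.
move=> x; have : is_derive x 1 (stein_d2 s) (- stein_int (trigd (trigd (trigd s))) (k + k + k) 0 x).
  rewrite /stein_d2; apply: derive_opp; apply: stein_int_derive; last by rewrite !addr_gt0.
  by move=> y; apply: stein_int_integrable; exact: addr_gt0.
exact: is_derive_to_continuous.
Qed.

Lemma stein_sol_derive1 s : derive1 (stein_sol s) = stein_d1 s.
Proof. by apply/funext => x; apply: is_derive_to_derive1; exact: stein_sol_derive. Qed.

Lemma stein_d1_derive1 s : derive1 (stein_d1 s) = stein_d2 s.
Proof. by apply/funext => x; apply: is_derive_to_derive1; exact: stein_d1_derive. Qed.

Lemma stein_sol_C2 s : C2 (stein_sol s).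
Proof.
rewrite /C2 stein_sol_derive1 stein_d1_derive1; split.
  by move=> x; apply: ex_derive; exact: stein_sol_derive.
split; last exact: stein_d2_continuous.
by move=> x; apply: ex_derive; exact: stein_d1_derive.
Qed.

Lemma stein_d1E s x : stein_d1 s x =
  - \int[leb]_(v in `]0%R, 1%R[) (v `^ (k - 1) * trigp (trigE v (trigd s)) (v `^ k * x)).
Proof.
rewrite /stein_d1 /stein_int; congr (- _); apply: eq_Rintegral => v _.
by rewrite /jint mul0r subr0.
Qed.

Lemma stein_d2E s x : stein_d2 s x =
  - \int[leb]_(v in `]0%R, 1%R[) (v `^ (k + k - 1) * trigp (trigE v (trigd (trigd s))) (v `^ k * x)).
Proof.
rewrite /stein_d2 /stein_int; congr (- _); apply: eq_Rintegral => v _.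
by rewrite /jint mul0r subr0.
Qed.

Let incr s v x u := trigp (trigE v s) (v `^ k * (x + u)) - trigp (trigE v s) (v `^ k * x) -
  u * (v `^ k * trigp (trigE v (trigd s)) (v `^ k * x)).

Let incrC s := 2 * trigM (trigd s) + trigM (trigd (trigd s)).

Let incrC_ge0 s : 0 <= incrC s.
Proof. by apply: addr_ge0; rewrite ?mulr_ge0 ?trigM_ge0. Qed.

(** The factor v^k makes the bound integrable against v^(-1). In the quadratic regime v^(2k) is
    bounded by v^k, so that one product majorant covers both regimes. *)
Let incr_bound s v x u : 0 < v < 1 ->
  `|incr s v x u| <= incrC s * v `^ k * Num.min `|u| (u ^+ 2).
Proof.
move=> /andP[v0 v1].
have vk1 : v `^ k <= 1.
  by apply: vk_le1; rewrite v0.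
have M1 := trigM_ge0 (trigd s); have M2 := trigM_ge0 (trigd (trigd s)).
have E1 := trigM_trigE (trigd s) (ltW v1).
have E2 := trigM_trigE (trigd (trigd s)) (ltW v1).
have -> : incr s v x u = trigp (trigE v s) (v `^ k * x + v `^ k * u) - trigp (trigE v s) (v `^ k * x) -
   (v `^ k * u) * trigp (trigE v (trigd s)) (v `^ k * x) by rewrite /incr (mulrDr _ x u); ring.
rewrite minEle; case: ifP => _.
  apply: le_trans (ler_normB _ _) _.
  apply: (@le_trans _ _ (trigM (trigd s) * (v `^ k * `|u|) + trigM (trigd s) * (v `^ k * `|u|))).
    apply: lerD.
      apply: le_trans (trigp_lip _ _ _) _; rewrite trigd_trigE normrM (ger0_norm (powR_ge0 _ _)).
      by rewrite ler_wpM2r// mulr_ge0 ?powR_ge0.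
    rewrite !normrM (ger0_norm (powR_ge0 _ _)) mulrC ler_wpM2r ?mulr_ge0 ?powR_ge0//.
    exact: le_trans (trigp_bound _ _) E1.
  rewrite -[leRHS]mulrA -mulrDl ler_wpM2r ?mulr_ge0 ?powR_ge0// /incrC; lra.
rewrite -trigd_trigE; apply: le_trans (trigp_taylor _ _ _) _; rewrite !trigd_trigE.
rewrite exprMn -mulrA; apply: ler_pM.
- exact: trigM_ge0.
- by rewrite mulr_ge0 ?sqr_ge0.
- by apply: le_trans E2 _; rewrite /incrC lerDr mulr_ge0.
by rewrite ler_wpM2r ?sqr_ge0// expr2 ler_piMl ?powR_ge0.
Qed.

Let incr_integrable s x u :
  leb.-integrable `]0%R, 1%R[ (EFin \o (fun v => v `^ (- 1) * incr s v x u)).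
Proof.
have i1 := stein_int_integrable0 s (x + u); have i2 := stein_int_integrable0 s x.
have i3 := stein_int_integrable (trigd s) 0 x k0.
have : leb.-integrable `]0%R, 1%R[ (EFin \o (fun v => jint s 0 1 (x + u) v - jint s 0 1 x v -
    u * jint (trigd s) k 0 x v)).
  by apply: integrable_subr => //; [exact: integrable_subr|exact: integrable_mulr].
apply: eq_integrable => // v; rewrite inE/= in_itv/= => /andP[v0 v1].
congr EFin; rewrite /jint /incr sub0r (_ : k - 1 = - 1 + k); last by ring.
rewrite powRD; last by rewrite (gt_eqF v0) implybT.
by ring.
Qed.

Let incr_integral s x u : stein_sol s (x + u) - stein_sol s x - u * stein_d1 s x =
  - \int[leb]_(v in `]0%R, 1%R[) (v `^ (- 1) * incr s v x u).
Proof.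
have i1 := stein_int_integrable0 s (x + u); have i2 := stein_int_integrable0 s x.
have i3 := stein_int_integrable (trigd s) 0 x k0.
rewrite (_ : stein_sol s (x + u) - stein_sol s x - u * stein_d1 s x =
  - (stein_int s 0 1 (x + u) - stein_int s 0 1 x - u * stein_int (trigd s) k 0 x)); last first.
  by rewrite /stein_sol /stein_d1; ring.
congr (- _).
rewrite /stein_int -RintegralB// -RintegralZl// -RintegralB//; last 2 first.
- exact: integrable_subr.
- exact: integrable_mulr.
apply: eq_Rintegral => v; rewrite inE/= in_itv/= => /andP[v0 v1].
rewrite /jint /incr sub0r (_ : k - 1 = - 1 + k); last by ring.
rewrite powRD; last by rewrite (gt_eqF v0) implybT.
by ring.
Qed.

Let vkalpha v : 0 < v -> (v `^ k) `^ alpha = v.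
Proof.
move=> v0; rewrite -powRrM /k mulVf ?powRr1 ?(ltW v0)//.
by rewrite gt_eqF.
Qed.

Let Fuv s x u v := v `^ (- 1) * levy_even alpha beta (incr s v x) u.

Let incr_trigS s v x : incr s v x =
  fun u => trigp (trigS (v `^ k) (trigE v s)) (x + u) - trigp (trigS (v `^ k) (trigE v s)) x -
    u * trigp (trigd (trigS (v `^ k) (trigE v s))) x.
Proof.
by apply/funext => u; rewrite /incr !trigp_trigS trigp_trigd_trigS trigd_trigE.
Qed.

Let levy_op_incr s v x : nnfreq s -> 0 < v ->
  levy_op alpha beta (incr s v x) =
  - 2 * levy_cos alpha * (v * trigL alpha beta (trigE v s) (v `^ k * x)).
Proof.
move=> s0 v0; rewrite incr_trigS levy_op_trigp//; last first.
  by apply: nnfreq_trigS; [exact: powR_ge0|exact: nnfreq_trigE].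
rewrite trigL_trigS ?powR_ge0//; last exact: nnfreq_trigE.
by rewrite vkalpha.
Qed.

Let incr_measurable s x (f : R * R -> R) (V : R * R -> R) :
  measurable_fun setT f -> measurable_fun setT V ->
  measurable_fun setT (fun z => incr s (V z) x (f z)).
Proof.
move=> mf mV.
have mk : measurable_fun setT (fun z => V z `^ k).
  by apply: (measurableT_comp (measurable_powR k)).
apply: measurable_funB; first apply: measurable_funB.
- apply: trigE_measurable => //; apply: measurable_funM => //.
  exact: measurable_funD.
- by apply: trigE_measurable => //; apply: measurable_funM.
- apply: measurable_funM => //; apply: measurable_funM => //.
  by apply: trigE_measurable => //; apply: measurable_funM.
Qed.

Let Fuv_measurable s x : measurable_fun setT (fun z => Fuv s x z.1 z.2).
Proof.
apply: measurable_funM; first by apply: (measurableT_comp (measurable_powR (- 1))).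
apply: measurable_funM.
  apply: measurable_funD; apply: measurable_funM => //; apply: incr_measurable => //.
  by apply: measurableT_comp => //; exact: oppr_measurable.
by apply: (measurableT_comp (measurable_invpowR (1 + alpha))).
Qed.

(** A product of an integrable function of u and an integrable function of v, the form that
    [Fubini_dominated] takes. *)
Let Fuv_bound s x u v : 0 < u -> 0 < v < 1 ->
  `|Fuv s x u v| <= ((`|1 + beta| + `|1 - beta|) * incrC s * levy_min alpha u) * v `^ (k - 1).
Proof.
move=> u0 v01; have /andP[v0 v1] := v01.
rewrite /Fuv /levy_even /levy_min normrM (ger0_norm (powR_ge0 _ _)).
rewrite (_ : k - 1 = - 1 + k); last by ring.
rewrite (@powRD _ v); last by rewrite (gt_eqF v0) implybT.
rewrite [leRHS](_ : _ = v `^ (- 1) * ((`|1 + beta| + `|1 - beta|) *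
  (incrC s * v `^ k * Num.min u (u ^+ 2)) / u `^ (1 + alpha))); last by ring.
rewrite ler_wpM2l ?powR_ge0// normrM (ger0_norm (_ : 0 <= (u `^ (1 + alpha))^-1)) ?invr_ge0 ?powR_ge0//.
rewrite ler_wpM2r ?invr_ge0 ?powR_ge0// [leRHS]mulrDl.
have H1 := incr_bound s x u v01; have H2 := incr_bound s x (- u) v01.
rewrite normrN sqrrN in H2; rewrite (gtr0_norm u0) in H1 H2.
apply: le_trans (ler_normD _ _) _; rewrite !normrM.
by apply: lerD; rewrite ler_wpM2l.
Qed.

(** Exchanging the integrals puts [levy_op] of a single dilated polynomial inside, where the factor
    v of homogeneity cancels v^(-1). The minus sign of the solution makes the constant positive. *)
Lemma levy_op_stein_sol s x : nnfreq s ->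
  leb.-integrable `]0%R, 1%R[ (EFin \o (fun v => trigL alpha beta (trigE v s) (v `^ k * x))) /\
  levy_op alpha beta (fun u => stein_sol s (x + u) - stein_sol s x - u * stein_d1 s x) =
  2 * levy_cos alpha * \int[leb]_(v in `]0%R, 1%R[) trigL alpha beta (trigE v s) (v `^ k * x).
Proof.
move=> s0; have Ic0 := levy_cos_gt0 halpha.
have nz : - 2 * levy_cos alpha != 0.
  by rewrite mulNr oppr_eq0 mulf_neq0 ?pnatr_eq0// lt0r_neq0.
have ia : leb.-integrable `]0%R, +oo[
    (EFin \o (fun u => (`|1 + beta| + `|1 - beta|) * incrC s * levy_min alpha u)).
  by apply: integrable_mulr => //; exact: levy_min_integrable.
have ib : leb.-integrable `]0%R, 1%R[ (EFin \o (fun v => v `^ (k - 1))).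
  exact: (powR_itv01_integral k0).1.
have Fb u v : `]0%R, +oo[%classic u -> `]0%R, 1%R[%classic v ->
    `|Fuv s x u v| <= ((`|1 + beta| + `|1 - beta|) * incrC s * levy_min alpha u) * v `^ (k - 1).
  by rewrite /= !in_itv/= andbT; exact: Fuv_bound.
have mF := Fuv_measurable s x.
have mF' : measurable_fun setT (fun z => Fuv s x z.2 z.1).
  exact: (measurableT_comp mF (@measurable_swap _ _ _ _)).
have E := @Fubini_dominated _ _ _ _ _ leb leb _ _ (measurable_itv _) (measurable_itv _)
  (Fuv s x) _ _ mF ia ib Fb.
have inner v : 0 < v < 1 -> \int[leb]_(u in `]0%R, +oo[) Fuv s x u v =
    - 2 * levy_cos alpha * trigL alpha beta (trigE v s) (v `^ k * x).
  move=> v01; have /andP[v0 v1] := v01.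
  have i : leb.-integrable `]0%R, +oo[ (EFin \o levy_even alpha beta (incr s v x)).
    apply: (@levy_even_integrable R alpha beta halpha _ (incrC s * v `^ k)).
    - have := incr_measurable s x (measurable_fst (T1 := R) (T2 := R)) (measurable_cst v).
      move=> /(measurableT_comp)/(_ (measurable_pair2 (0 : R))). exact.
    - move=> u; apply: le_trans (incr_bound _ _ _ v01) _.
      apply: ler_wpM2l; last by rewrite ge_min lexx.
      by apply: mulr_ge0; [exact: incrC_ge0|exact: powR_ge0].
    - move=> u; apply: le_trans (incr_bound _ _ _ v01) _.
      apply: ler_wpM2l; last by rewrite ge_min lexx orbT.
      by apply: mulr_ge0; [exact: incrC_ge0|exact: powR_ge0].
  transitivity (v `^ (- 1) * levy_op alpha beta (incr s v x)).
    exact: (@RintegralZl _ _ _ leb _ (levy_even alpha beta (incr s v x)) _ (measurable_itv _) i).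
  rewrite (levy_op_incr x s0 v0) mulrCA; congr (_ * _).
  by rewrite mulrA (powRN1_mul v0) mul1r.
(* Integrability in v comes out of Fubini itself, the inner integral being a nonzero multiple of
   this term. *)
have iL : leb.-integrable `]0%R, 1%R[ (EFin \o (fun v => trigL alpha beta (trigE v s) (v `^ k * x))).
  have Fb' v u : `]0%R, 1%R[%classic v -> `]0%R, +oo[%classic u ->
    `|Fuv s x u v| <= v `^ (k - 1) * ((`|1 + beta| + `|1 - beta|) * incrC s * levy_min alpha u).
    by rewrite mulrC => hv hu; exact: Fb.
  have H := @Fubini_dominated_integrable _ _ _ _ _ leb leb _ _ (measurable_itv _) (measurable_itv _)
    (fun v u => Fuv s x u v) _ _ mF' ib ia Fb'.
  have : leb.-integrable `]0%R, 1%R[ (EFin \o (fun v => (- 2 * levy_cos alpha)^-1 *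
      \int[leb]_(u in `]0%R, +oo[) Fuv s x u v)) by exact: integrable_mulr.
  apply: eq_integrable; first exact: measurable_itv.
  move=> v; rewrite inE.
  rewrite /= in_itv/=.
  move=> v01.
  congr EFin.
  by rewrite (inner _ v01) (mulKf nz).
split; first exact: iL.
rewrite /levy_op.
transitivity (\int[leb]_(u in `]0%R, +oo[) - \int[leb]_(v in `]0%R, 1%R[) Fuv s x u v).
  apply: eq_Rintegral => u; rewrite inE/= in_itv/= andbT => u0.
  rewrite /levy_even !incr_integral.
  have i1 := incr_integrable s x u; have i2 := incr_integrable s x (- u).
  rewrite !mulrN -opprD mulNr; congr (- _).
  pose f1 v := v `^ (- 1) * incr s v x u; pose f2 v := v `^ (- 1) * incr s v x (- u).
  have j1 : leb.-integrable `]0%R, 1%R[ (EFin \o (fun v => (1 + beta) * f1 v)).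
    exact: integrable_mulr.
  have j2 : leb.-integrable `]0%R, 1%R[ (EFin \o (fun v => (1 - beta) * f2 v)).
    exact: integrable_mulr.
  have j3 : leb.-integrable `]0%R, 1%R[ (EFin \o (fun v => (1 + beta) * f1 v + (1 - beta) * f2 v)).
    exact: integrable_addr.
  have e1 := @RintegralZl _ _ _ leb _ f1 (1 + beta) (measurable_itv _) i1.
  have e2 := @RintegralZl _ _ _ leb _ f2 (1 - beta) (measurable_itv _) i2.
  have e3 := @RintegralD _ _ _ leb _ _ _ (measurable_itv _) j1 j2.
  have e4 := @RintegralZr _ _ _ leb _ _ (u `^ (1 + alpha))^-1 (measurable_itv _) j3.
  rewrite -[X in (X + _) / _]e1 -[X in (_ + X) / _]e2 -[X in X / _]e3 -e4.
  by apply: eq_Rintegral => v _; rewrite /Fuv /levy_even /f1 /f2; ring.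
have iI : leb.-integrable `]0%R, +oo[ (EFin \o (fun u => \int[leb]_(v in `]0%R, 1%R[) Fuv s x u v)).
  exact: (@Fubini_dominated_integrable _ _ _ _ _ leb leb _ _ (measurable_itv _) (measurable_itv _)
  (Fuv s x) _ _ mF ia ib Fb).
under eq_Rintegral do rewrite -mulN1r.
have e5 := @RintegralZl _ _ _ leb _ _ (- 1) (measurable_itv _) iI.
have e6 : \int[leb]_(v in `]0%R, 1%R[) \int[leb]_(u in `]0%R, +oo[) Fuv s x u v =
    \int[leb]_(v in `]0%R, 1%R[) (- 2 * levy_cos alpha * trigL alpha beta (trigE v s) (v `^ k * x)).
  by apply: eq_Rintegral => v; rewrite inE/= in_itv/= => v01; rewrite (inner _ v01).
have e7 := @RintegralZl _ _ _ leb _ _ (- 2 * levy_cos alpha) (measurable_itv _) iL.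
by rewrite e5 E e6 e7; ring.
Qed.

Let W s x v := trigp (trigE v s) (v `^ k * x).

(** Increasing v shortens the remaining time 1 - v, so the coefficients contribute [trigL], minus
    the generator. The other summand comes from the moving point v^k x. *)
Let W_derive s x v : 0 < v -> is_derive v 1 (W s x)
  (trigL alpha beta (trigE v s) (v `^ k * x) +
   x * (k * (v `^ (k - 1) * trigp (trigE v (trigd s)) (v `^ k * x)))).
Proof.
move=> v0; elim: s => [|q s IH].
  rewrite /W /trigL /trigp/= !big_nil !mulr0 addr0.
  by rewrite (_ : (fun v => _) = cst 0); [exact: is_derive_cst|apply/funext => w; exact: big_nil].
have -> : W (q :: s) x = fun v => q.1.1 * expR (- ((1 - v) * q.1.2 `^ alpha)) *
    cos (q.1.2 * (v `^ k * x) + (q.2 + kap * ((1 - v) * q.1.2 `^ alpha))) + W s x v.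
  by apply/funext => w; rewrite /W /trigp/= big_cons.
notypeclasses refine (derive_eq _ _).
  notypeclasses refine (derive_add _ _); last exact: IH.
  by der.
rewrite /trigL /trigp/= !big_cons/= -/kap.
rewrite (_ : q.1.2 * (v `^ k * x) + (q.2 + pi / 2 + kap * ((1 - v) * q.1.2 `^ alpha)) =
  q.1.2 * (v `^ k * x) + (q.2 + kap * ((1 - v) * q.1.2 `^ alpha)) + pi / 2); last by ring.
rewrite cosDpihalf; ring.
Qed.

Let W_cont0 s x : W s x v @[v --> (0 : R)^'+] --> trigp (trigE 0 s) 0.
Proof.
elim: s => [|q s IH].
  rewrite /W /trigp/= !big_nil (_ : (fun v => _) = cst 0); first exact: cvg_cst.
  by apply/funext => w; exact: big_nil.
have -> : W (q :: s) x = fun v => q.1.1 * expR (- ((1 - v) * q.1.2 `^ alpha)) *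
    cos (q.1.2 * (v `^ k * x) + (q.2 + kap * ((1 - v) * q.1.2 `^ alpha))) + W s x v.
  by apply/funext => w; rewrite /W /trigp/= big_cons.
rewrite /trigp /= big_cons/=; apply: cvgD; last exact: IH.
have c1 : (1 - v) * q.1.2 `^ alpha @[v --> (0:R)^'+] --> (1 - 0) * q.1.2 `^ alpha.
  apply: cvgMl; apply: cvgB; first exact: cvg_cst.
  by apply: cvg_at_right_filter; exact: cvg_id.
apply: cvgM.
  apply: cvgMr; apply: continuous_cvg; first exact: continuous_expR.
  exact: cvgN.
apply: continuous_cvg; first exact: continuous_cos.
apply: cvgD.
  apply: cvgMr; rewrite -{2}(mul0r x); apply: cvgMl.
  exact: powR_cvg0.
by apply: cvgD; [exact: cvg_cst|exact: cvgMr].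
Qed.

Let W_derive_cont s x v : 0 < v -> {for v, continuous (fun v =>
  (trigL alpha beta (trigE v s) (v `^ k * x) +
   x * (k * (v `^ (k - 1) * trigp (trigE v (trigd s)) (v `^ k * x)))))}.
Proof.
move=> v0; pose f v := trigL alpha beta (trigE v s) (v `^ k * x) +
   x * (k * (v `^ (k - 1) * W (trigd s) x v)).
suff [a /is_derive_to_continuous//] : exists a, is_derive v 1 f a.
have [aL L1] : exists a, is_derive v 1 (fun v => trigL alpha beta (trigE v s) (v `^ k * x)) a.
  elim: s {f} => [|q s [a IH]].
    exists 0; rewrite (_ : (fun v => _) = cst 0); first exact: is_derive_cst.
    by apply/funext => w; exact: big_nil.
  eexists.
  rewrite (_ : (fun v => _) = fun v => (q.1.1 * expR (- ((1 - v) * q.1.2 `^ alpha))) * (q.1.2 `^ alpha *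
    (cos (q.1.2 * (v `^ k * x) + (q.2 + kap * ((1 - v) * q.1.2 `^ alpha))) + kap *
     sin (q.1.2 * (v `^ k * x) + (q.2 + kap * ((1 - v) * q.1.2 `^ alpha))))) +
     trigL alpha beta (trigE v s) (v `^ k * x)); last first.
    by apply/funext => w; rewrite /trigL/= big_cons.
  notypeclasses refine (derive_add _ _); last exact: IH.
  by der.
eexists; rewrite /f; notypeclasses refine (derive_add _ _); first exact: L1.
notypeclasses refine (derive_scale _ _); notypeclasses refine (derive_scale _ _).
notypeclasses refine (derive_mul _ _); last exact: W_derive.
by der.
Qed.

(** The endpoint values are [W] at 1, where [trigE] is the identity, and the limit of [W] at 0,
    which is the mean of [trigp s] under the stable law. *)
Theorem stein_equation s x : nnfreq s ->
  Lgen alpha beta (stein_sol s) x - alpha^-1 * (x * stein_d1 s x) =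
  trigp s x - trigp (trigE 0 s) 0.
Proof.
move=> s0; have Ic0 := levy_cos_gt0 halpha.
have [iL opE] := levy_op_stein_sol x s0.
pose g u := stein_sol s (u + x) - stein_sol s x - u * derive1 (stein_sol s) x.
have gE u : g u = - \int[leb]_(v in `]0%R, 1%R[) (v `^ (- 1) * incr s v x u).
  by rewrite -incr_integral /g stein_sol_derive1 (addrC u).
(* The increment bound survives integration in v because v^(k - 1) has integral 1 / k. *)
have gb u : `|g u| <= incrC s * k^-1 * Num.min `|u| (u ^+ 2).
  rewrite gE normrN.
  have i := incr_integrable s x u.
  apply: le_trans (le_normr_Rintegral _ i) _ => //.
  have [ik <-] := powR_itv01_integral k0.
  rewrite mulrAC -RintegralZl//; apply: le_Rintegral => //.
  - exact: integrable_norm.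
  - exact: integrable_mulr.
  move=> v; rewrite /= in_itv/= => v01; have /andP[v0 v1] := v01.
  rewrite normrM (ger0_norm (powR_ge0 _ _)) (_ : k - 1 = - 1 + k); last by ring.
  rewrite powRD; last by rewrite (gt_eqF v0) implybT.
  rewrite mulrCA ler_wpM2l ?powR_ge0//.
  by apply: le_trans (incr_bound _ _ _ v01) _; rewrite mulrAC.
have C0 : 0 <= incrC s * k^-1.
  by apply: mulr_ge0; [exact: incrC_ge0|rewrite invr_ge0 ltW].
have Csol : continuous (stein_sol s).
  by move=> y; exact: is_derive_to_continuous (stein_sol_derive s y).
have mg : measurable_fun setT g.
  apply: measurable_funB; last by apply: measurable_funM.
  apply: measurable_funB => //; apply: measurableT_comp; last exact: measurable_funD.
  exact: continuous_measurable_fun.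
rewrite (@LgenE _ alpha beta halpha _ x (incrC s * k^-1) mg); first last.
- by move=> u; apply: le_trans (gb u) _; apply: ler_wpM2l => //; rewrite ge_min lexx orbT.
- by move=> u; apply: le_trans (gb u) _; apply: ler_wpM2l => //; rewrite ge_min lexx.
have -> : (fun u => stein_sol s (u + x) - stein_sol s x - u * derive1 (stein_sol s) x) =
    fun u => stein_sol s (x + u) - stein_sol s x - u * stein_d1 s x.
  by apply/funext => u; rewrite stein_sol_derive1 (addrC u).
rewrite opE (_ : (levy_cos alpha)^-1 / 2 * _ =
  \int[leb]_(v in `]0%R, 1%R[) trigL alpha beta (trigE v s) (v `^ k * x)); last first.
  by field; rewrite gt_eqF.
pose ef v := x * (k * (v `^ (k - 1) * trigp (trigE v (trigd s)) (v `^ k * x))).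
have i3 : leb.-integrable `]0%R, 1%R[
    (EFin \o (fun v => v `^ (k - 1) * trigp (trigE v (trigd s)) (v `^ k * x))).
  have := stein_int_integrable (trigd s) 0 x k0; apply: eq_integrable => // v _.
  by rewrite /= /jint mul0r subr0.
have iE : leb.-integrable `]0%R, 1%R[ (EFin \o ef).
  by apply: integrable_mulr => //; exact: integrable_mulr.
have -> : alpha^-1 * (x * stein_d1 s x) = - \int[leb]_(v in `]0%R, 1%R[) ef v.
  rewrite stein_d1E /ef RintegralZl//; last exact: integrable_mulr.
  by rewrite RintegralZl// -/k; ring.
rewrite opprK -RintegralD//.
apply: (@FTC_itv01 R _ (W s x)).
- by move=> v /andP[v0 _]; exact: W_derive.
- by move=> v /andP[v0 _]; exact: W_derive_cont.
- exact: W_cont0.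
- have := is_derive_to_continuous (W_derive s x (ltr01 : (0 : R) < 1)).
  rewrite /prop_for /continuous_at {2}/W trigE1 powR1 mul1r; exact: cvg_at_left_filter.
- exact: integrable_addr.
Qed.

End Stein_solution.

(** * Moments of the stable law *)

Section stable_law_moments.
Context {R : realType}.
Variables (alpha beta : R) (halpha : 1 < alpha < 2).
Variables (mu : probability R R) (hmu : stable_law alpha beta mu).
Implicit Types (s : seq (R * R * R)) (q : R * R * R) (b c v x h u t th y z : R).

Let a1 : 1 < alpha. Proof. by case/andP: halpha. Qed.
Let a0 : 0 < alpha. Proof. exact: lt_trans a1. Qed.
Let kap := beta * tan (pi * alpha / 2).
Let k := alpha^-1.

Lemma prob_bounded_integrable (f : R -> R) c : measurable_fun setT f ->
  (forall x, `|f x| <= c) -> mu.-integrable setT (EFin \o f).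
Proof.
move=> mf fc; apply: (@integrable_dominated _ _ _ mu _ measurableT _ (fun=> c)) => //.
by apply: finite_measure_integrable_cst.
Qed.

Let cos_measurable (t th : R) : measurable_fun setT (fun z : R => cos (t * z + th)).
Proof. by apply: derive_measurable => x; eexists; der. Qed.

Lemma stable_cos t th : 0 <= t ->
  \int[mu]_z cos (t * z + th) = expR (- t `^ alpha) * cos (th + kap * t `^ alpha).
Proof.
move=> t0; have [hc hs] := hmu t.
have ct : \int[mu]_z cos (t * z) = expR (- t `^ alpha) * cos (kap * t `^ alpha).
  rewrite /Rintegral hc/= ger0_norm//; congr (_ * cos _); rewrite /kap.
  move: t0; rewrite le_eqVlt => /predU1P[<-|t0]; first by rewrite powR0 ?gt_eqF// !mulr0 mul0r.
  by rewrite gtr0_sg//; ring.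
have st : \int[mu]_z sin (t * z) = expR (- t `^ alpha) * sin (kap * t `^ alpha).
  rewrite /Rintegral hs/= ger0_norm//; congr (_ * sin _); rewrite /kap.
  move: t0; rewrite le_eqVlt => /predU1P[<-|t0]; first by rewrite powR0 ?gt_eqF// !mulr0 mul0r.
  by rewrite gtr0_sg//; ring.
have ic : mu.-integrable setT (EFin \o (fun z => cos th * cos (t * z))).
  apply: integrable_mulr => //; apply: (@prob_bounded_integrable _ 1).
    by apply: derive_measurable => x; eexists; der.
  by move=> x; exact: cos_max.
have isn : mu.-integrable setT (EFin \o (fun z => sin th * sin (t * z))).
  apply: integrable_mulr => //; apply: (@prob_bounded_integrable _ 1).
    by apply: derive_measurable => x; eexists; der.
  by move=> x; exact: sin_max.
have i1 : mu.-integrable setT (EFin \o (fun z => cos (t * z))).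
  apply: (@prob_bounded_integrable _ 1); last by move=> x; exact: cos_max.
  by apply: derive_measurable => x; eexists; der.
have i2 : mu.-integrable setT (EFin \o (fun z => sin (t * z))).
  apply: (@prob_bounded_integrable _ 1); last by move=> x; exact: sin_max.
  by apply: derive_measurable => x; eexists; der.
transitivity (\int[mu]_z (cos th * cos (t * z) - sin th * sin (t * z))).
  by apply: eq_Rintegral => z _; rewrite cosD; ring.
have e1 := @RintegralB _ _ _ mu _ _ _ measurableT ic isn.
have e2 := @RintegralZl _ _ _ mu _ _ (cos th) measurableT i1.
have e3 := @RintegralZl _ _ _ mu _ _ (sin th) measurableT i2.
by rewrite e1 e2 e3 ct st cosD; ring.
Qed.

(** The scale b = (1 - v)^(1/alpha) satisfies b^alpha = 1 - v, so the characteristic function at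
    frequency times b yields the damping and the phase shift of [trigE]. *)
Lemma stable_trigp s v y : nnfreq s -> v <= 1 ->
  mu.-integrable setT (EFin \o (fun z => trigp s (y + (1 - v) `^ k * z))) /\
  \int[mu]_z trigp s (y + (1 - v) `^ k * z) = trigp (trigE alpha beta v s) y.
Proof.
move=> + v1; set b := (1 - v) `^ k.
have b0 : 0 <= b by exact: powR_ge0.
have v0 : 0 <= 1 - v by rewrite subr_ge0.
have ba : b `^ alpha = 1 - v.
  by rewrite /b -powRrM /k mulVf ?powRr1 ?gt_eqF.
elim: s => [_|q s IH /andP[q0 s0]].
  have e : (fun z => trigp [::] (y + b * z)) = fun=> 0 by apply/funext => z; exact: big_nil.
  rewrite e /trigp /= big_nil; split; last by rewrite /Rintegral integral0.
  exact: integrable0.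
have [i1 e1] := IH s0.
have i2 : mu.-integrable setT (EFin \o (fun z => cos (q.1.2 * b * z + (q.1.2 * y + q.2)))).
  apply: (@prob_bounded_integrable _ 1); first exact: cos_measurable.
  by move=> x; exact: cos_max.
have e : (fun z => trigp (q :: s) (y + b * z)) = fun z =>
    q.1.1 * cos (q.1.2 * b * z + (q.1.2 * y + q.2)) + trigp s (y + b * z).
  apply/funext => z; rewrite /trigp big_cons; congr (_ * cos _ + _); ring.
have i3 : mu.-integrable setT (EFin \o (fun z => q.1.1 * cos (q.1.2 * b * z + (q.1.2 * y + q.2)))).
  exact: integrable_mulr.
rewrite e; split; first exact: integrable_addr.
have e2 := @RintegralD _ _ _ mu _ _ _ measurableT i3 i1.
have e3 := @RintegralZl _ _ _ mu _ _ q.1.1 measurableT i2.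
rewrite e2 e3 e1 (stable_cos _ (mulr_ge0 q0 b0)) powRM// ba {2}/trigp/= big_cons/=.
rewrite /trigp; congr (_ + _); rewrite -/kap (mulrC (_ `^ _)) -mulrA; congr (_ * (_ * cos _)); ring.
Qed.

(** The characteristic function near 0 controls the tail: 2^n (1 - cos (2^(-n) z)) has mean O(2^(-n
    (alpha - 1))), summable as alpha > 1, and for |z| >= 1 one of these terms is at least a constant
    times |z|. *)
Lemma stable_first_moment : mu.-integrable setT (EFin \o (fun z : R => z)).
Proof.
pose t (n : nat) : R := 2^-1 ^+ n.
have t0 n : 0 < t n by rewrite exprn_gt0.
pose f (n : nat) z : R := (t n)^-1 * (1 - cos (t n * z)).
have f0 n z : 0 <= f n z by rewrite mulr_ge0 ?invr_ge0 ?cos_ge1B// ltW.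
have mf n : measurable_fun setT (f n) by apply: derive_measurable => x; eexists; rewrite /f; der.
pose r : R := 2^-1 `^ (alpha - 1).
have r0 : 0 < r by rewrite powR_gt0.
have r1 : r < 1.
  have := @gt0_ltr_powR R (alpha - 1) _ 2^-1 1; rewrite subr_gt0 !nnegrE powR1 => -> //.
  by rewrite invf_lt1 ?ltr1n.
have intf n : (\int[mu]_z (f n z)%:E <= ((1 + `|kap|) * r ^+ n)%:E)%E.
  have ic : mu.-integrable setT (EFin \o (fun z => cos (t n * z + 0))).
    by apply: (@prob_bounded_integrable _ 1) => // x; exact: cos_max.
  have i1 : mu.-integrable setT (EFin \o (fun z : R => (1 : R))).
    exact: finite_measure_integrable_cst.
  have i2 : mu.-integrable setT (EFin \o (fun z => 1 - cos (t n * z + 0))).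
    exact: integrable_subr.
  have i3 : mu.-integrable setT (EFin \o f n).
    have : mu.-integrable setT (EFin \o (fun z => (t n)^-1 * (1 - cos (t n * z + 0)))).
      exact: integrable_mulr.
    by apply: eq_integrable => // z _; rewrite /= addr0.
  have e : \int[mu]_z f n z = (t n)^-1 * (1 - expR (- t n `^ alpha) * cos (kap * t n `^ alpha)).
    rewrite -[kap * _]add0r -(stable_cos 0 (ltW (t0 n))).
    have e1 := @RintegralZl _ _ _ mu _ _ (t n)^-1 measurableT i2.
    have e2 := @RintegralB _ _ _ mu _ _ _ measurableT i1 ic.
    have e3 : \int[mu]_z (1 : R) = 1.
      rewrite (@Rintegral_cst _ _ _ mu _ measurableT) mul1r.
      by rewrite [X in fine X](_ : _ = 1%E)//; exact: probability_setT.
    transitivity (\int[mu]_z ((t n)^-1 * (1 - cos (t n * z + 0)))).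
      by apply: eq_Rintegral => z _; rewrite /f addr0.
    by rewrite e1 e2 e3.
  have ta0 : 0 <= t n `^ alpha by exact: powR_ge0.
  rewrite -[leLHS]fineK; last exact: integrable_fin_num.
  rewrite lee_fin -[leLHS]/(\int[mu]_z f n z) e.
  have -> : r ^+ n = (t n)^-1 * t n `^ alpha.
    rewrite /r /t -powR_mulrn ?powR_ge0// -powRrM -(powR_mulrn n (_ : 0 <= 2^-1))//.
    rewrite -powRN -!powRrM -powRD; last by rewrite invr_eq0 pnatr_eq0 implybT.
    by congr (_ `^ _); ring.
  rewrite mulrCA ler_wpM2l ?invr_ge0 ?(ltW (t0 n))//.
  set w := t n `^ alpha in ta0 *.
  (* Both summands are at most linear in [w]: the damping costs [w], the phase [|kap| * w]. *)
  have -> : 1 - expR (- w) * cos (kap * w) = (1 - expR (- w)) + expR (- w) * (1 - cos (kap * w)) by ring.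
  rewrite mulrDl mul1r lerD ?oneBexpRN_le//.
  apply: (@le_trans _ _ (1 * (1 - cos (kap * w)))).
    by rewrite ler_wpM2r ?cos_ge1B ?expRN_le1.
  rewrite mul1r; have := ler_norm_cosB 0 (kap * w); rewrite cos0 sub0r normrN ger0_norm ?cos_ge1B//.
  by rewrite normrM (ger0_norm ta0).
have sumf : (\int[mu]_z (\sum_(n <oo) (f n z)%:E) < +oo)%E.
  rewrite integral_nneseries//; last 2 first.
  - by move=> n; exact/measurable_EFinP.
  - by move=> n z _; rewrite lee_fin.
  apply: (@le_lt_trans _ _ ((1 + `|kap|) / (1 - r))%:E); last exact: ltry.
  apply: lime_le; first by apply: is_cvg_nneseries => n _ _; apply: integral_ge0 => z _; rewrite lee_fin.
  apply: nearW => n; apply: (@le_trans _ _ (\sum_(0 <= i < n) ((1 + `|kap|) * r ^+ i)%:E)%E).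
    by apply: lee_sum.
  rewrite sumEFin lee_fin -mulr_sumr ler_wpM2l ?addr_ge0//.
  rewrite -[leRHS]mul1r ler_pdivlMr ?subr_gt0// big_mkord.
  have := subrX1 r n; have := exprn_ge0 n (ltW r0); lra.
have sumf0 z : (0 <= \sum_(n <oo) (f n z)%:E)%E by apply: nneseries_ge0 => n _ _; rewrite lee_fin.
have msumf : measurable_fun setT (fun z => \sum_(n <oo) (f n z)%:E)%E.
  apply: ge0_emeasurable_sum => n; first by move=> z _ _; rewrite lee_fin.
  by move=> _; exact/measurable_EFinP.
(* For 2^n <= |z| < 2^(n + 1) the argument |z| / 2^n lies in [1, 2], so [f n z] is at least 2^n (1 -
   cos 1), which exceeds |z| (1 - cos 1) / 2. *)
pose c0 : R := 2 / (1 - cos 1).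
have c00 : 0 < c0 by rewrite divr_gt0// subr_gt0 cos1_lt1.
have key z : (`|z|%:E <= 1 + c0%:E * \sum_(n <oo) (f n z)%:E)%E.
  have [z1|z1] := ltP `|z| 1.
    rewrite -[leLHS]adde0; apply: leeD; first by rewrite lee_fin ltW.
    by apply: mule_ge0 => //; rewrite lee_fin ltW.
  pose n := trunc_log 2 (Num.truncn `|z|).
  have /andP[n1 n2] : (2 ^ n)%:R <= `|z| < (2 ^ n.+1)%:R.
    rewrite -truncn_ge_nat// -truncn_lt_nat// trunc_logP ?truncn_gt0//=.
    exact: trunc_log_ltn.
  have tE : (t n)^-1 = (2 ^ n)%:R by rewrite /t exprVn invrK natrX.
  have fz : `|z| <= c0 * f n z.
    rewrite /f tE -cos_norm normrM (gtr0_norm (t0 n)).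
    have w : cos (t n * `|z|) <= cos 1.
      have tE' : t n = (2 ^ n)%:R^-1 by rewrite -tE invrK.
      apply: cos_le_cos1; rewrite tE' mulrC ler_pdivlMr// mul1r n1/= ler_pdivrMr//.
      by rewrite -natrM -expnS ltW.
    apply: le_trans (ltW n2) _; rewrite expnS natrM.
    have c1 : 0 < 1 - cos 1 :> R by rewrite subr_gt0 cos1_lt1.
    have -> : c0 * ((2 ^ n)%:R * (1 - cos (t n * `|z|))) =
      2 * (2 ^ n)%:R * ((1 - cos (t n * `|z|)) / (1 - cos 1)) by rewrite /c0; ring.
    rewrite ler_peMr ?mulr_ge0// ler_pdivlMr// mul1r; lra.
  apply: (@le_trans _ _ (c0%:E * (f n z)%:E)%E); first by rewrite lee_fin.
  rewrite -[leLHS]add0e; apply: leeD => //; apply: lee_wpmul2l; first by rewrite lee_fin ltW.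
  apply: le_trans (nneseries_lim_ge n.+1 _); last by move=> i _ _; rewrite lee_fin.
  by rewrite big_nat_recr//= leeDr// sume_ge0// => i _; rewrite lee_fin.
apply/integrableP; split; first exact/measurable_EFinP.
apply: (@le_lt_trans _ _ (\int[mu]_z (1 + c0%:E * \sum_(n <oo) (f n z)%:E))%E).
  apply: ge0_le_integral => //.
  - by apply/measurable_EFinP; exact: measurableT_comp.
  - by apply: emeasurable_funD => //; exact: emeasurable_funM.
  - by move=> z _; exact: key.
have c0e : (0 <= c0%:E)%E by rewrite lee_fin ltW.
have e1 : (\int[mu]_z (1 + c0%:E * \sum_(n <oo) (f n z)%:E) =
    \int[mu]_z 1 + \int[mu]_z (c0%:E * \sum_(n <oo) (f n z)%:E))%E.
  apply: ge0_integralD => //; first by move=> z _; exact: mule_ge0.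
  exact: emeasurable_funM.
have e2 : (\int[mu]_z (c0%:E * \sum_(n <oo) (f n z)%:E) =
    c0%:E * \int[mu]_z (\sum_(n <oo) (f n z)%:E))%E.
  exact: ge0_integralZl.
rewrite e1 e2 integral_cst//= mul1e lte_add_pinfty//.
  by rewrite (le_lt_trans (probability_le1 mu measurableT))// ltry.
exact: lte_mul_pinfty.
Qed.

End stable_law_moments.

(** * Integrals against the law as integrals against its density *)

Section density_change.
Context {R : realType}.
Notation leb := (@lebesgue_measure R).
Variables (mu : probability R R) (p : R -> R) (hp : is_density mu p).

Let p0 x : 0 <= p x. Proof. by case: hp. Qed.
Let mp : measurable_fun setT p. Proof. by case: hp => _ []. Qed.
Let pE A : measurable A -> mu A = (\int[leb]_(x in A) (p x)%:E)%E.
Proof. by case: hp => _ [_]; exact. Qed.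

Lemma density_integrable : leb.-integrable setT (EFin \o p).
Proof.
apply/integrableP; split; first exact/measurable_EFinP.
rewrite [ltLHS](_ : _ = mu setT); first by rewrite probability_setT ltry.
by rewrite pE//; apply: eq_integral => x _ /=; rewrite ger0_norm.
Qed.

Lemma density_Rintegral1 : \int[leb]_x p x = 1.
Proof. by rewrite /Rintegral -pE// probability_setT. Qed.

(** The density is given through measures of sets. Comparing integrals over all measurable sets
    identifies it almost everywhere with the Radon-Nikodym derivative, for which a change of
    variables is available. *)
Lemma integral_density (f : R -> R) (c : R) : measurable_fun setT f ->
  (forall x, `|f x| <= c) ->
  leb.-integrable setT (EFin \o (fun x => f x * p x)) /\
  \int[mu]_x f x = \int[leb]_x (f x * p x).
Proof.
move=> mf fc.
have ifp : leb.-integrable setT (EFin \o (fun x => f x * p x)).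
  apply: (@integrable_dominated _ _ _ leb _ measurableT _ (fun x => c * p x)).
  - exact: measurable_funM.
  - by move=> x _; rewrite normrM (ger0_norm (p0 x)) ler_wpM2r.
  - by apply: integrable_mulr => //; exact: density_integrable.
split => //.
have imu : mu.-integrable setT (EFin \o f) by exact: prob_bounded_integrable mf fc.
(* R and measurableTypeR R differ by their display only; the image of mu under
   the identity lives on the latter. *)
have mid : @measurable_fun _ _ R (measurableTypeR R) setT (fun x : R => x) by exact: measurable_id.
pose X : {mfun R >-> measurableTypeR R} :=
  MeasurableFun.Pack (MeasurableFun.Class (isMeasurableFun.Build _ _ _ _ _ mid)).
pose nu := distribution mu X.
have nuE (A : set (measurableTypeR R)) : measurable A -> nu A = (\int[leb]_(x in A) (p x)%:E)%E.
  by move=> mA; rewrite /nu /distribution /pushforward/= -pE.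
have ac : nu `<< leb.
  apply/null_content_dominatesP => A mA A0; rewrite nuE//.
  apply: null_set_integral => //.
  by apply: measurable_funTS; exact/measurable_EFinP.
have mfe : measurable_fun [set: measurableTypeR R] (EFin \o f) by exact/measurable_EFinP.
have nuI : (\int[nu]_x (f x)%:E = \int[mu]_x (f x)%:E)%E.
  have := @integral_pushforward _ _ R (measurableTypeR R) R X mid mu setT (EFin \o f) mfe.
  by rewrite preimage_setT; exact.
have inu : nu.-integrable setT (EFin \o f).
  by apply: (@integrable_pushforward _ _ R (measurableTypeR R) R X mid mu setT (EFin \o f) mfe).
rewrite /Rintegral; congr fine; rewrite -nuI.
have E := @Radon_Nikodym_change_of_variables _ (measurableTypeR R) R nu leb ac _ _ measurableT inu.
rewrite -[LHS]E.
apply: ae_eq_integral => //.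
- exact: emeasurable_funM.
- by apply/measurable_EFinP; exact: measurable_funM.
have A : ae_eq leb setT (Radon_Nikodym (charge_of_finite_measure nu) leb) (EFin \o p).
  apply: integral_ae_eq => //.
  - exact: Radon_Nikodym_integrable.
  - exact/measurable_EFinP.
  - move=> B _ mB; rewrite -Radon_Nikodym_integral//=.
    exact: nuE.
by apply: filterS A => x H _ /=; rewrite EFinM; congr (_ * _)%E; exact: H.
Qed.

End density_change.

(** * Fourier inversion of the density *)

Section oscillatory_integrals.
Context {R : realType}.
Notation leb := (@lebesgue_measure R).
Variables (alpha beta : R) (halpha : 1 < alpha < 2).
Implicit Types (s c x h t th y z : R).

Let a1 : 1 < alpha. Proof. by case/andP: halpha. Qed.
Let a0 : 0 < alpha. Proof. exact: lt_trans a1. Qed.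
Let kap := beta * tan (pi * alpha / 2).

Lemma atan_derive x : is_derive x 1 atan ((1 + x ^+ 2)^-1).
Proof. by apply: DeriveDef; [exact: derivable_atan|rewrite -derive1E derive1_atan]. Qed.

Lemma atan_cvgNy : (atan x @[x --> -oo%R] --> - (pi / 2 : R)).
Proof.
have H : - atan (- x) @[x --> -oo%R] --> - (pi / 2 : R).
  apply: cvgN; apply: (cvg_comp -%R (@atan R)); last exact: cvgy_atan.
  by apply/cvgNry.
by under eq_fun do rewrite -[X in atan X]opprK atanN.
Qed.

Let oneD_gt0 x : 0 < 1 + x ^+ 2.
Proof. by rewrite ltr_pwDl// sqr_ge0. Qed.

Let cont_oneDV x : {for x, continuous (fun x => (1 + x ^+ 2)^-1)}.
Proof.
apply: cvgV; first by rewrite gt_eqF.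
by apply: cvgD; [exact: cvg_cst|exact: exprn_continuous].
Qed.

Lemma oneDsqrV_integrable : leb.-integrable setT (EFin \o (fun x => (1 + x ^+ 2)^-1)).
Proof.
apply: (@ge0_FTC_setT_integrable R (fun x => (1 + x ^+ 2)^-1) (@atan R) (- (pi / 2)) (pi / 2)).
- exact: cont_oneDV.
- by move=> x; rewrite invr_ge0 ltW.
- exact: atan_cvgNy.
- exact: cvgy_atan.
Qed.

(** The modulus of the characteristic function times t^s. Each derivative in x adds 1 to s;
    integration by parts makes s fractional. *)
Definition gwt s t := t `^ s * expR (- t `^ alpha).

Lemma gwt_ge0 s t : 0 <= gwt s t.
Proof. by rewrite mulr_ge0 ?powR_ge0 ?expR_ge0. Qed.

(** For t > 1 the inverse of the exponential is bounded below by one Taylor term, of degree n + 1 >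
    s + 2, and alpha > 1 makes that term absorb t^(s + 2). The factor 2 comes from 1 + t^2 <= 2 t^2,
    or from 1 + t^2 <= 2 when t <= 1. *)
Lemma gwt_bound s : 0 <= s -> exists2 C, 0 <= C & forall t, 0 < t -> gwt s t <= C * (1 + t ^+ 2)^-1.
Proof.
move=> s0; pose n := Num.truncn (s + 2).
exists (2 * (n.+1)`!%:R) => // t t0; rewrite -ler_pdivrMr ?invr_gt0// invrK /gwt.
have f1 : (1 : R) <= (n.+1)`!%:R by rewrite ler1n fact_gt0.
have w0 : 0 <= t `^ alpha by exact: powR_ge0.
have [t1|t1] := leP t 1.
  have h1 : t `^ s <= 1.
    by have := @ge0_ler_powR R s s0 t 1; rewrite !nnegrE powR1 (ltW t0) ler01 => /(_ isT isT t1).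
  have h2 := expRN_le1 w0.
  have h3 : 1 + t ^+ 2 <= 2 by have := exprn_ile1 2 (ltW t0) t1; lra.
  apply: (@le_trans _ _ (1 * 1 * 2)); last lra.
  apply: ler_pM => //; first by rewrite mulr_ge0 ?powR_ge0 ?expR_ge0.
    by apply: ltW.
  by apply: ler_pM; rewrite ?powR_ge0 ?expR_ge0.
have t1' := ltW t1.
have e1 : (t `^ alpha) ^+ n.+1 / (n.+1)`!%:R <= expR (t `^ alpha).
  by apply: le_trans (expR_ge1Dxn n w0); rewrite lerDr.
have w1 : 0 < t `^ alpha by exact: powR_gt0.
have e2 : expR (- t `^ alpha) <= (n.+1)`!%:R / (t `^ alpha) ^+ n.+1.
  rewrite expRN -[leRHS]invrK lef_pV2 ?posrE ?expR_gt0 ?invr_gt0 ?divr_gt0 ?exprn_gt0 ?ltr0n ?fact_gt0//.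
  by rewrite invf_div.
have e3 : t `^ s * t ^+ 2 <= (t `^ alpha) ^+ n.+1.
  rewrite -(powR_mulrn 2 (ltW t0)) -(powR_mulrn n.+1 w0) -powRrM -powRD; last by rewrite (gt_eqF t0) implybT.
  apply: ler_powR => //.
  have sn : s + 2 < n.+1%:R by rewrite truncnS_gt.
  apply: le_trans (ltW sn) _; rewrite ler_peMl//; exact: ltW.
have e4 : 1 + t ^+ 2 <= 2 * t ^+ 2 by have := exprn_ege1 2 t1'; lra.
apply: (@le_trans _ _ (t `^ s * expR (- t `^ alpha) * (2 * t ^+ 2))).
  by rewrite ler_wpM2l// mulr_ge0 ?powR_ge0 ?expR_ge0.
rewrite (_ : _ * (2 * _) = 2 * (expR (- t `^ alpha) * (t `^ s * t ^+ 2))); last by ring.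
rewrite ler_wpM2l//.
apply: (@le_trans _ _ ((n.+1)`!%:R / (t `^ alpha) ^+ n.+1 * (t `^ alpha) ^+ n.+1)).
  by apply: (ler_pM (expR_ge0 _) _ e2 e3); apply: mulr_ge0; [exact: powR_ge0|exact: sqr_ge0].
by rewrite divfK// (gt_eqF (exprn_gt0 _ w1)).
Qed.

Let gwt_measurable s : measurable_fun setT (gwt s).
Proof.
apply: measurable_funM; first exact: measurable_powR.
apply: measurableT_comp; first exact: measurable_expR.
by apply: measurableT_comp; [exact: oppr_measurable|exact: measurable_powR].
Qed.

Lemma gwt_integrable s : 0 <= s -> leb.-integrable `]0%R, +oo[ (EFin \o gwt s).
Proof.
move=> s0; have [C C0 HC] := gwt_bound s0.
apply: (@integrable_dominated _ _ _ leb _ (measurable_itv _) _ (fun t => C * (1 + t ^+ 2)^-1)).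
- exact: (measurable_funTS (gwt_measurable s)).
- move=> t; rewrite /= in_itv/= andbT => t0.
  by rewrite ger0_norm ?gwt_ge0// HC.
- apply: integrable_mulr => //; apply: (integrableS measurableT) => //.
  exact: oneDsqrV_integrable.
Qed.

(** At s = 0 and th = 0 this is the real part of exp(-i t x) times the characteristic function, so
    that its integral over t > 0 is pi times the density. A derivative in x adds 1 to s and pi / 2
    to th. *)
Let osc s th x t := gwt s t * cos (t * x - kap * t `^ alpha + th).
Definition osc_int s th x := \int[leb]_(t in `]0%R, +oo[) osc s th x t.

Let osc_measurable s th x : measurable_fun setT (osc s th x).
Proof.
apply: measurable_funM => //; apply: measurableT_comp.
  by apply: continuous_measurable_fun; exact: continuous_cos.
apply: measurable_funD => //; apply: measurable_funB; first exact: measurable_funM.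
by apply: measurable_funM => //; exact: measurable_powR.
Qed.

Let osc_le s th x t : `|osc s th x t| <= gwt s t.
Proof. by rewrite /osc normrM (ger0_norm (gwt_ge0 _ _)) ler_piMr ?gwt_ge0// cos_max. Qed.

Let osc_integrable s th x : 0 <= s -> leb.-integrable `]0%R, +oo[ (EFin \o osc s th x).
Proof.
move=> s0; apply: (@integrable_dominated _ _ _ leb _ (measurable_itv _) _ (gwt s)).
- exact: (measurable_funTS (osc_measurable s th x)).
- by move=> t _; exact: osc_le.
- exact: gwt_integrable.
Qed.

Let gwtM s t : 0 < t -> gwt (s + 1) t = gwt s t * t.
Proof.
move=> t0; rewrite /gwt powRD; last by rewrite (gt_eqF t0) implybT.
by rewrite (powRr1 (ltW t0)); ring.
Qed.

Lemma osc_int_derive s th x : 0 <= s ->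
  is_derive x 1 (osc_int s th) (osc_int (s + 1) (th + pi / 2) x).
Proof.
move=> s0; have s1 : 0 <= s + 1 by exact: addr_ge0.
have s2 : 0 <= s + 1 + 1 by exact: addr_ge0.
apply: (is_derive_quadratic (c := \int[leb]_(t in `]0%R, +oo[) gwt (s + 1 + 1) t)) => h.
have i1 := osc_integrable th (x + h) s0; have i2 := osc_integrable th x s0.
have i3 := osc_integrable (th + pi / 2) x s1.
have i12 : leb.-integrable `]0%R, +oo[ (EFin \o (fun t => osc s th (x + h) t - osc s th x t)).
  exact: integrable_subr.
have i3' : leb.-integrable `]0%R, +oo[ (EFin \o (fun t => h * osc (s + 1) (th + pi / 2) x t)).
  exact: integrable_mulr.
have i4 : leb.-integrable `]0%R, +oo[ (EFin \o (fun t => osc s th (x + h) t - osc s th x t -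
   h * osc (s + 1) (th + pi / 2) x t)) by exact: integrable_subr.
have e1 := @RintegralB _ _ _ leb _ _ _ (measurable_itv _) i1 i2.
have e2 := @RintegralZl _ _ _ leb _ _ h (measurable_itv _) i3.
have e3 := @RintegralB _ _ _ leb _ _ _ (measurable_itv _) i12 i3'.
rewrite [X in `|X|](_ : _ = \int[leb]_(t in `]0%R, +oo[) (osc s th (x + h) t - osc s th x t -
   h * osc (s + 1) (th + pi / 2) x t)); last by rewrite e3 e1 e2.
apply: le_trans (le_normr_Rintegral _ i4) _ => //.
have ig := gwt_integrable s2.
have e4 := @RintegralZr _ _ _ leb _ _ (h ^+ 2) (measurable_itv _) ig.
rewrite -e4; apply: le_Rintegral.
- exact: measurable_itv.
- exact: integrable_norm.
- rewrite (_ : (fun x0 => _) = (fun t => h ^+ 2 * gwt (s + 1 + 1) t)); last first.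
    by apply/funext => t; rewrite mulrC.
  exact: integrable_mulr.
move=> t; rewrite /= in_itv/= andbT => t0.
rewrite /osc !gwtM// (addrA _ th) cosDpihalf.
set A := t * x - kap * t `^ alpha + th.
have -> : t * (x + h) - kap * t `^ alpha + th = A + t * h by rewrite /A; ring.
have -> : gwt s t * cos (A + t * h) - gwt s t * cos A - h * (gwt s t * t * - sin A) =
   gwt s t * (cos (A + t * h) - cos A + t * h * sin A) by ring.
rewrite normrM (ger0_norm (gwt_ge0 _ _)).
have -> : gwt s t * t * t * h ^+ 2 = gwt s t * (t * h) ^+ 2 by ring.
exact: (ler_wpM2l (gwt_ge0 s t) (cos_taylor A (t * h))).
Qed.

Lemma osc_int_le s th x : 0 <= s ->
  `|osc_int s th x| <= \int[leb]_(t in `]0%R, +oo[) gwt s t.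
Proof.
move=> s0; have i := osc_integrable th x s0.
apply: le_trans (le_normr_Rintegral _ i) _ => //.
apply: le_Rintegral; [exact: measurable_itv|exact: integrable_norm|exact: gwt_integrable|].
by move=> t _; exact: osc_le.
Qed.

Let gwt_cvgy s : 0 <= s -> gwt s t @[t --> +oo%R] --> (0 : R).
Proof.
move=> s0; have [C C0 HC] := gwt_bound s0.
apply/cvgrPdist_le => e e0; near=> t.
have t1 : 1 <= t by near: t; apply: nbhs_pinfty_ge; exact: num_real.
have tC : C / e <= t by near: t; apply: nbhs_pinfty_ge; exact: num_real.
have t0 : 0 < t by exact: lt_le_trans t1.
rewrite sub0r normrN ger0_norm ?gwt_ge0//; apply: le_trans (HC _ t0) _.
rewrite ler_pdivrMr// mulrC -ler_pdivrMr//; apply: le_trans tC _.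
by rewrite expr2; nra.
Unshelve. all: end_near. Qed.

(* The integral over (0, oo) of the t-derivative of
   t^s exp(-t^alpha) cos (t x - kap t^alpha + th) is minus its value at 0+. *)
Lemma osc_int_parts s th x : s = 0 \/ 1 <= s ->
  x * osc_int s (th + pi / 2) x = - (if s == 0 then cos th else 0) -
   (s * osc_int (s - 1) th x - alpha * osc_int (s + alpha - 1) th x -
    kap * alpha * osc_int (s + alpha - 1) (th + pi / 2) x).
Proof.
move=> hs; have s0 : 0 <= s by case: hs => [->//|]; exact: le_trans.
have sa0 : 0 <= s + alpha - 1 by have := a1; move: s0; lra.
pose r1 t := s * osc (s - 1) th x t.
pose r2 t := alpha * osc (s + alpha - 1) th x t.
pose r3 t := kap * alpha * osc (s + alpha - 1) (th + pi / 2) x t.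
pose r4 t := x * osc s (th + pi / 2) x t.
(* At s = 0 the power t^(s - 1) is not integrable at 0, but the factor [s] removes the term; for s
   >= 1 the exponent is nonnegative. *)
have i1 : leb.-integrable `]0%R, +oo[ (EFin \o r1).
  rewrite /r1; case: hs => [->|s1].
    rewrite (_ : EFin \o _ = cst 0%E); first exact: integrable0.
    by apply/funext => t /=; rewrite mul0r.
  by apply: integrable_mulr => //; apply: osc_integrable; rewrite subr_ge0.
have I1 : \int[leb]_(t in `]0%R, +oo[) r1 t = s * osc_int (s - 1) th x.
  rewrite /r1; case: hs => [->|s1].
    have E : \int[leb]_(t in `]0%R, +oo[) (0 * osc (0 - 1) th x t) = \int[leb]_(t in `]0%R, +oo[) 0.
      by apply: eq_Rintegral => t _; rewrite mul0r.
    by rewrite E mul0r /Rintegral integral0.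
  by apply: (@RintegralZl _ _ _ leb _ _ s (measurable_itv _)); apply: osc_integrable; rewrite subr_ge0.
have j2 := osc_integrable th x sa0.
have j3 := osc_integrable (th + pi / 2) x sa0.
have j4 := osc_integrable (th + pi / 2) x s0.
have i2 : leb.-integrable `]0%R, +oo[ (EFin \o r2) by exact: integrable_mulr.
have i3 : leb.-integrable `]0%R, +oo[ (EFin \o r3) by exact: integrable_mulr.
have i4 : leb.-integrable `]0%R, +oo[ (EFin \o r4) by exact: integrable_mulr.
pose G t := gwt s t * cos (t * x - kap * t `^ alpha + th).
pose f t := r1 t - r2 t - r3 t + r4 t.
have i12 : leb.-integrable `]0%R, +oo[ (EFin \o (fun t => r1 t - r2 t)) by exact: integrable_subr.
have i123 : leb.-integrable `]0%R, +oo[ (EFin \o (fun t => r1 t - r2 t - r3 t)).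
  exact: integrable_subr.
have iF : leb.-integrable `]0%R, +oo[ (EFin \o f) by exact: integrable_addr.
have dG t : 0 < t -> is_derive t 1 G (f t).
  move=> t0; rewrite /G /gwt; derive.
  have e1 : t `^ (s + alpha - 1) = t `^ s * t `^ (alpha - 1).
    by rewrite -powRD; [congr powR; ring|rewrite (gt_eqF t0) implybT].
  by rewrite /f /r1 /r2 /r3 /r4 /osc /gwt e1 (addrA _ th) cosDpihalf; ring.
have cf t : 0 < t -> {for t, continuous f}.
  move=> t0; suff [a /is_derive_to_continuous//] : exists a, is_derive t 1 f a.
  by eexists; rewrite /f /r1 /r2 /r3 /r4 /osc /gwt; der.
(* The power t^s tends to 1 if s = 0 and to 0 otherwise. *)
have GL : G t @[t --> 0^'+] --> (if s == 0 then cos th else 0).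
  have ca : t `^ alpha @[t --> (0:R)^'+] --> (0 : R) by exact: powR_cvg0.
  have c1 : cos (t * x - kap * t `^ alpha + th) @[t --> (0:R)^'+] --> cos (0 * x - kap * 0 + th).
    apply: continuous_cvg; first exact: continuous_cos.
    apply: cvgD; last exact: cvg_cst.
    apply: cvgB; last exact: cvgMr.
    by apply: cvgMl; apply: cvg_at_right_filter; exact: cvg_id.
  have c2 : expR (- t `^ alpha) @[t --> (0:R)^'+] --> expR (- 0).
    by apply: continuous_cvg; [exact: continuous_expR|exact: cvgN].
  have [z|nz] := eqVneq s 0.
    rewrite -[X in _ --> X](_ : 1 * expR (- 0) * cos (0 * x - kap * 0 + th) = _); last first.
      by rewrite oppr0 expR0 !mul1r mul0r mulr0 subr0 add0r.
    rewrite /G /gwt z; apply: cvgM => //; apply: cvgM => //.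
    by under eq_fun do rewrite powRr0; exact: cvg_cst.
  rewrite -[X in _ --> X](_ : 0 * expR (- 0) * cos (0 * x - kap * 0 + th) = _); last by rewrite !mul0r.
  apply: cvgM => //; apply: cvgM => //; apply: powR_cvg0.
  by rewrite lt_neqAle eq_sym nz.
have Gy : G t @[t --> +oo%R] --> (0 : R).
  apply: norm_cvg0; apply: (@squeeze_cvgr _ _ _ _ (cst 0) _ _ _ _ _ (gwt_cvgy s0)); last exact: cvg_cst.
  apply: nearW => t; rewrite /= normr_ge0/= /G normrM (ger0_norm (gwt_ge0 _ _)).
  by rewrite ler_piMr ?gwt_ge0// cos_max.
have I := FTC_itv0y dG cf GL Gy iF.
have e1 := @RintegralD _ _ _ leb _ _ _ (measurable_itv _) i123 i4.
have e2 := @RintegralB _ _ _ leb _ _ _ (measurable_itv _) i12 i3.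
have e3 := @RintegralB _ _ _ leb _ _ _ (measurable_itv _) i1 i2.
have I2 := @RintegralZl _ _ _ leb _ _ alpha (measurable_itv _) j2.
have I3 := @RintegralZl _ _ _ leb _ _ (kap * alpha) (measurable_itv _) j3.
have I4 := @RintegralZl _ _ _ leb _ _ x (measurable_itv _) j4.
move: I; rewrite /f e1 e2 e3 I1 /r2 I2 /r3 I3 /r4 I4 sub0r => I.
have {}I : s * osc_int (s - 1) th x - alpha * osc_int (s + alpha - 1) th x -
    kap * alpha * osc_int (s + alpha - 1) (th + pi / 2) x + x * osc_int s (th + pi / 2) x =
  - (if s == 0 then cos th else 0) := I.
rewrite -I; ring.
Qed.

Let parts_le (b L s u v w M N K : R) : `|L| <= 1 -> `|u| <= M -> `|v| <= N -> `|w| <= K -> 0 <= s ->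
  b = - L - (s * u - alpha * v - kap * alpha * w) ->
  `|b| <= 1 + s * M + alpha * N + `|kap| * alpha * K.
Proof.
move=> L1 uM vN wK s0 ->; have a0' := ltW a0.
have h1 : `|s * u| <= s * M by rewrite normrM (ger0_norm s0) ler_wpM2l.
have h2 : `|alpha * v| <= alpha * N by rewrite normrM (ger0_norm a0') ler_wpM2l.
have h3 : `|kap * alpha * w| <= `|kap| * alpha * K.
  by rewrite !normrM (ger0_norm a0') ler_wpM2l// mulr_ge0.
have := ler_normB (- L) (s * u - alpha * v - kap * alpha * w).
have := ler_normB (s * u - alpha * v) (kap * alpha * w).
have := ler_normB (s * u) (alpha * v).
by rewrite normrN; lra.
Qed.

Lemma osc_int_decay s : s = 0 \/ 1 <= s -> exists C, forall th x, `|x * osc_int s th x| <= C.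
Proof.
move=> hs; have s0 : 0 <= s by case: hs => [->//|]; exact: le_trans.
have sa0 : 0 <= s + alpha - 1 by have := a1; move: s0; lra.
eexists => th x; rewrite -(subrK (pi / 2) th).
set L := if s == 0 then cos (th - pi / 2) else 0.
have L1 : `|L| <= 1 by rewrite /L; case: ifP => _; rewrite ?normr0// cos_max.
have E := osc_int_parts (th - pi / 2) x hs.
have U : `|s * osc_int (s - 1) (th - pi / 2) x| <= s * \int[leb]_(t in `]0%R, +oo[) gwt (s - 1) t.
  case: hs => [->|s1]; first by rewrite !mul0r normr0.
  by rewrite normrM (ger0_norm s0) ler_wpM2l// osc_int_le// subr_ge0.
(* The product of [s] and [osc_int (s - 1)] is bounded as a whole, with coefficient 1, because at s
   = 0 the second factor has no bound of its own. *)
rewrite -(mul1r (s * _)) in E.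
apply: (parts_le L1 U (osc_int_le _ _ sa0) (osc_int_le _ _ sa0) ler01 E).
Qed.

(** One integration by parts turns the exponent 1 into 0 and alpha, both admissible in
    [osc_int_decay] as alpha > 1; that lemma absorbs the second factor x. *)
Lemma osc_int_decay2 : exists C, forall th x, `|x ^+ 2 * osc_int 1 th x| <= C.
Proof.
have [C0 H0] := osc_int_decay (or_introl (erefl 0)).
have [Ca Ha] := osc_int_decay (or_intror (ltW a1)).
eexists => th x.
have := osc_int_parts (th - pi / 2) x (or_intror (lexx 1)).
have e1 : (1 : R) - 1 = 0 by ring.
have e2 : 1 + alpha - 1 = alpha by ring.
rewrite (gt_eqF ltr01) e1 e2 (subrK (pi / 2) th) => E.
have E2 : x ^+ 2 * osc_int 1 th x = - 0 - (1 * (x * osc_int 0 (th - pi / 2) x) -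
   alpha * (x * osc_int alpha (th - pi / 2) x) - kap * alpha * (x * osc_int alpha th x)).
  by rewrite expr2 -mulrA E; ring.
by apply: (parts_le _ (H0 _ _) (Ha _ _) (Ha _ _) ler01 E2); rewrite normr0.
Qed.

End oscillatory_integrals.

(** * The Poisson kernel, of total mass pi *)

Section Poisson_kernel.
Context {R : realType}.
Notation leb := (@lebesgue_measure R).
Implicit Types (e x y z t : R).

Definition poisson e y := e / (e ^+ 2 + y ^+ 2).

Let sqr_gt0 e y : 0 < e -> 0 < e ^+ 2 + y ^+ 2.
Proof. by move=> e0; rewrite ltr_pwDl ?sqr_ge0// exprn_gt0. Qed.

Lemma poisson_ge0 e y : 0 < e -> 0 <= poisson e y.
Proof. by move=> e0; rewrite divr_ge0// ltW// sqr_gt0. Qed.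

Lemma poisson_le e y : 0 < e -> poisson e y <= e^-1.
Proof.
move=> e0; rewrite /poisson ler_pdivrMr ?sqr_gt0// mulrDr expr2 mulrA mulVf ?gt_eqF// mul1r.
by rewrite lerDl mulr_ge0 ?sqr_ge0// invr_ge0 ltW.
Qed.

Lemma poisson_far e d y : 0 < e -> 0 < d -> d <= `|y| -> poisson e y <= e / d ^+ 2.
Proof.
move=> e0 d0 dy; rewrite /poisson ler_pM2l// lef_pV2 ?posrE ?exprn_gt0 ?sqr_gt0//.
have : d ^+ 2 <= `|y| ^+ 2 by rewrite lerXn2r ?nnegrE ?(ltW d0) ?normr_ge0.
by rewrite real_normK ?num_real// => h; apply: le_trans h _; rewrite lerDr sqr_ge0.
Qed.

(** The uniform bound of [poisson_far] is integrated against the density, of mass 1. Against the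
    constant [p x] a bound integrable in y is required, and a multiple of the kernel of width 1
    provides it. *)
Lemma poisson_far1 e d y : 0 < e -> 0 < d -> d <= `|y| ->
  poisson e y <= e * (1 + (d ^+ 2)^-1) * poisson 1 y.
Proof.
move=> e0 d0 dy; rewrite /poisson expr1n mul1r -!mulrA ler_pM2l//.
have d2 : 0 < d ^+ 2 by rewrite exprn_gt0.
have dy2 : d ^+ 2 <= y ^+ 2.
  have : d ^+ 2 <= `|y| ^+ 2 by rewrite lerXn2r ?nnegrE ?(ltW d0) ?normr_ge0.
  by rewrite real_normK ?num_real.
have y1 : 0 < 1 + y ^+ 2 by have := sqr_gt0 y (@ltr01 R); rewrite expr1n.
rewrite ler_pdivlMr// mulrC ler_pdivrMr ?sqr_gt0//.
have h : y ^+ 2 * (d ^+ 2)^-1 >= 1 by rewrite ler_pdivlMr// mul1r.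
have e2 : 0 <= e ^+ 2 * (1 + (d ^+ 2)^-1) by rewrite mulr_ge0 ?sqr_ge0// addr_ge0// invr_ge0 ltW.
by move: e2 h; rewrite mulrDr (mulrC (1 + _)) mulrDl mulr1 mulrDr; lra.
Qed.

Lemma poisson_derive e x z : 0 < e ->
  is_derive z 1 (fun z => - atan ((x - z) / e)) (poisson e (x - z)).
Proof.
move=> e0.
notypeclasses refine (derive_eq (derive_opp (@derive_comp _ (@atan R) (fun z => (x - z) / e) _ _ _
  (atan_derive _) (@derive_mul _ (fun z => x - z) (fun=> e^-1) _ _ _
    (derive_sub (derive_cstc x z) (derive_idc z)) (derive_cstc e^-1 z)))) _).
rewrite /= /poisson exprMn exprVn.
have ne : e != 0 by rewrite gt_eqF.
have n1 : 1 + (x - z) ^+ 2 / e ^+ 2 != 0.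
  by rewrite gt_eqF// ltr_pwDl// divr_ge0 ?sqr_ge0.
have n2 : e ^+ 2 + (x - z) ^+ 2 != 0 by rewrite gt_eqF// sqr_gt0.
by field; rewrite ?n1 ?n2 ?ne//.
Qed.

Let poisson_cont e x : 0 < e -> continuous (fun z => poisson e (x - z)).
Proof.
move=> e0 z; rewrite /poisson; apply: cvgMr; apply: cvgV; first by rewrite gt_eqF// sqr_gt0.
apply: cvgD; first exact: cvg_cst.
apply: (@continuous_comp _ _ _ (fun z => x - z) (fun y => y ^+ 2)); last exact: exprn_continuous.
by apply: cvgB; [exact: cvg_cst|exact: cvg_id].
Qed.

Let poisson_Ny e x : 0 < e -> - atan ((x - z) / e) @[z --> -oo%R] --> - (pi / 2 : R).
Proof.
move=> e0; apply: cvgN; apply: (cvg_comp (fun z => (x - z) / e) (@atan R)); last exact: cvgy_atan.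
apply/cvgryPge => M; near=> z; rewrite ler_pdivlMr// lerBrDr addrC -lerBrDr.
by near: z; apply: nbhs_ninfty_le; exact: num_real.
Unshelve. all: end_near. Qed.

Let poisson_y e x : 0 < e -> - atan ((x - z) / e) @[z --> +oo%R] --> (pi / 2 : R).
Proof.
move=> e0; rewrite -[X in _ --> X]opprK.
apply: cvgN; apply: (cvg_comp (fun z => (x - z) / e) (@atan R)); last exact: atan_cvgNy.
apply/cvgrNyPle => M; near=> z; rewrite ler_pdivrMr// lerBlDr addrC -lerBlDr.
by near: z; apply: nbhs_pinfty_ge; exact: num_real.
Unshelve. all: end_near. Qed.

Lemma poisson_integrable e x : 0 < e -> leb.-integrable setT (EFin \o (fun z => poisson e (x - z))).
Proof.
move=> e0.
apply: (@ge0_FTC_setT_integrable R _ _ _ _ (fun z => poisson_derive x z e0) (@poisson_cont e x e0)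
  _ (@poisson_Ny e x e0) (@poisson_y e x e0)).
by move=> z; exact: poisson_ge0.
Qed.

Lemma poisson_Rintegral e x : 0 < e -> \int[leb]_z poisson e (x - z) = pi.
Proof.
move=> e0.
rewrite (@FTC_setT R _ _ _ _ (fun z => poisson_derive x z e0) (@poisson_cont e x e0)
  (@poisson_Ny e x e0) (@poisson_y e x e0) (@poisson_integrable e x e0)).
by field.
Qed.

Let exp_cvgy e : 0 < e -> expR (- (e * t)) @[t --> +oo%R] --> (0 : R).
Proof.
move=> e0; apply: (cvg_comp (fun t => e * t) (fun y => expR (- y))); last exact: cvgr_expR.
apply/cvgryPge => M; near=> t; rewrite -ler_pdivrMl//.
Unshelve. all: end_near. Qed.

Lemma expR_integrable e : 0 < e ->
  leb.-integrable `]0%R, +oo[ (EFin \o (fun t => expR (- (e * t)))).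
Proof.
move=> e0.
apply: (@ge0_FTC_itv0y_integrable R _ (fun t => - e^-1 * expR (- (e * t))) (- e^-1 * 1) (- e^-1 * 0)).
- move=> t _; derive; field; exact: lt0r_neq0.
- move=> t _; apply: (@is_derive_to_continuous _ _ _ (- e * expR (- (e * t)))).
  by derive; ring.
- apply: cvgMr; apply: cvg_at_right_filter.
  suff : {for (0 : R), continuous (fun t => expR (- (e * t)))}
    by move=> h; apply: cvg_trans h _; rewrite mulr0 oppr0 expR0.
  apply: (@is_derive_to_continuous _ (fun t => expR (- (e * t))) 0 (- e * expR (- (e * 0)))).
  by derive; ring.
- by apply: cvgMr; exact: exp_cvgy.
- by move=> t _; exact: expR_ge0.
Qed.

Lemma poissonE e y : 0 < e ->
  \int[leb]_(t in `]0%R, +oo[) (expR (- (e * t)) * cos (t * y)) = poisson e y.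
Proof.
move=> e0; pose c := (e ^+ 2 + y ^+ 2)^-1.
have c0 : e ^+ 2 + y ^+ 2 != 0 by rewrite gt_eqF// sqr_gt0.
(* The antiderivative: the real part of exp(-(e - i y) t) divided by -(e - i y). *)
pose G t := c * (expR (- (e * t)) * (y * sin (t * y) - e * cos (t * y))).
have dG t : 0 < t -> is_derive t 1 G (expR (- (e * t)) * cos (t * y)).
  by move=> _; rewrite /G; derive; rewrite /c; field.
have cf t : 0 < t -> {for t, continuous (fun t => expR (- (e * t)) * cos (t * y))}.
  move=> _; suff [a /is_derive_to_continuous//] : exists a, is_derive t 1 (fun t => expR (- (e * t)) * cos (t * y)) a.
  by eexists; der.
have G0 : G t @[t --> 0^'+] --> - poisson e y.
  have -> : - poisson e y = G 0 by rewrite /G /poisson mulr0 mul0r oppr0 expR0 sin0 cos0 /c; field.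
  apply: cvg_at_right_filter.
  suff [a /is_derive_to_continuous//] : exists a, is_derive (0 : R) 1 G a.
  by rewrite /G; eexists; der.
have Gy : G t @[t --> +oo%R] --> (0 : R).
  rewrite -(mulr0 c); apply: cvgMr.
  apply: norm_cvg0.
  have E : expR (- (e * t)) * (`|y| + e) @[t --> +oo%R] --> (0 : R).
    rewrite -(mul0r (`|y| + e)); apply: cvgMl; exact: exp_cvgy.
  apply: (@squeeze_cvgr _ _ _ _ (cst 0) _ _ _ _ _ E); last exact: cvg_cst.
  apply: nearW => t; rewrite /= normr_ge0/= normrM (ger0_norm (expR_ge0 _)).
  rewrite ler_wpM2l ?expR_ge0//.
  apply: le_trans (ler_normB _ _) _; rewrite !normrM (gtr0_norm e0).
  by apply: lerD; apply: ler_piMr; rewrite ?normr_ge0 ?sin_max ?cos_max ?(ltW e0).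
have I : leb.-integrable `]0%R, +oo[ (EFin \o (fun t => expR (- (e * t)) * cos (t * y))).
  apply: (@integrable_dominated _ _ _ leb _ (measurable_itv _) _ (fun t => expR (- (e * t)))).
  - apply: measurable_funTS; apply: derive_measurable => t; eexists; der.
  - by move=> t _; rewrite normrM (ger0_norm (expR_ge0 _)) ler_piMr ?expR_ge0// cos_max.
  - exact: expR_integrable.
by rewrite (FTC_itv0y dG cf G0 Gy I) sub0r opprK.
Qed.

End Poisson_kernel.

(** * Pointwise inversion by Poisson means *)

Section inversion.
Context {R : realType}.
Notation leb := (@lebesgue_measure R).
Variables (alpha beta : R) (halpha : 1 < alpha < 2).
Variables (mu : probability R R) (hmu : stable_law alpha beta mu).
Variables (p : R -> R) (hp : is_density mu p) (cp : continuous p).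
Implicit Types (e d x y z t : R).

Let kap := beta * tan (pi * alpha / 2).
Let p0 x : 0 <= p x. Proof. by case: hp. Qed.

Let osc x t := gwt alpha 0 t * cos (t * x - kap * t `^ alpha + 0).

Let osc_meas x : measurable_fun setT (osc x).
Proof.
apply: measurable_funM.
  apply: measurable_funM; first exact: measurable_powR.
  apply: measurableT_comp; first exact: measurable_expR.
  by apply: measurableT_comp; [exact: oppr_measurable|exact: measurable_powR].
apply: measurableT_comp.
  by apply: continuous_measurable_fun; exact: continuous_cos.
apply: measurable_funD => //; apply: measurable_funB; first exact: measurable_funM.
by apply: measurable_funM => //; exact: measurable_powR.
Qed.

Let osc_le x t : `|osc x t| <= gwt alpha 0 t.
Proof. by rewrite /osc normrM (ger0_norm (gwt_ge0 _ _ _)) ler_piMr ?gwt_ge0// cos_max. Qed.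

(** [poissonE] writes the kernel as an integral of cosines, and Fubini moves the mean inside, where
    the characteristic function appears. The damping exp(-e t) supplies the majorant. *)
Lemma poisson_mu e x : 0 < e ->
  \int[mu]_z poisson e (x - z) = \int[leb]_(t in `]0%R, +oo[) (expR (- (e * t)) * osc x t).
Proof.
move=> e0.
pose F (z : R) (t : measurableTypeR R) : R := expR (- (e * t)) * cos (t * (x - z)).
have mF : measurable_fun setT (fun z : R * measurableTypeR R => F z.1 z.2).
  apply: measurable_funM.
    apply: measurableT_comp; first exact: measurable_expR.
    apply: measurableT_comp; first exact: oppr_measurable.
    by apply: measurable_funM => //; exact: measurable_snd.
  apply: measurableT_comp.
    by apply: continuous_measurable_fun; exact: continuous_cos.
  apply: measurable_funM; first exact: measurable_snd.
  by apply: measurable_funB => //; exact: measurable_fst.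
have ia : mu.-integrable setT (EFin \o (fun=> 1 : R)).
  by apply: finite_measure_integrable_cst.
have Fab (z : R) (t : measurableTypeR R) : setT z -> `]0%R, +oo[%classic t ->
    `|F z t| <= 1 * expR (- (e * t)).
  by move=> _ _; rewrite mul1r /F normrM (ger0_norm (expR_ge0 _)) ler_piMr ?expR_ge0// cos_max.
have E := @Fubini_dominated _ _ _ _ _ mu leb _ _ measurableT (measurable_itv _) F _ _ mF ia
  (expR_integrable e0) Fab.
transitivity (\int[mu]_z \int[leb]_(t in `]0%R, +oo[) F z t).
  by apply: eq_Rintegral => z _; rewrite -(poissonE (x - z) e0).
rewrite E; apply: (eq_Rintegral leb) => t; rewrite inE/= in_itv/= andbT => t0.
have ic : mu.-integrable setT (EFin \o (fun z : R => cos (t * z + - (t * x)))).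
  apply: (@prob_bounded_integrable _ mu _ 1); last by move=> z; exact: cos_max.
  by apply: derive_measurable => z; eexists; der.
transitivity (\int[mu]_z (expR (- (e * t)) * cos (t * z + - (t * x)))).
  by apply: eq_Rintegral => z _; rewrite /F -cosN; congr (_ * cos _); ring.
have e1 := @RintegralZl _ _ _ mu _ _ (expR (- (e * t))) measurableT ic.
rewrite e1 (stable_cos halpha hmu _ (ltW t0)); congr (_ * _).
rewrite /osc /gwt powRr0 mul1r -[in RHS]cosN; congr (_ * cos _).
by rewrite /kap; ring.
Qed.

Let gwt1_int := \int[leb]_(t in `]0%R, +oo[) gwt alpha 1 t.

(** From 1 - exp(-e t) <= e t; the extra power of t is absorbed by [gwt alpha 1]. *)
Lemma poisson_mu_approx e x : 0 < e ->
  `|\int[mu]_z poisson e (x - z) - osc_int alpha beta 0 0 x| <= e * gwt1_int.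
Proof.
move=> e0; rewrite (poisson_mu x e0).
have i1 : leb.-integrable `]0%R, +oo[ (EFin \o osc x).
  apply: (@integrable_dominated _ _ _ leb _ (measurable_itv _) _ (gwt alpha 0)).
  - exact: (measurable_funTS (osc_meas x)).
  - by move=> t _; exact: osc_le.
  - exact: gwt_integrable.
have i2 : leb.-integrable `]0%R, +oo[ (EFin \o (fun t => expR (- (e * t)) * osc x t)).
  apply: (@integrable_dominated _ _ _ leb _ (measurable_itv _) _ (gwt alpha 0)).
  - apply: measurable_funTS; apply: measurable_funM; last exact: osc_meas.
    by apply: derive_measurable => t; eexists; der.
  - move=> t; rewrite /= in_itv/= andbT => t0; rewrite normrM (ger0_norm (expR_ge0 _)).
    apply: le_trans (osc_le x t); apply: ler_piMl => //.
    by apply: expRN_le1; apply: mulr_ge0; exact: ltW.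
  - exact: gwt_integrable.
have i3 : leb.-integrable `]0%R, +oo[ (EFin \o (fun t => expR (- (e * t)) * osc x t - osc x t)).
  exact: integrable_subr.
have ig : leb.-integrable `]0%R, +oo[ (EFin \o gwt alpha 1) by apply: gwt_integrable.
have ieg : leb.-integrable `]0%R, +oo[ (EFin \o (fun t => e * gwt alpha 1 t)).
  exact: integrable_mulr.
have E := @RintegralB _ _ _ leb _ _ _ (measurable_itv _) i2 i1.
have E2 := @RintegralZl _ _ _ leb _ _ e (measurable_itv _) ig.
have H : `|\int[leb]_(t in `]0%R, +oo[) (expR (- (e * t)) * osc x t - osc x t)| <=
    \int[leb]_(t in `]0%R, +oo[) (e * gwt alpha 1 t).
  apply: le_trans (le_normr_Rintegral _ i3) _ => //.
  apply: le_Rintegral; [exact: measurable_itv|exact: integrable_norm|exact: ieg|].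
  move=> t; rewrite /= in_itv/= andbT => t0.
  have et : 0 <= e * t by apply: mulr_ge0; exact: ltW.
  have -> : expR (- (e * t)) * osc x t - osc x t = - ((1 - expR (- (e * t))) * osc x t) by ring.
  rewrite normrN normrM (ger0_norm (oneBexpRN_ge0 et)).
  have -> : e * gwt alpha 1 t = e * t * gwt alpha 0 t.
    by rewrite /gwt (powRr1 (ltW t0)) powRr0; ring.
  apply: ler_pM => //; [exact: oneBexpRN_ge0|exact: oneBexpRN_le].
by move: H; rewrite E E2.
Qed.

(** [K] depends on the point and on the tolerance [n] but not on the width [e], so [e] can be chosen
    last. *)
Lemma poisson_density_approx x n : 0 < n -> exists K, forall e, 0 < e ->
  `|\int[mu]_z poisson e (x - z) - pi * p x| <= n * pi + e * K.
Proof.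
move=> n0.
have [d /= d0 Hd] : exists2 d : R, 0 < d & forall z, `|x - z| < d -> `|p x - p z| <= n.
  have cx : p z @[z --> x] --> p x := cp (x := x).
  move/cvgrPdist_le: cx => /(_ n n0) /nbhs_ballP[d /= d0 H].
  by exists d.
(* The first term is the factor of [poisson_far] times the mass 1 of [p]; the second is [p x] times
   the factor of [poisson_far1] times the mass pi of the kernel of width 1. *)
exists ((d ^+ 2)^-1 + p x * (1 + (d ^+ 2)^-1) * pi) => e e0.
have mP : measurable_fun setT (fun z : R => poisson e (x - z)).
  apply: continuous_measurable_fun => z; rewrite /poisson; apply: cvgMr; apply: cvgV.
    by rewrite gt_eqF// ltr_pwDl ?sqr_ge0// exprn_gt0.
  apply: cvgD; first exact: cvg_cst.
  apply: (@continuous_comp _ _ _ (fun z => x - z) (fun y => y ^+ 2)); last exact: exprn_continuous.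
  by apply: cvgB; [exact: cvg_cst|exact: cvg_id].
have P_le z : `|poisson e (x - z)| <= e^-1 by rewrite (ger0_norm (poisson_ge0 _ e0)) poisson_le.
have [iPp ->] := integral_density hp mP P_le.
have iP := poisson_integrable x e0.
have iP1 := poisson_integrable x (@ltr01 R).
have ip := density_integrable hp.
have ipxP : leb.-integrable setT (EFin \o (fun z => p x * poisson e (x - z))) by exact: integrable_mulr.
have E1 := @RintegralZl _ _ _ leb _ _ (p x) measurableT iP.
have E2 := @RintegralB _ _ _ leb _ _ _ measurableT iPp ipxP.
rewrite (poisson_Rintegral x e0) in E1; rewrite E1 in E2.
rewrite (mulrC pi (p x)).
pose c2 := e * (d ^+ 2)^-1.
pose c3 := p x * (e * (1 + (d ^+ 2)^-1)).
pose b1 z := n * poisson e (x - z).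
pose b2 z := c2 * p z.
pose b3 z := c3 * poisson 1 (x - z).
have j1 : leb.-integrable setT (EFin \o b1) by exact: integrable_mulr.
have j2 : leb.-integrable setT (EFin \o b2) by exact: integrable_mulr.
have j3 : leb.-integrable setT (EFin \o b3) by exact: integrable_mulr.
have j12 : leb.-integrable setT (EFin \o (fun z => b1 z + b2 z)) by exact: integrable_addr.
have j123 : leb.-integrable setT (EFin \o (fun z => b1 z + b2 z + b3 z)) by exact: integrable_addr.
have F1 := @RintegralZl _ _ _ leb _ _ n measurableT iP.
have F2 := @RintegralZl _ _ _ leb _ _ c2 measurableT ip.
have F3 := @RintegralZl _ _ _ leb _ _ c3 measurableT iP1.
have F12 := @RintegralD _ _ _ leb _ _ _ measurableT j1 j2.
have F123 := @RintegralD _ _ _ leb _ _ _ measurableT j12 j3.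
rewrite (poisson_Rintegral x e0) in F1.
rewrite (density_Rintegral1 hp) in F2.
rewrite (poisson_Rintegral x (@ltr01 R)) in F3.
have i3 : leb.-integrable setT (EFin \o (fun z => poisson e (x - z) * p z - p x * poisson e (x - z))).
  exact: integrable_subr.
have H : `|\int[leb]_z (poisson e (x - z) * p z - p x * poisson e (x - z))| <=
    \int[leb]_z (b1 z + b2 z + b3 z).
  apply: le_trans (le_normr_Rintegral _ i3) _ => //.
  apply: le_Rintegral; [exact: measurableT|exact: integrable_norm|exact: j123|].
  move=> z _.
  have -> : poisson e (x - z) * p z - p x * poisson e (x - z) = - (poisson e (x - z) * (p x - p z)) by ring.
  have P0 := poisson_ge0 (x - z) e0.
  have P1 := poisson_ge0 (x - z) (@ltr01 R).
  rewrite normrN normrM (ger0_norm P0).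
  have c20 : 0 <= c2 by rewrite mulr_ge0 ?invr_ge0 ?sqr_ge0 ?(ltW e0).
  have c30 : 0 <= c3.
    by rewrite !mulr_ge0 ?addr_ge0 ?invr_ge0 ?sqr_ge0 ?(ltW e0).
  have B1 : 0 <= b1 z by rewrite mulr_ge0 ?(ltW n0).
  have B2 : 0 <= b2 z by rewrite mulr_ge0.
  have B3 : 0 <= b3 z by rewrite mulr_ge0.
  have [near_|far] := ltP `|x - z| d.
    apply: (@le_trans _ _ (b1 z)); last by rewrite -addrA lerDl addr_ge0.
    by rewrite /b1 mulrC ler_wpM2r// Hd.
  apply: (@le_trans _ _ (b2 z + b3 z)); last by rewrite -addrA lerDr.
  have q1 := poisson_far e0 d0 far; have q2 := poisson_far1 e0 d0 far.
  have q3 : `|p x - p z| <= p x + p z.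
    by apply: le_trans (ler_normB _ _) _; rewrite !ger0_norm.
  apply: le_trans (ler_wpM2l P0 q3) _; rewrite mulrDr addrC; apply: lerD.
    by rewrite /b2 ler_wpM2r.
  by rewrite /b3 /c3 mulrC -(mulrA (p x)); apply: ler_wpM2l.
move: H; rewrite E2 F123 F12 F1 F2 F3 => H; apply: le_trans H _.
by rewrite le_eqVlt; apply/orP; left; apply/eqP; rewrite /c2 /c3; ring.
Qed.

(** As the width tends to 0, the same Poisson means approach both sides times pi; continuity of [p]
    gives the equality at every point and not only almost everywhere. *)
Lemma density_osc_int x : p x = osc_int alpha beta 0 0 x / pi.
Proof.
have pi0 := @pi_gt0 R.
suff : `|osc_int alpha beta 0 0 x - pi * p x| = 0.
  move/eqP; rewrite normr_eq0 subr_eq0 => /eqP ->.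
  by rewrite mulrAC divff ?mul1r// gt_eqF.
apply/eqP; rewrite eq_le normr_ge0 andbT; apply/ler_addgt0Pr => r r0; rewrite add0r.
(* Half of [r] is spent on the oscillation of [p] near x, where the kernel has mass at most pi, and
   half on the terms linear in the width. The 1 added in [L] keeps it positive. *)
have n0 : 0 < r / 2 / pi by rewrite !divr_gt0.
have [K HK] := poisson_density_approx x n0.
pose L := `|K| + `|gwt1_int| + 1.
have L0 : 0 < L by rewrite ltr_wpDl// addr_ge0.
pose e := r / 2 / L.
have e0 : 0 < e by rewrite !divr_gt0.
have h1 := HK e e0; have h2 := poisson_mu_approx x e0.
rewrite distrC in h2.
have eK : e * K <= e * `|K| by rewrite (ler_pM2l e0) ler_norm.
have eg : e * gwt1_int <= e * `|gwt1_int| by rewrite (ler_pM2l e0) ler_norm.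
have eL : e * L = r / 2 by rewrite /e divfK// gt_eqF.
have rp : r / 2 / pi * pi = r / 2 by rewrite divfK// gt_eqF.
have := ler_distD (\int[mu]_z poisson e (x - z)) (osc_int alpha beta 0 0 x) (pi * p x).
rewrite rp in h1; rewrite /L !mulrDr mulr1 in eL.
by lra.
Qed.

End inversion.

(** * Bounds on the derivatives of the Stein solution *)

Section beta_weight.
Context {R : realType}.
Notation leb := (@lebesgue_measure R).
Variables (alpha : R) (halpha : 1 < alpha < 2).
Implicit Types (v x : R).

Let a1 : 1 < alpha. Proof. by case/andP: halpha. Qed.
Let a2 : alpha < 2. Proof. by case/andP: halpha. Qed.
Let k := alpha^-1.
Let k1 : 0 < 1 - k.
Proof. by rewrite subr_gt0 invf_lt1// (lt_trans _ a1). Qed.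
Let k2 : 0 <= k + k - 1.
Proof.
have : 1 < 2 * k by rewrite ltr_pdivlMr ?mul1r// (lt_trans _ a1).
by move=> ?; lra.
Qed.

Let oneB_cvg : 1 - x @[x --> (1 : R)^'-] --> (0 : R)^'+.
Proof.
move=> A [e /= e0 eA]; exists e => //= x; rewrite /ball_/= => x1 x1'.
by apply: eA => /=; rewrite ?subr_gt0// /ball_/= sub0r normrN.
Qed.

Lemma powR_oneB_integrable :
  leb.-integrable `]0%R, 1%R[ (EFin \o (fun v => (1 - v) `^ (1 - k - 1))).
Proof.
apply: (@ge0_FTC_itv01_integrable R _ (fun v => - (1 - k)^-1 * (1 - v) `^ (1 - k))
  (- (1 - k)^-1 * 1 `^ (1 - k)) (- (1 - k)^-1 * 0)).
- move=> x /andP[_ x1]; have x1' : 0 < 1 - x by rewrite subr_gt0.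
  by derive; field; exact: lt0r_neq0.
- move=> x /andP[_ x1]; have x1' : 0 < 1 - x by rewrite subr_gt0.
  suff [a /is_derive_to_continuous//] : exists a, is_derive x 1 (fun v => (1 - v) `^ (1 - k - 1)) a.
  by eexists; der.
- apply: cvgMr; apply: cvg_at_right_filter.
  suff H : {for (0 : R), continuous (fun v => (1 - v) `^ (1 - k))}.
    by apply: cvg_trans H _; rewrite subr0.
  suff [a /is_derive_to_continuous//] : exists a, is_derive (0 : R) 1 (fun v => (1 - v) `^ (1 - k)) a.
  by eexists; der.
- apply: cvgMr; apply: (cvg_comp (fun x => 1 - x) (fun x => x `^ (1 - k)) oneB_cvg).
  exact: powR_cvg0.
- by move=> x _; exact: powR_ge0.
Qed.

Definition beta_wt v := v `^ (k + k - 1) * (1 - v) `^ (1 - k - 1).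

Let beta_wt_measurable : measurable_fun setT beta_wt.
Proof.
apply: measurable_funM; first exact: measurable_powR.
by apply: (measurableT_comp (measurable_powR _)); exact: measurable_funB.
Qed.

(** As alpha < 2, the exponent 2 / alpha - 1 is nonnegative: the first factor is at most 1, and only
    the singularity at v = 1 counts. *)
Lemma beta_wt_integrable : leb.-integrable `]0%R, 1%R[ (EFin \o beta_wt).
Proof.
apply: (@integrable_dominated _ _ _ leb _ (measurable_itv _) _ _ _ _ powR_oneB_integrable).
  exact: (measurable_funTS beta_wt_measurable).
move=> v; rewrite /= in_itv/= => /andP[v0 v1].
rewrite ger0_norm ?mulr_ge0 ?powR_ge0//; apply: ler_piMl; first exact: powR_ge0.
have := @ge0_ler_powR R _ k2 v 1.
by rewrite !nnegrE powR1 (ltW v0) ler01 => /(_ isT isT (ltW v1)).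
Qed.

Lemma BetaE : Beta (2 / alpha) (1 - alpha^-1) = \int[leb]_(v in `]0%R, 1%R[) beta_wt v.
Proof.
rewrite /Beta /Rintegral integral_itv_bndoo.
  have -> : 2 / alpha = k + k by rewrite /k; ring.
  by [].
apply/measurable_EFinP; apply: measurable_funTS.
have -> : 2 / alpha = k + k by rewrite /k; ring.
exact: beta_wt_measurable.
Qed.

End beta_weight.

Section density_derivative.
Context {R : realType}.
Notation leb := (@lebesgue_measure R).
Variables (alpha beta : R) (halpha : 1 < alpha < 2).
Variables (mu : probability R R) (hmu : stable_law alpha beta mu).
Variables (p : R -> R) (hp : is_density mu p).
Hypothesis pd : forall x, derivable p x 1.
Hypothesis pc : continuous (derive1 p).
Implicit Types (x y z v b : R) (s : seq (R * R * R)).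

Let a1 : 1 < alpha. Proof. by case/andP: halpha. Qed.
Let a0 : 0 < alpha. Proof. exact: lt_trans a1. Qed.
Let k := alpha^-1.
Let p0 x : 0 <= p x. Proof. by case: hp. Qed.
Let dp x : is_derive x 1 p (derive1 p x).
Proof. by apply: DeriveDef => //; rewrite derive1E. Qed.
Let cp : continuous p. Proof. by move=> x; exact: is_derive_to_continuous (dp x). Qed.

Lemma density_derive1E x : derive1 p x = osc_int alpha beta 1 (pi / 2) x / pi.
Proof.
apply: is_derive_to_derive1.
have -> : p = fun x => pi^-1 * osc_int alpha beta 0 0 x.
  by apply/funext => y; rewrite mulrC; exact: density_osc_int.
rewrite mulrC; apply: derive_scale.
by have := osc_int_derive beta halpha 0 x (lexx 0); rewrite !add0r.
Qed.

Lemma density_derive1_integrable : leb.-integrable setT (EFin \o derive1 p).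
Proof.
have [C HC] := osc_int_decay2 beta halpha.
(* The bound on the oscillatory integral and the bound on x^2 times it add up to one on (1 + x^2)
   times it. *)
pose K := (\int[leb]_(t in `]0%R, +oo[) gwt alpha 1 t + C) / pi.
apply: (@integrable_dominated _ _ _ leb _ measurableT _ (fun x => K * (1 + x ^+ 2)^-1)).
- exact: continuous_measurable_fun.
- move=> x _; have x2 : 0 < 1 + x ^+ 2 by rewrite ltr_pwDl ?sqr_ge0.
  rewrite -ler_pdivrMr ?invr_gt0// invrK density_derive1E /K.
  rewrite normrM (gtr0_norm (_ : 0 < pi^-1)) ?invr_gt0 ?pi_gt0// mulrAC ler_pM2r ?invr_gt0 ?pi_gt0//.
  rewrite mulrDr mulr1; apply: lerD; first exact: osc_int_le.
  by apply: le_trans (HC (pi / 2) x); rewrite normrM (ger0_norm (sqr_ge0 x)) mulrC.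
- apply: integrable_mulr => //; exact: oneDsqrV_integrable.
Qed.

(** Decay of order 1 / |x| suffices to remove the boundary terms when integrating by parts against
    [p]. *)
Let p_decay : exists2 C, 0 <= C & forall x, `|x| * p x <= C.
Proof.
have [C HC] := osc_int_decay beta halpha (or_introl (erefl (0:R))).
exists (C / pi).
  by rewrite divr_ge0 ?pi_ge0// (le_trans _ (HC 0 0)).
move=> x; rewrite (density_osc_int halpha hmu hp cp) mulrA ler_pM2r ?invr_gt0 ?pi_gt0//.
by apply: le_trans (HC 0 x); rewrite normrM ler_wpM2l// ler_norm.
Qed.

Let p_cvgy : p x @[x --> +oo%R] --> (0 : R).
Proof.
have [C C0 HC] := p_decay.
apply/cvgrPdist_le => e e0; near=> x.
have x1 : 1 <= x by near: x; apply: nbhs_pinfty_ge; exact: num_real.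
have x0 : 0 < x by exact: lt_le_trans x1.
rewrite sub0r normrN ger0_norm// -(ler_pM2l x0).
have := HC x; rewrite (gtr0_norm x0) => h; apply: le_trans h _.
by rewrite -ler_pdivrMr.
Unshelve. all: end_near. Qed.

Let p_cvgNy : p x @[x --> -oo%R] --> (0 : R).
Proof.
have [C C0 HC] := p_decay.
apply/cvgrPdist_le => e e0; near=> x.
have x1 : x <= -1 by near: x; apply: nbhs_ninfty_le; exact: num_real.
have x0 : x < 0 by apply: le_lt_trans x1 _; rewrite oppr_lt0.
rewrite sub0r normrN ger0_norm//.
have := HC x; rewrite (ltr0_norm x0) => h.
have nx : 0 < - x by rewrite oppr_gt0.
by rewrite -(ler_pM2l nx); apply: le_trans h _; rewrite -ler_pdivrMr// lerNr.
Unshelve. all: end_near. Qed.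

Definition density_variation := \int[leb]_x `|derive1 p x|.

(** Applied below with T' in the role of [s]. The factor 1 / b appears because the z-derivative of
    T'(y + b z) is b T''(y + b z). *)
Lemma trigd_mu_le s y b : 0 < b -> (forall x, `|trigp s x| <= 1) ->
  `|\int[mu]_z trigp (trigd s) (y + b * z)| <= b^-1 * density_variation.
Proof.
move=> b0 s1.
have mW t : measurable_fun setT (fun z : R => trigp t (y + b * z)).
  apply: (measurableT_comp (trigp_measurable t)).
  by apply: measurable_funD => //; exact: measurable_funM.
have dW t z : is_derive z 1 (fun z => trigp t (y + b * z)) (trigp (trigd t) (y + b * z) * b).
  notypeclasses refine (@derive_comp _ (trigp t) (fun z => y + b * z) _ _ _ (trigp_derive t _) _).
  by derive; ring.
have cW t : continuous (fun z => trigp t (y + b * z)).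
  by move=> z; exact: is_derive_to_continuous (dW t z).
have [i1 ->] := integral_density hp (mW (trigd s)) (fun z => trigp_bound (trigd s) _).
have i2 : leb.-integrable setT (EFin \o (fun z => trigp s (y + b * z) * derive1 p z)).
  apply: (@integrable_dominated _ _ _ leb _ measurableT _ (fun z => `|derive1 p z|)).
  - by apply: measurable_funM; [exact: mW|exact: continuous_measurable_fun].
  - by move=> z _; rewrite normrM ler_piMl.
  - exact: (integrable_norm density_derive1_integrable).
have i3 : leb.-integrable setT (EFin \o (fun z => b * (trigp (trigd s) (y + b * z) * p z))).
  exact: integrable_mulr.
pose f z := b * (trigp (trigd s) (y + b * z) * p z) + trigp s (y + b * z) * derive1 p z.
have iF : leb.-integrable setT (EFin \o f) by exact: integrable_addr.
have dG z : is_derive z 1 (fun z => trigp s (y + b * z) * p z) (f z).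
  by notypeclasses refine (derive_eq (derive_mul (dW s z) (dp z)) _); rewrite /f; ring.
have cf : continuous f.
  move=> z; rewrite /f; apply: cvgD.
    by apply: cvgMr; apply: cvgM; [exact: cW|exact: cp].
  by apply: cvgM; [exact: cW|exact: pc].
have squeeze z : `|trigp s (y + b * z) * p z| <= p z.
  by rewrite normrM (ger0_norm (p0 z)); apply: ler_piMl.
have l1 : trigp s (y + b * z) * p z @[z --> -oo%R] --> (0 : R).
  apply: norm_cvg0; apply: (@squeeze_cvgr _ _ _ _ (cst 0) _ _ _ _ _ p_cvgNy); last exact: cvg_cst.
  by apply: nearW => z; rewrite /= normr_ge0/=.
have l2 : trigp s (y + b * z) * p z @[z --> +oo%R] --> (0 : R).
  apply: norm_cvg0; apply: (@squeeze_cvgr _ _ _ _ (cst 0) _ _ _ _ _ p_cvgy); last exact: cvg_cst.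
  by apply: nearW => z; rewrite /= normr_ge0/=.
have E := FTC_setT dG cf l1 l2 iF.
have e1 := @RintegralD _ _ _ leb _ _ _ measurableT i3 i2.
have e2 := @RintegralZl _ _ _ leb _ _ b measurableT i1.
move: E; rewrite /f e1 e2 subrr => /eqP; rewrite addr_eq0 => /eqP {}E.
rewrite ler_pdivlMl// -{1}(gtr0_norm b0) -normrM E normrN.
apply: le_trans (le_normr_Rintegral _ i2) _ => //.
apply: le_Rintegral => //; [exact: integrable_norm|exact: (integrable_norm density_derive1_integrable)|].
by move=> z _; rewrite normrM ler_piMl.
Qed.

Section stein_bounds.
Variables (s : seq (R * R * R)) (s0 : nnfreq s) (s1 : forall x, `|trigp (trigd s) x| <= 1).

Let nnd (t : seq (R * R * R)) : nnfreq t -> nnfreq (trigd t). Proof. by rewrite /nnfreq all_map. Qed.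

Lemma stein_d1_le x : `|stein_d1 alpha beta s x| <= alpha.
Proof.
have k0 : 0 < k by rewrite invr_gt0.
have [ik ikE] := powR_itv01_integral k0.
rewrite stein_d1E normrN -[leRHS]invrK -ikE.
pose f v := v `^ (k - 1) * trigp (trigE alpha beta v (trigd s)) (v `^ k * x).
have fb v : `]0%R, 1%R[%classic v -> `|f v| <= v `^ (k - 1).
  rewrite /= in_itv/= => /andP[v0 v1]; rewrite /f normrM (ger0_norm (powR_ge0 _ _)).
  apply: ler_piMr; first exact: powR_ge0.
  have [i <-] := stable_trigp halpha hmu (v `^ k * x) (nnd s0) (ltW v1).
  apply: le_trans (le_normr_Rintegral _ i) _ => //.
  apply: (@le_trans _ _ (\int[mu]_z (1 : R))).
    apply: le_Rintegral => //; [exact: integrable_norm|by apply: finite_measure_integrable_cst].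
  have m1 : fine (mu [set: R]) = 1 by rewrite probability_setT.
  by rewrite Rintegral_cst// mul1r le_eqVlt; apply/orP; left; apply/eqP; exact: m1.
have iF : leb.-integrable `]0%R, 1%R[ (EFin \o f).
  apply: (@integrable_dominated _ _ _ leb _ (measurable_itv _) _ _ _ fb ik).
  apply: measurable_funTS; apply: measurable_funM; first exact: measurable_powR.
  apply: trigE_measurable => //.
  by apply: measurable_funM => //; exact: measurable_powR.
apply: le_trans (le_normr_Rintegral _ iF) _ => //.
apply: le_Rintegral; [exact: measurable_itv|exact: integrable_norm|exact: ik|exact: fb].
Qed.

Lemma stein_d2_le x : `|stein_d2 alpha beta s x| <= Beta (2 / alpha) (1 - alpha^-1) * density_variation.
Proof.
have ib := beta_wt_integrable halpha.
have iV : leb.-integrable `]0%R, 1%R[ (EFin \o (fun v => density_variation * beta_wt alpha v)).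
  exact: integrable_mulr.
have e1 := @RintegralZl _ _ _ leb _ _ density_variation (measurable_itv _) ib.
rewrite stein_d2E normrN BetaE mulrC -e1.
pose f v := v `^ (k + k - 1) * trigp (trigE alpha beta v (trigd (trigd s))) (v `^ k * x).
have fb v : `]0%R, 1%R[%classic v -> `|f v| <= density_variation * beta_wt alpha v.
  rewrite /= in_itv/= => /andP[v0 v1]; rewrite /f normrM (ger0_norm (powR_ge0 _ _)).
  rewrite /beta_wt mulrCA; apply: ler_wpM2l; first exact: powR_ge0.
  have [i <-] := stable_trigp halpha hmu (v `^ k * x) (nnd (nnd s0)) (ltW v1).
  have b0 : 0 < (1 - v) `^ k by rewrite powR_gt0// subr_gt0.
  apply: le_trans (trigd_mu_le _ b0 s1) _.
  by rewrite -powRN addrAC subrr sub0r mulrC.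
have iF : leb.-integrable `]0%R, 1%R[ (EFin \o f).
  apply: (@integrable_dominated _ _ _ leb _ (measurable_itv _) _ _ _ fb iV).
  apply: measurable_funTS; apply: measurable_funM; first exact: measurable_powR.
  apply: trigE_measurable => //.
  by apply: measurable_funM => //; exact: measurable_powR.
apply: le_trans (le_normr_Rintegral _ iF) _ => //.
apply: le_Rintegral; [exact: measurable_itv|exact: integrable_norm|exact: iV|exact: fb].
Qed.

End stein_bounds.
End density_derivative.

(** * Comparison of the two laws on trigonometric polynomials *)

Section stein_discrepancy.
Context {R : realType}.
Notation leb := (@lebesgue_measure R).
Variables (alpha beta : R) (halpha : 1 < alpha < 2).
Variables (mu : probability R R) (hmu : stable_law alpha beta mu).
Variables (p : R -> R) (hp : is_density mu p).
Hypothesis pd : forall x, derivable p x 1.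
Hypothesis pc : continuous (derive1 p).
Variables (d : measure_display) (T : measurableType d) (P : probability T R).
Variables (X : T -> R) (mX : measurable_fun setT X).
Hypothesis iX : P.-integrable setT (EFin \o X).
Implicit Types (s : seq (R * R * R)).

Let eta := Beta (2 / alpha) (1 - alpha^-1) *
  fine (\int[leb]_y (`|derive1 p y|)%:E)%E.

Definition stein_sup : \bar R :=
  ereal_sup [set `| (\int[P]_w (Lgen alpha beta phi (X w))%:E
     - (alpha^-1)%:E * \int[P]_w (X w * derive1 phi (X w))%:E)%E |%E
     | phi in [set phi : R -> R | C2 phi /\
        (forall x, `|derive1 phi x| <= alpha)%R /\
        (forall x, `|derive1 (derive1 phi) x| <= eta)%R]].

Lemma trigp_stein_sup s : nnfreq s -> (forall x, `|trigp (trigd s) x| <= 1) ->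
  ((`|\int[P]_w trigp s (X w) - \int[mu]_z trigp s z|)%:E <= stein_sup)%E.
Proof.
move=> s0 s1.
set phi := stein_sol alpha beta s.
have phi1 : derive1 phi = stein_d1 alpha beta s by exact: stein_sol_derive1.
have phi2 : derive1 (stein_d1 alpha beta s) = stein_d2 alpha beta s by exact: stein_d1_derive1.
pose k := alpha^-1.
pose m := trigp (trigE alpha beta 0 s) 0.
have mE : \int[mu]_z trigp s z = m.
  rewrite /m; have [_ <-] := stable_trigp halpha hmu 0 s0 ler01.
  by apply: eq_Rintegral => z _; rewrite subr0 powR1 mul1r add0r.
pose A w := trigp s (X w).
pose B w := X w * stein_d1 alpha beta s (X w).
have iA : P.-integrable setT (EFin \o A).
  apply: (@integrable_dominated _ _ _ P _ measurableT _ (fun=> trigM s)).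
  - exact: (measurableT_comp (trigp_measurable s) mX).
  - by move=> w _; exact: trigp_bound.
  - exact: finite_measure_integrable_cst.
have iB : P.-integrable setT (EFin \o B).
  apply: (@integrable_dominated _ _ _ P _ measurableT _ (fun w => alpha * `|X w|)).
  - apply: measurable_funM => //; apply: measurableT_comp => //.
    by apply: derive_measurable => x; exists (stein_d2 alpha beta s x); exact: stein_d1_derive.
  - move=> w _; rewrite normrM mulrC; apply: ler_wpM2r => //.
    exact: (stein_d1_le halpha hmu).
  - by apply: integrable_mulr => //; exact: integrable_norm.
have iAm : P.-integrable setT (EFin \o (fun w => A w - m)).
  by apply: integrable_subr => //; exact: finite_measure_integrable_cst.
have ikB : P.-integrable setT (EFin \o (fun w => k * B w)) by exact: integrable_mulr.
have iL : P.-integrable setT (EFin \o (fun w => A w - m + k * B w)) by exact: integrable_addr.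
(* The Stein equation writes the generator along [X] through integrable functions; this gives its
   mean a finite value and allows it to be split. *)
have LE w : Lgen alpha beta phi (X w) = A w - m + k * B w.
  by have := stein_equation beta halpha (X w) s0; rewrite -/phi -/k -/m /A /B => <-; ring.
rewrite mE; apply: ereal_sup_ubound; exists phi; first split.
- exact: stein_sol_C2.
- rewrite phi1 phi2; split; first exact: (stein_d1_le halpha hmu).
  move=> x; exact: (stein_d2_le halpha hmu hp pd pc s0 s1 x).
have E1 : (\int[P]_w (X w * derive1 phi (X w))%:E = (\int[P]_w B w)%:E)%E.
  by rewrite phi1 fineK//; exact: integrable_fin_num.
have E2 : (\int[P]_w (Lgen alpha beta phi (X w))%:E = (\int[P]_w (A w - m + k * B w))%:E)%E.
  under eq_integral do rewrite LE.
  by rewrite fineK//; exact: integrable_fin_num.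
rewrite E1 E2 -EFinM -EFinB; congr (_%:E); congr (`|_|).
have e1 := @RintegralD _ _ _ P _ _ _ measurableT iAm ikB.
have e2 := @RintegralZl _ _ _ P _ _ k measurableT iB.
have e3 := @RintegralB _ _ _ P _ _ _ measurableT iA (finite_measure_integrable_cst P m measurableT).
have P1 : fine (P [set: T]) = 1 by rewrite probability_setT.
have e4 : \int[P]_w m = m by rewrite Rintegral_cst// -[RHS]mulr1; congr (_ * _); exact: P1.
rewrite e1 e2 e3 e4.
by rewrite -/k; ring.
Qed.

End stein_discrepancy.

(** * Trigonometric approximation of Lipschitz functions *)

Section Bernstein.
Context {R : realType}.
Implicit Types (c d : nat -> R) (u v y : R) (n : nat).

(* De Casteljau's recursion for the Bernstein polynomial with control values
   [c 0, ..., c n]. *)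
Fixpoint bernstein n c u : R :=
  if n is n'.+1 then (1 - u) * bernstein n' c u + u * bernstein n' (fun k => c k.+1) u else c 0%N.

Lemma bernsteinB n c d u :
  bernstein n (fun k => c k - d k) u = bernstein n c u - bernstein n d u.
Proof. by elim: n c d => //= n IH c d; rewrite !IH; ring. Qed.

Lemma bernstein_affine n c a b u :
  bernstein n (fun k => a * c k + b) u = a * bernstein n c u + b.
Proof. by elim: n c => //= n IH c; rewrite !IH; ring. Qed.

Lemma bernstein_le n c d u : 0 <= u <= 1 -> (forall k, c k <= d k) ->
  bernstein n c u <= bernstein n d u.
Proof.
move=> /andP[u0 u1]; elim: n c d => //= n IH c d cd.
by apply: lerD; apply: ler_wpM2l; rewrite ?subr_ge0//; apply: IH.
Qed.

Lemma bernstein_cst n a u : bernstein n (fun=> a) u = a.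
Proof. by elim: n => //= n ->; ring. Qed.

Lemma bernstein_norm n c u M : 0 <= u <= 1 -> (forall k, `|c k| <= M) ->
  `|bernstein n c u| <= M.
Proof.
move=> u01 cM; rewrite ler_norml -{1}(bernstein_cst n (- M) u) -{2}(bernstein_cst n M u).
by apply/andP; split; apply: bernstein_le => // k; have := cM k; rewrite ler_norml => /andP[].
Qed.

(** The slope of a Bernstein polynomial is n times the Bernstein polynomial of the differences of
    its control values. For values f(k / n) these differences are at most L / n, so the Lipschitz
    constant L of f is kept. *)
Lemma bernstein_lip n c u v D : 0 <= u <= 1 -> 0 <= v <= 1 ->
  (forall k, `|c k.+1 - c k| <= D) ->
  `|bernstein n c u - bernstein n c v| <= n%:R * D * `|u - v|.
Proof.
move=> u01 v01; elim: n c => [|n IH] c cD /=; first by rewrite subrr normr0 !mul0r.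
have [u0 u1] := andP u01.
set c' := fun k => c k.+1.
have B := bernstein_norm n v01 cD; rewrite bernsteinB -/c' in B.
have h1 := IH c cD; have h2 := IH c' (fun k => cD k.+1).
rewrite (_ : _ - _ = (1 - u) * (bernstein n c u - bernstein n c v) +
  u * (bernstein n c' u - bernstein n c' v) +
  (u - v) * (bernstein n c' v - bernstein n c v)); last by ring.
apply: le_trans (ler_normD _ _) _.
have -> : n.+1%:R * D * `|u - v| = ((1 - u) * (n%:R * D * `|u - v|) + u * (n%:R * D * `|u - v|)) +
   `|u - v| * D by rewrite -natr1; ring.
apply: lerD; last by rewrite normrM ler_wpM2l.
apply: le_trans (ler_normD _ _) _; rewrite !normrM (ger0_norm u0).
rewrite (ger0_norm (_ : 0 <= 1 - u)) ?subr_ge0//.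
have u1' : 0 <= 1 - u by rewrite subr_ge0.
exact: (lerD (ler_wpM2l u1' h1) (ler_wpM2l u0 h2)).
Qed.

(** The second moment about y of a binomial variable. The recursion replaces y by y - 1, hence the
    induction over all y. *)
Lemma bernstein_variance n u y :
  bernstein n (fun k => (k%:R - y) ^+ 2) u = n%:R * u * (1 - u) + (n%:R * u - y) ^+ 2.
Proof.
elim: n y => [|n IH] y /=; first by ring.
rewrite (IH y); have -> : (fun k => (k.+1%:R - y) ^+ 2) = fun k => (k%:R - (y - 1)) ^+ 2 :> R.
  by apply/funext => k; rewrite -natr1; congr (_ ^+ 2); ring.
by rewrite IH -natr1; ring.
Qed.

Lemma bernstein_approx (f : R -> R) L n u e : 0 <= u <= 1 -> 0 <= L -> 0 < e -> (0 < n)%N ->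
  (forall a b, `|f a - f b| <= L * `|a - b|) ->
  `|bernstein n (fun k => f (k%:R / n%:R)) u - f u| <= L * (e + (n%:R * e)^-1).
Proof.
move=> u01 L0 e0 n0 Lf; have [u0 u1] := andP u01.
have n0' : 0 < n%:R :> R by rewrite ltr0n.
have ne0 : 0 < n%:R * e by rewrite mulr_gt0.
rewrite -{1}(bernstein_cst n (f u) u) -bernsteinB.
(* With a = |k / n - u|, the inequality a <= a^2 / e + e gives a quadratic majorant, whose Bernstein
   polynomial is explicit. *)
pose d k : R := L / (n%:R ^+ 2 * e) * (k%:R - n%:R * u) ^+ 2 + L * e.
have H k : `|f (k%:R / n%:R) - f u| <= d k.
  apply: le_trans (Lf _ _) _; rewrite /d -(mulrA L) -mulrDr; apply: ler_wpM2l => //.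
  have -> : k%:R / n%:R - u = (k%:R - n%:R * u) / n%:R.
    by rewrite mulrBl mulrAC divff ?mul1r// gt_eqF.
  set t := k%:R - n%:R * u.
  have -> : (n%:R ^+ 2 * e)^-1 * t ^+ 2 = (`|t / n%:R|) ^+ 2 / e.
    by rewrite real_normK ?num_real// exprMn exprVn; field; rewrite !gt_eqF.
  set a := `|_|; have a0 : 0 <= a by exact: normr_ge0.
  have -> : a ^+ 2 / e + e = (a ^+ 2 + e ^+ 2) / e by field; rewrite gt_eqF.
  rewrite ler_pdivlMr//.
  have := sqr_ge0 (a - e); have := sqr_ge0 (a + e); rewrite !expr2; nra.
have D : bernstein n d u = L / (n%:R ^+ 2 * e) * (n%:R * u * (1 - u)) + L * e.
  by rewrite bernstein_affine bernstein_variance subrr expr0n addr0.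
apply: (@le_trans _ _ (bernstein n d u)).
  rewrite ler_norml; apply/andP; split; last first.
    by apply: bernstein_le => // k; apply: le_trans (H k); exact: ler_norm.
  have -> : - bernstein n d u = bernstein n (fun k => -1 * d k + 0) u.
    by rewrite (bernstein_affine n d (-1) 0 u); ring.
  apply: bernstein_le => // k; have := H k; rewrite ler_norml => /andP[h _].
  by rewrite mulN1r addr0.
rewrite D [leRHS]mulrDr [leRHS]addrC; apply: lerD => //.
have -> : L / (n%:R ^+ 2 * e) * (n%:R * u * (1 - u)) = L * (n%:R * e)^-1 * (u * (1 - u)).
  by field; rewrite !gt_eqF.
by apply: ler_piMr; [rewrite mulr_ge0// invr_ge0 ltW|nra].
Qed.

End Bernstein.

(** * Closure properties of trigonometric polynomials *)

Section trigonometric_closure.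
Context {R : realType}.
Implicit Types (f g : R -> R) (s : seq (R * R * R)).

Definition trig_poly f := exists2 s, nnfreq s & forall x, f x = trigp s x.

Lemma trig_poly_add f g : trig_poly f -> trig_poly g -> trig_poly (fun x => f x + g x).
Proof.
move=> [s s0 fE] [t t0 gE]; exists (s ++ t); first by rewrite /nnfreq all_cat; apply/andP.
by move=> x; rewrite fE gE /trigp big_cat.
Qed.

Lemma trig_poly_scale a f : trig_poly f -> trig_poly (fun x => a * f x).
Proof.
move=> [s s0 fE]; exists [seq (a * q.1.1, q.1.2, q.2) | q <- s]; first by rewrite /nnfreq all_map.
by move=> x; rewrite fE /trigp big_map mulr_sumr; apply: eq_bigr => q _ /=; rewrite mulrA.
Qed.

Lemma trig_poly_cos a th : trig_poly (fun x => cos (a * x + th)).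
Proof.
have [a0|a0] := leP 0 a.
  by exists [:: (1, a, th)]; rewrite /nnfreq/= ?a0// => x; rewrite /trigp big_seq1 mul1r.
exists [:: (1, - a, - th)]; first by rewrite /nnfreq/= oppr_ge0 ltW.
by move=> x; rewrite /trigp big_seq1 mul1r /= mulNr -opprD cosN.
Qed.

Lemma trig_poly_cst a : trig_poly (fun=> a).
Proof.
have [s s0 sE] := trig_poly_scale a (trig_poly_cos 0 0).
by exists s => // x; rewrite -sE mul0r addr0 cos0 mulr1.
Qed.

(** Product-to-sum formulas, with sines written as cosines shifted by pi / 2. Multiplication by one
    sine is enough, as each step of de Casteljau's recursion has degree one in u. *)
Lemma trig_poly_sinM a f : trig_poly f -> trig_poly (fun x => sin (a * x) * f x).
Proof.
move=> [s _ fE]; elim: s f fE => [|[[c xi] th] s IH] f fE.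
  have [t t0 tE] := trig_poly_cst 0.
  by exists t => // x; rewrite fE -tE /trigp big_nil mulr0.
have [t t0 tE] : trig_poly (fun x => c / 2 * (cos ((a + xi) * x + (th - pi / 2)) +
    cos ((a - xi) * x + (- th - pi / 2))) + sin (a * x) * trigp s x).
  apply: trig_poly_add; last exact: IH.
  by apply: trig_poly_scale; apply: trig_poly_add; exact: trig_poly_cos.
exists t => // x; rewrite -tE fE /trigp big_cons /= mulrDr; congr (_ + _).
have sh y : cos (y - pi / 2) = sin y by rewrite cosB cos_pihalf sin_pihalf mulr0 mulr1 add0r.
rewrite !addrA !sh.
have -> : (a + xi) * x + th = a * x + (xi * x + th) by ring.
have -> : (a - xi) * x - th = a * x - (xi * x + th) by ring.
by rewrite sinD sinB; field.
Qed.

Lemma trig_poly_bernstein n (c : nat -> R) a :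
  trig_poly (fun x => bernstein n c ((1 + sin (a * x)) / 2)).
Proof.
elim: n c => [|n IH] c; first exact: trig_poly_cst.
have H : trig_poly (fun x => (2^-1 * bernstein n c ((1 + sin (a * x)) / 2) +
     (- 2^-1) * (sin (a * x) * bernstein n c ((1 + sin (a * x)) / 2))) +
   (2^-1 * bernstein n (fun k => c k.+1) ((1 + sin (a * x)) / 2) +
     2^-1 * (sin (a * x) * bernstein n (fun k => c k.+1) ((1 + sin (a * x)) / 2)))).
  by apply: trig_poly_add; apply: trig_poly_add; apply: trig_poly_scale => //;
    apply: trig_poly_sinM.
have [s s0 sE] := H; exists s => // x; rewrite -sE /=.
by field.
Qed.

(** The difference quotient with step e / M is at most 1 in absolute value and, by the Taylor bound,
    differs from the derivative by at most e. *)
Lemma trigd_le1 s : (forall x y, `|trigp s x - trigp s y| <= `|x - y|) ->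
  forall x, `|trigp (trigd s) x| <= 1.
Proof.
move=> H x; apply/ler_addgt0Pr => e e0.
pose M := trigM (trigd (trigd s)) + 1.
have M0 : 0 < M by rewrite ltr_wpDl// trigM_ge0.
pose h := e / M.
have h0 : 0 < h by rewrite divr_gt0.
have t := trigp_taylor s x h; have l := H (x + h) x.
rewrite addrAC subrr add0r (gtr0_norm h0) in l.
rewrite -(ler_pM2l h0) -{1}(gtr0_norm h0) -normrM mulrDr mulr1.
have -> : h * trigp (trigd s) x = (trigp s (x + h) - trigp s x) -
  (trigp s (x + h) - trigp s x - h * trigp (trigd s) x) by ring.
apply: le_trans (ler_normB _ _) _; apply: lerD => //.
apply: le_trans t _; rewrite expr2 mulrCA; apply: ler_wpM2l; first exact: ltW.
have -> : e = M * h by rewrite /h mulrCA divff ?mulr1// gt_eqF.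
by rewrite ler_wpM2r ?(ltW h0)// /M lerDl.
Qed.

(* Bernstein polynomials of u |-> h (N (2 u - 1)) at u = (1 + sin (x / N)) / 2. *)
Lemma lipschitz_trigp_approx (h : R -> R) (N e : R) : 0 < N -> 0 < e ->
  (forall x y, `|h x - h y| <= `|x - y|) ->
  exists2 s, nnfreq s & (forall x, `|trigp (trigd s) x| <= 1) /\
    forall x, `|trigp s x - h (N * sin (x / N))| <= e.
Proof.
move=> N0 e0 hl.
pose f u := h (N * (2 * u - 1)).
pose L := 2 * N; have L0 : 0 < L by rewrite mulr_gt0.
have fL a b : `|f a - f b| <= L * `|a - b|.
  apply: le_trans (hl _ _) _; rewrite -{1}(gtr0_norm L0) -normrM /L.
  by rewrite (_ : _ - _ = 2 * N * (a - b))//; ring.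
(* The choice of [n] makes n r^2 > 1, so the error L (r + 1 / (n r)) of [bernstein_approx] is at
   most 2 L r = e. *)
pose r := e / 2 / L; have r0 : 0 < r by rewrite !divr_gt0.
pose n := (Num.truncn (r ^+ 2)^-1).+1.
have n0 : (0 < n)%N by [].
have n0' : 0 < n%:R :> R by rewrite ltr0n.
have nr : (n%:R * r)^-1 <= r.
  have q : (r ^+ 2)^-1 < n%:R by exact: truncnS_gt.
  have r2 : 0 < r ^+ 2 by rewrite exprn_gt0.
  have nr0 : 0 < n%:R * r by exact: mulr_gt0.
  rewrite -[leLHS]mul1r (ler_pdivrMr _ _ nr0) mulrCA -expr2.
  by rewrite -(ler_pdivrMr _ _ r2) mul1r; exact: ltW.
pose U x := (1 + sin (N^-1 * x)) / 2.
have U01 x : 0 <= U x <= 1.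
  have := sin_geN1 (N^-1 * x); have := sin_le1 (N^-1 * x).
  by rewrite /U => ? ?; apply/andP; split; lra.
have [s s0 sE] := trig_poly_bernstein n (fun k => f (k%:R / n%:R)) N^-1.
refine (ex_intro2 _ _ s s0 _); split; last first.
  move=> x; rewrite -sE -/(U x).
  have -> : h (N * sin (x / N)) = f (U x) by rewrite /f /U; congr h; rewrite (mulrC x); field.
  apply: le_trans (bernstein_approx (U01 x) (ltW L0) r0 n0 fL) _.
  apply: (@le_trans _ _ (L * (r + r))); first by rewrite ler_pM2l// lerD2l.
  by rewrite /r; rewrite le_eqVlt; apply/predU1P; left; field; rewrite gt_eqF.
apply: trigd_le1 => x y; rewrite -!sE -/(U x) -/(U y).
have cD k : `|f (k.+1%:R / n%:R) - f (k%:R / n%:R)| <= L / n%:R.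
  apply: le_trans (fL _ _) _; apply: ler_wpM2l; first exact: ltW.
  by rewrite -mulrBl -natrB ?leqnSn// subSnn mul1r ger0_norm// invr_ge0 ltW.
(* The factors are 2 N from [f], 1 / 2 from [U] and 1 / N from the argument of the sine: their
   product is exactly 1. *)
apply: le_trans (bernstein_lip n (U01 x) (U01 y) cD) _.
have -> : n%:R * (L / n%:R) = L by rewrite mulrCA divff ?mulr1// gt_eqF.
rewrite /U -mulrBl opprD addrACA subrr add0r normrM (ger0_norm (_ : 0 <= 2^-1))//.
apply: (@le_trans _ _ (L * (`|N^-1 * x - N^-1 * y| / 2))).
  by rewrite ler_pM2l// ler_pM2r//; exact: ler_norm_sinB.
rewrite -mulrBr normrM (gtr0_norm (_ : 0 < N^-1)) ?invr_gt0// /L.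
by rewrite le_eqVlt; apply/predU1P; left; field; rewrite gt_eqF.
Qed.

End trigonometric_closure.

(** * Truncation of the argument by N sin (x / N) *)

Section Lipschitz_approximation.
Context {R : realType} {d : measure_display} {T : measurableType d}.
Variables (Q : probability T R) (Y : T -> R).
Hypothesis iY : Q.-integrable setT (EFin \o Y).
Implicit Types (h : R -> R) (s : seq (R * R * R)).

Let mY : measurable_fun setT Y.
Proof. by apply/measurable_EFinP; exact: measurable_int iY. Qed.

Let g (N : R) w := `|Y w - N * sin (Y w / N)|.

Let mg N : measurable_fun setT (g N).
Proof.
apply: measurableT_comp => //; apply: measurable_funB => //; apply: measurable_funM => //.
apply: measurableT_comp; first by apply: continuous_measurable_fun; exact: continuous_sin.
exact: measurable_funM.
Qed.

Let gE N w : 0 < N -> g N w = N * `|Y w / N - sin (Y w / N)|.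
Proof.
move=> N0; rewrite /g -[X in _ = X * _](gtr0_norm N0) -normrM mulrBr; congr `|_ - _|.
by rewrite mulrCA divff ?mulr1// gt_eqF.
Qed.

Let g_le N w : 0 < N -> g N w <= 2 * `|Y w|.
Proof.
move=> N0; rewrite (gE _ N0).
apply: le_trans (ler_wpM2l (ltW N0) (norm_subr_sin_le2 _)) _.
rewrite normrM (gtr0_norm (_ : 0 < N^-1)) ?invr_gt0//.
by rewrite le_eqVlt; apply/predU1P; left; field; rewrite gt_eqF.
Qed.

Let g_le2 N w : 0 < N -> g N w <= Y w ^+ 2 / N.
Proof.
move=> N0; rewrite (gE _ N0).
apply: le_trans (ler_wpM2l (ltW N0) (norm_subr_sin_le _)) _.
by rewrite le_eqVlt; apply/predU1P; left; field; rewrite gt_eqF.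
Qed.

Let ig N : 0 < N -> Q.-integrable setT (EFin \o g N).
Proof.
move=> N0; apply: (@integrable_dominated _ _ _ Q _ measurableT _ (fun w => 2 * `|Y w|)) => //.
  by move=> w _; rewrite ger0_norm; [exact: g_le|exact: normr_ge0].
by apply: integrable_mulr => //; exact: integrable_norm.
Qed.

(** The pointwise error is at most Y^2 / N, but [Y] has only a first moment; dominated convergence
    under 2 |Y| replaces a rate. *)
Lemma sine_truncation_cvg0 :
  \int[Q]_w `|Y w - n.+1%:R * sin (Y w / n.+1%:R)| @[n --> \oo] --> (0 : R).
Proof.
have N0 n : 0 < n.+1%:R :> R by rewrite ltr0n.
have i2 : Q.-integrable setT (EFin \o (fun w => 2 * `|Y w|)).
  by apply: integrable_mulr => //; exact: integrable_norm.
have [|||||_ _ /=] := @dominated_convergence _ _ _ Q _ measurableT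
   (fun n => EFin \o g n.+1%:R) (cst 0%E) (EFin \o (fun w => 2 * `|Y w|)).
- by move=> n; exact/measurable_EFinP.
- exact: measurable_cst.
- apply: aeW => w _; apply/fine_cvgP; split; first exact: nearW.
  apply/cvgrPdist_le => e e0; near=> n.
  rewrite sub0r normrN /= ger0_norm ?normr_ge0//.
  apply: le_trans (g_le2 w (N0 n)) _; rewrite (ler_pdivrMr _ _ (N0 n)) mulrC -ler_pdivrMr//.
  apply: le_trans (ltW (truncnS_gt _)) _; rewrite ler_nat ltnS; near: n; exact: nbhs_infty_ge.
- exact: i2.
- apply: aeW => w n _ /=; rewrite lee_fin ger0_norm ?normr_ge0//; exact: g_le.
rewrite integral0 => H.
have {}H : fine (\int[Q]_w (g n.+1%:R w)%:E)%E @[n --> \oo] --> fine 0%E by exact: fine_cvg H.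
exact: H.
Unshelve. all: end_near. Qed.

Lemma lipschitz_integrable h : (forall x y, `|h x - h y| <= `|x - y|) ->
  Q.-integrable setT (EFin \o (h \o Y)).
Proof.
move=> hl.
have ch : continuous h by apply: (@continuous_lipschitz _ _ 1) => x y; rewrite mul1r.
apply: (@integrable_dominated _ _ _ Q _ measurableT _ (fun w => `|h 0| + `|Y w|)).
- exact: (measurableT_comp (continuous_measurable_fun ch) mY).
- move=> w _ /=; have := hl (Y w) 0; rewrite subr0 => H.
  rewrite -[X in `|X|](subrK (h 0)) addrC; apply: le_trans (ler_normD _ _) _.
  by rewrite lerD2l.
- apply: integrable_addr => //; last exact: integrable_norm.
  exact: finite_measure_integrable_cst.
Qed.

Lemma lipschitz_trigp_dist h s (N e : R) : 0 < N ->
  (forall x y, `|h x - h y| <= `|x - y|) ->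
  (forall x, `|trigp s x - h (N * sin (x / N))| <= e) ->
  `|\int[Q]_w h (Y w) - \int[Q]_w trigp s (Y w)| <=
    \int[Q]_w `|Y w - N * sin (Y w / N)| + e.
Proof.
move=> N0 hl hs.
have i1 := lipschitz_integrable hl.
have i2 : Q.-integrable setT (EFin \o (fun w => trigp s (Y w))).
  apply: (@integrable_dominated _ _ _ Q _ measurableT _ (fun=> trigM s)).
  - exact: (measurableT_comp (trigp_measurable s) mY).
  - by move=> w _; exact: trigp_bound.
  - exact: finite_measure_integrable_cst.
have ie : Q.-integrable setT (EFin \o cst e) by exact: finite_measure_integrable_cst.
have e1 := @RintegralB _ _ _ Q _ _ _ measurableT i1 i2.
have e2 := @RintegralD _ _ _ Q _ _ _ measurableT (ig N0) ie.
have Q1 : fine (Q [set: T]) = 1 by rewrite probability_setT.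
have e3 : \int[Q]_w e = e by rewrite Rintegral_cst// -[RHS]mulr1; congr (_ * _); exact: Q1.
have i12 : Q.-integrable setT (EFin \o (fun w => h (Y w) - trigp s (Y w))) by exact: integrable_subr.
have -> : \int[Q]_w h (Y w) - \int[Q]_w trigp s (Y w) = \int[Q]_w (h (Y w) - trigp s (Y w)) by rewrite -e1.
have -> : \int[Q]_w `|Y w - N * sin (Y w / N)| + e = \int[Q]_w (g N w + e) by rewrite e2 e3.
apply: le_trans (le_normr_Rintegral _ i12) _ => //.
apply: le_Rintegral => //; [exact: integrable_norm|exact: integrable_addr (ig N0) ie|].
move=> w _; apply: le_trans (ler_distD (h (N * sin (Y w / N))) _ _) _; apply: lerD.
  exact: hl.
by rewrite distrC.
Qed.

End Lipschitz_approximation.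

Theorem theorem1p2 (R : realType) (alpha beta : R)
  (halpha : 1 < alpha < 2) (hbeta : -1 <= beta <= 1)
  (mu : probability R R) (hmu : stable_law alpha beta mu)
  (p : R -> R) (hp : is_density mu p)
  (hpd : forall x, derivable p x 1) (hpc : continuous (derive1 p)) :
  let eta := Beta (2 / alpha) (1 - alpha^-1) *
             fine (\int[@lebesgue_measure R]_y (`|derive1 p y|)%:E)%E in
  (\int[@lebesgue_measure R]_y (`|derive1 p y|)%:E < +oo)%E /\
  forall (d : measure_display) (T : measurableType d) (P : probability T R)
         (X : T -> R), measurable_fun setT X ->
    P.-integrable setT (EFin \o X) ->
    (dW P X mu <=
     ereal_sup [set `| (\int[P]_w (Lgen alpha beta phi (X w))%:E
                        - (alpha^-1)%:E * \int[P]_w (X w * derive1 phi (X w))%:E)%E |%E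
               | phi in [set phi : R -> R | C2 phi /\
                    (forall x, `|derive1 phi x| <= alpha)%R /\
                    (forall x, `|derive1 (derive1 phi) x| <= eta)%R]])%E.
Proof.
move=> eta; split.
  by have /integrableP[_] := density_derive1_integrable halpha hmu hp hpd hpc.
move=> d T P X mX iX; rewrite /dW; apply: ub_ereal_sup => _ [h /= hl <-].
(* The first moment makes [h] integrable under [mu] and lets the sine truncation apply to that law
   as well. *)
have iZ := stable_first_moment halpha hmu.
have iPh := lipschitz_integrable iX hl; have imh := lipschitz_integrable iZ hl.
have -> : (\int[P]_w (h (X w))%:E = (\int[P]_w h (X w))%:E)%E.
  by rewrite fineK//; exact: integrable_fin_num.
have -> : (\int[mu]_z (h z)%:E = (\int[mu]_z h z)%:E)%E.
  by rewrite fineK//; exact: integrable_fin_num.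
rewrite -EFinB abse_EFin; apply/lee_addgt0Pr => e e0.
(* Two laws, each with a truncation error and an approximation error: four terms of size e / 4. *)
have e4 : 0 < e / 4 by rewrite divr_gt0.
have [n [nP nmu]] : exists n : nat,
    \int[P]_w `|X w - n.+1%:R * sin (X w / n.+1%:R)| <= e / 4 /\
    \int[mu]_z `|z - n.+1%:R * sin (z / n.+1%:R)| <= e / 4.
  have /cvgrPdist_le/(_ _ e4) hP := sine_truncation_cvg0 iX.
  have /cvgrPdist_le/(_ _ e4) hmu' := sine_truncation_cvg0 iZ.
  have [n _ H] := filterI hP hmu'.
  exists n; have := H n (leqnn n); rewrite /= !sub0r !normrN => -[H1 H2].
  by split; [apply: le_trans H1|apply: le_trans H2]; exact: ler_norm.
have [s s0 [s1 sh]] := lipschitz_trigp_approx (ltr0Sn R n) e4 hl.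
have bP := lipschitz_trigp_dist iX (ltr0Sn R n) hl sh.
have bmu := lipschitz_trigp_dist iZ (ltr0Sn R n) hl sh.
apply: le_trans (leeD2r e%:E (trigp_stein_sup halpha hmu hp hpd hpc mX iX s0 s1)).
rewrite -EFinD lee_fin.
set hX := \int[P]_w h (X w) in bP *; set hZ := \int[mu]_z h z in bmu *.
set tX := \int[P]_w trigp s (X w) in bP *; set tZ := \int[mu]_z trigp s z in bmu *.
have -> : hX - hZ = (hX - tX) + (tX - tZ) - (hZ - tZ) by ring.
have := ler_normB ((hX - tX) + (tX - tZ)) (hZ - tZ).
have := ler_normD (hX - tX) (tX - tZ).
by lra.
Qed.
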